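(* Let $(M,\omega)$ be a symplectic manifold. (1) Let $\lambda=\pm1$ and $\ell=\pm1$. Integrable $(\lambda,\ell)$-structures on $(M,\omega)$ interpolate between integrable $(\lambda,0)$-structures and integrable $(0,\ell)$-structures on $(M,\omega)$, in the following sense: if sections of $\mathrm{End}(TM\oplus T^*M)$ of the block forms $$R=\begin{pmatrix} r & 0\\ 0 & t\end{pmatrix}\qquad\text{and}\qquad Q=\begin{pmatrix} 0 & p\\ \theta^\flat & 0\end{pmatrix}$$ (with respect to the splitting $TM\oplus T^*M$, where $\theta$ is a field of bilinear forms on $TM$) are integrable $(\lambda,\ell)$-structures on $(M,\omega)$, then $r$ is an integrable $(\lambda,0)$-structure on $(M,\omega)$ and $\theta$ is an integrable $(0,\ell)$-structure on $(M,\omega)$. (2) Let $\ell=\pm1$. If sections of $\mathrm{End}(TM\oplus T^*M)$ of the block forms $$R=\begin{pmatrix} r & 0\\ 0 & t\end{pmatrix}\qquad\text{and}\qquad Q=\begin{pmatrix} 0 & p\\ \theta^\flat & 0\end{pmatrix}$$ (with respect to the splitting $TM\oplus T^*M$, where $\theta$ is a field of bilinear forms on $TM$) are $(+)$-integrable $(1,\ell)$-structures on $(M,\omega)$, then $r$ is a $(+)$-integrable $(1,0)$-structure on $(M,\omega)$ and $\theta$ is an integrable $(0,\ell)$-structure on $(M,\omega)$.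
   Context: All objects are $C^\infty$. For a smooth manifold $M$ put $\mathbb{T}M=TM\oplus T^*M$, with the split pseudo-Riemannian structure $b(u+\sigma,v+\tau)=\tau(u)+\sigma(v)$ and the Courant bracket $[u+\sigma,v+\tau]=[u,v]+\mathcal L_u\tau-\mathcal L_v\sigma-\tfrac12 d(\tau(u)-\sigma(v))$. For a bilinear form $c$ on $V$, $c^\flat:V\to V^*$ is $c^\flat(u)(v)=c(u,v)$. A real linear isomorphism $S$ with $S^2=\lambda\,\mathrm{id}$, $\lambda=\pm1$, is called split if it has exactly two eigenspaces (in the complexification if $\lambda=-1$), of the same dimension (automatic if $\lambda=-1$). Let $S$ be a smooth section of $\mathrm{End}(\mathbb{T}M)$ with $S^2=\lambda\,\mathrm{id}$, $S$ split and skew-symmetric for $b$. $S$ is a generalized complex structure (if $\lambda=-1$), respectively a generalized paracomplex structure (if $\lambda=1$), if the smooth sections of the $\sqrt\lambda$-eigenbundle and those of the $-\sqrt\lambda$-eigenbundle of $S$ are each closed under the Courant bracket (extended $\mathbb C$-bilinearly to the complexification when $\lambda=-1$). A $(+)$-generalized paracomplex structure is defined like a generalized paracomplex structure, except that closedness is required only for sections of the $1$-eigenbundle. A paracomplex structure on $M$ is a tensor field $r$ of type $(1,1)$ with $r^2=\mathrm{id}$ whose $\pm1$-eigendistributions are integrable and of equal dimension. A complex structure is a tensor field $j$ of type $(1,1)$ with $j^2=-\mathrm{id}$ whose $\pm i$-eigendistributions in $TM\otimes\mathbb C$ are involutive. Let $(M,\omega)$ be a symplectic manifold. - An integrable $(1,0)$-structure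 on $(M,\omega)$ is a paracomplex structure $r$ on $M$ which is skew-symmetric for $\omega$. - An integrable $(-1,0)$-structure is a complex structure on $M$ which is skew-symmetric for $\omega$. - An integrable $(0,1)$-structure ($\mathbb L$-symplectic structure) is a symplectic form $\theta$ on $M$ such that the tensor field $A$ given by $\theta^\flat=\omega^\flat\circ A$ satisfies $A^2=\mathrm{id}$ and is split. - An integrable $(0,-1)$-structure ($\mathbb C$-symplectic structure) is a symplectic form $\theta$ on $M$ such that $A$ given by $\theta^\flat=\omega^\flat\circ A$ satisfies $A^2=-\mathrm{id}$. - A $(+)$-integrable $(1,0)$-structure is a tensor field $r$ of type $(1,1)$ with $r^2=\mathrm{id}$, skew-symmetric for $\omega$, whose $1$-eigendistribution is integrable. For $k=\pm1$ let $I_k=\begin{pmatrix}0&k(\omega^\flat)^{-1}\\ \omega^\flat&0\end{pmatrix}$ on $\mathbb{T}M$. For $\lambda,\ell=\pm1$, an integrable $(\lambda,\ell)$-structure on $(M,\omega)$ is a generalized complex structure (if $\lambda=-1$), resp. generalized paracomplex structure (if $\lambda=1$), $S$ on $M$ such that $SI_{\lambda\ell}=I_{\lambda\ell}S$ and $I_{\lambda\ell}S$ is split. A $(+)$-integrable $(1,\ell)$-structure on $(M,\omega)$ is a $(+)$-generalized paracomplex structure $S$ on $M$ such that $SI_\ell=I_\ell S$ and $SI_\ell$ is split. *)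

(* Defs.v *)
(* MathComp / MathComp-Analysis *)
From mathcomp Require Import all_boot all_order all_algebra.
From mathcomp Require Import complex.
From mathcomp Require Import boolp classical_sets functions reals topology.
From mathcomp Require Import normedtype derive.

Set Implicit Arguments.
Unset Strict Implicit.
Unset Printing Implicit Defensive.

Import Order.TTheory GRing.Theory Num.Theory.
Import numFieldNormedType.Exports.

Local Open Scope classical_set_scope.
Local Open Scope ring_scope.

Section LinearAlgebra.

(* c(x, y) for the bilinear form with Gram matrix G. *)
Definition bilin (F : fieldType) (n : nat) (G : 'M[F]_n) (x y : 'cV[F]_n) : F :=
  (x^T *m G *m y) 0 0.

(* Covectors are columns as well, t acting on v by t(v) = \sum_i t_i v_i. *)
Definition pairing (F : fieldType) (n : nat) (t v : 'cV[F]_n) : F :=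
  (t^T *m v) 0 0.

(* Matrix of u |-> c(u, _): pairing (flat G *m u) v = bilin G u v. *)
Definition flat (F : fieldType) (n : nat) (G : 'M[F]_n) : 'M[F]_n := G^T.

Definition skew_for (F : fieldType) (n : nat) (c : 'cV[F]_n -> 'cV[F]_n -> F)
    (T : 'M[F]_n) : Prop :=
  forall x y, c (T *m x) y = - c x (T *m y).

Definition to_complex (R : rcfType) (m n : nat) (A : 'M[R]_(m, n)) :
  'M[R[i]]_(m, n) := map_mx (fun x : R => x%:C%C) A.

(* [eigenspace] is a space of row vectors, hence the transpositions. *)
Definition two_eigenspaces (F : fieldType) (n : nat) (T : 'M[F]_n) : Prop :=
  exists a b : F,
    [/\ a != b,
        forall c, eigenvalue T^T c <-> (c = a \/ c = b)
      & \rank (eigenspace T^T a) = \rank (eigenspace T^T b)].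

Definition split_iso (R : rcfType) (n : nat) (T : 'M[R]_n) : Prop :=
  (T *m T = 1%:M /\ two_eigenspaces T) \/
  (T *m T = (-1)%:M /\ two_eigenspaces (to_complex T)).

End LinearAlgebra.

Section Smoothness.
Variables (R : realType) (n : nat).

Definition basis_vec (j : 'I_n) : 'cV[R]_n := delta_mx j 0.

(* C^k functions on an open set U; only the values on U matter. *)
Fixpoint Ck (k : nat) (U : set 'cV[R]_n) (f : 'cV[R]_n -> R) : Prop :=
  if k is k'.+1 then
    forall j, (forall x, U x -> derivable f x (basis_vec j)) /\
              Ck k' U ('D_(basis_vec j) f)
  else forall x, U x -> {for x, continuous f}.

Definition smooth (a b : nat) (U : set 'cV[R]_n)
    (f : 'cV[R]_n -> 'M[R]_(a, b)) : Prop :=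
  forall i j k, Ck k U (fun x => f x i j).

Definition jac (m : nat) (f : 'cV[R]_n -> 'cV[R]_m) (x : 'cV[R]_n) :
    'M[R]_(m, n) :=
  \matrix_(i, j) 'D_(basis_vec j) (fun z => f z i 0) x.

End Smoothness.

(* A smooth n-manifold, with one chart [chart p : chart_dom p -> R^n] of its atlas
   singled out around each point p; these charts form an atlas, which generates
   the smooth structure. [chart p] and [chart_inv p] are relevant only on
   [chart_dom p] and on its image. *)
Record manifold (R : realType) (n : nat) := Manifold {
  carrier :> topologicalType;
  manifold_hausdorff : hausdorff_space carrier;
  manifold_second_countable : @second_countable carrier;
  chart_dom : carrier -> set carrier;
  chart : carrier -> carrier -> 'cV[R]_n;
  chart_inv : carrier -> 'cV[R]_n -> carrier;
  dom_open : forall p, open (chart_dom p);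
  dom_center : forall p, chart_dom p p;
  image_open : forall p, open (chart p @` chart_dom p);
  chartK : forall p x, chart_dom p x -> chart_inv p (chart p x) = x;
  chart_continuous :
    forall p x, chart_dom p x -> {for x, continuous (chart p)};
  chart_inv_continuous :
    forall p y, (chart p @` chart_dom p) y -> {for y, continuous (chart_inv p)};
  transition_smooth :
    forall p q, smooth (chart p @` (chart_dom p `&` chart_dom q))
                       (fun y => chart q (chart_inv p y))
}.

(* T_xM is identified with R^n by the coordinate basis of [chart x], T*_xM by
   the dual basis, and T_xM (+) T*_xM with the columns [col_mx u s]. Thus
   vector fields and 1-forms are functions M -> 'cV_n, sections of TM (+) T*M
   are functions M -> 'cV_(n + n), fields of endomorphisms and of bilinear
   forms (Gram matrices) are matrix-valued functions. *)
Section Fields.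
Variables (R : realType) (n : nat) (M : manifold R n).

(* Change from the coordinates of [chart p] to those of [chart q] on T_xM. *)
Definition transition (p q x : M) : 'M[R]_n :=
  jac (fun y => chart q (chart_inv p y)) (chart p x).

Definition gtransition (p q x : M) : 'M[R]_(n + n) :=
  block_mx (transition p q x) 0 0 (transition q p x)^T.

(* Components of a field in [chart q], as functions on the image of the chart *)
Definition vec_in (X : M -> 'cV[R]_n) (q : M) (y : 'cV[R]_n) : 'cV[R]_n :=
  let x := chart_inv q y in transition x q x *m X x.

Definition covec_in (t : M -> 'cV[R]_n) (q : M) (y : 'cV[R]_n) : 'cV[R]_n :=
  let x := chart_inv q y in (transition q x x)^T *m t x.

Definition gvec_in (s : M -> 'cV[R]_(n + n)) (q : M) (y : 'cV[R]_n) :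
    'cV[R]_(n + n) :=
  let x := chart_inv q y in gtransition x q x *m s x.

Definition end_in (A : M -> 'M[R]_n) (q : M) (y : 'cV[R]_n) : 'M[R]_n :=
  let x := chart_inv q y in
  transition x q x *m A x *m transition q x x.

Definition gend_in (S : M -> 'M[R]_(n + n)) (q : M) (y : 'cV[R]_n) :
    'M[R]_(n + n) :=
  let x := chart_inv q y in gtransition x q x *m S x *m gtransition q x x.

Definition form_in (G : M -> 'M[R]_n) (q : M) (y : 'cV[R]_n) : 'M[R]_n :=
  let x := chart_inv q y in (transition q x x)^T *m G x *m transition q x x.

Definition smooth_in_charts (a b : nat) (loc : M -> 'cV[R]_n -> 'M[R]_(a, b)) :
    Prop :=
  forall q, smooth (chart q @` chart_dom q) (loc q).

Definition smooth_vec (X : M -> 'cV[R]_n) := smooth_in_charts (vec_in X).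
Definition smooth_gvec (s : M -> 'cV[R]_(n + n)) :=
  smooth_in_charts (gvec_in s).
Definition smooth_end (A : M -> 'M[R]_n) := smooth_in_charts (end_in A).
Definition smooth_gend (S : M -> 'M[R]_(n + n)) :=
  smooth_in_charts (gend_in S).
Definition smooth_form (G : M -> 'M[R]_n) := smooth_in_charts (form_in G).

Definition lie_bracket (X Y : M -> 'cV[R]_n) (p : M) : 'cV[R]_n :=
  let y := chart p p in
  jac (vec_in Y p) y *m vec_in X p y - jac (vec_in X p) y *m vec_in Y p y.

(* (L_X t)_j = \sum_i (X^i d_i t_j + t_i d_j X^i) *)
Definition lie_derivative (X t : M -> 'cV[R]_n) (p : M) : 'cV[R]_n :=
  let y := chart p p in
  jac (covec_in t p) y *m vec_in X p y + (jac (vec_in X p) y)^T *m covec_in t p y.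

Definition differential (f : M -> R) (p : M) : 'cV[R]_n :=
  \col_j 'D_(basis_vec R j) (fun y => f (chart_inv p y)) (chart p p).

Definition split_form (x y : 'cV[R]_(n + n)) : R :=
  pairing (dsubmx y) (usubmx x) + pairing (dsubmx x) (usubmx y).

Definition courant (s1 s2 : M -> 'cV[R]_(n + n)) (p : M) : 'cV[R]_(n + n) :=
  let u x := usubmx (s1 x) in let sigma x := dsubmx (s1 x) in
  let v x := usubmx (s2 x) in let tau x := dsubmx (s2 x) in
  col_mx (lie_bracket u v p)
         (lie_derivative u tau p - lie_derivative v sigma p
          - 2^-1 *: differential
              (fun x => pairing (tau x) (u x) - pairing (sigma x) (v x)) p).

Section Eigensections.
Variables (a : nat) (sm : (M -> 'cV[R]_a) -> Prop).
Variable br : (M -> 'cV[R]_a) -> (M -> 'cV[R]_a) -> M -> 'cV[R]_a.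

Definition re_part (s : M -> 'cV[R[i]]_a) (p : M) : 'cV[R]_a :=
  map_mx (@complex.Re R) (s p).
Definition im_part (s : M -> 'cV[R[i]]_a) (p : M) : 'cV[R]_a :=
  map_mx (@complex.Im R) (s p).

Definition complex_bracket (s1 s2 : M -> 'cV[R[i]]_a) (p : M) : 'cV[R[i]]_a :=
  to_complex (br (re_part s1) (re_part s2) p - br (im_part s1) (im_part s2) p)
  + 'i%C *: to_complex (br (re_part s1) (im_part s2) p
                        + br (im_part s1) (re_part s2) p).

(* The sections satisfying sm of the c-eigenbundle of T are closed under br. *)
Definition eigen_closed (T : M -> 'M[R]_a) (c : R) : Prop :=
  forall s1 s2, sm s1 -> sm s2 ->
    (forall p, T p *m s1 p = c *: s1 p) ->
    (forall p, T p *m s2 p = c *: s2 p) ->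
    forall p, T p *m br s1 s2 p = c *: br s1 s2 p.

Definition complex_eigen_closed (T : M -> 'M[R]_a) (c : R[i]) : Prop :=
  forall s1 s2 : M -> 'cV[R[i]]_a,
    sm (re_part s1) -> sm (im_part s1) -> sm (re_part s2) -> sm (im_part s2) ->
    (forall p, to_complex (T p) *m s1 p = c *: s1 p) ->
    (forall p, to_complex (T p) *m s2 p = c *: s2 p) ->
    forall p, to_complex (T p) *m complex_bracket s1 s2 p
              = c *: complex_bracket s1 s2 p.

End Eigensections.

Definition almost_generalized (lambda : R) (S : M -> 'M[R]_(n + n)) : Prop :=
  [/\ smooth_gend S,
      forall p, S p *m S p = lambda%:M,
      forall p, split_iso (S p)
    & forall p, skew_for split_form (S p)].

Definition generalized_complex (S : M -> 'M[R]_(n + n)) : Prop :=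
  [/\ almost_generalized (-1) S,
      complex_eigen_closed smooth_gvec courant S 'i%C
    & complex_eigen_closed smooth_gvec courant S (- 'i%C)].

Definition generalized_paracomplex (S : M -> 'M[R]_(n + n)) : Prop :=
  [/\ almost_generalized 1 S,
      eigen_closed smooth_gvec courant S 1
    & eigen_closed smooth_gvec courant S (-1)].

Definition plus_generalized_paracomplex (S : M -> 'M[R]_(n + n)) : Prop :=
  almost_generalized 1 S /\ eigen_closed smooth_gvec courant S 1.

Definition smooth_map (k : nat) (W : set 'cV[R]_k) (F : 'cV[R]_k -> M) : Prop :=
  (forall y, W y -> {for y, continuous F}) /\
  (forall q, smooth (W `&` F @^-1` chart_dom q) (fun y => chart q (F y))).

(* Through every point there is an integral manifold of D: the image of an
   injective immersion F, defined on an open set W of R^k, whose tangent space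
   at each of its points is the value of D there. *)
Definition integrable_distribution (D : forall p : M, set 'cV[R]_n) : Prop :=
  forall p, exists (k : nat) (W : set 'cV[R]_k) (F : 'cV[R]_k -> M),
    [/\ open W /\ (exists2 y, W y & F y = p),
        smooth_map W F,
        (forall y z, W y -> W z -> F y = F z -> y = z)
      & forall y, W y ->
          let dF := jac (fun z => chart (F y) (F z)) y in
          \rank dF = k /\ D (F y) = [set dF *m h | h in [set: 'cV[R]_k]]].

Definition eigendistribution (r : M -> 'M[R]_n) (c : R) (p : M) : set 'cV[R]_n :=
  [set v | r p *m v = c *: v].

Definition paracomplex (r : M -> 'M[R]_n) : Prop :=
  [/\ smooth_end r,
      forall p, r p *m r p = 1%:M,
      integrable_distribution (eigendistribution r 1),
      integrable_distribution (eigendistribution r (-1))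
    & forall p, \rank (eigenspace (r p)^T 1) = \rank (eigenspace (r p)^T (-1))].

Definition complex_structure (j : M -> 'M[R]_n) : Prop :=
  [/\ smooth_end j,
      forall p, j p *m j p = (-1)%:M,
      complex_eigen_closed smooth_vec lie_bracket j 'i%C
    & complex_eigen_closed smooth_vec lie_bracket j (- 'i%C)].

(* (dG)_ijk = d_i G_jk + d_j G_ki + d_k G_ij *)
Definition closed_2form (G : M -> 'M[R]_n) : Prop :=
  forall (p : M) (i j k : 'I_n),
    let d (l a b : 'I_n) :=
      'D_(basis_vec R l) (fun y => form_in G p y a b) (chart p p) in
    d i j k + d j k i + d k i j = 0.

Definition symplectic (G : M -> 'M[R]_n) : Prop :=
  [/\ smooth_form G,
      forall p, (G p)^T = - G p,
      forall p, G p \in unitmx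
    & closed_2form G].

Section OnSymplectic.
Variable omega : M -> 'M[R]_n.

(* Integrable (lambda, 0)-structures, for lambda = 1 or -1 *)
Definition integrable_lambda_0 (lambda : R) (r : M -> 'M[R]_n) : Prop :=
  (if lambda == 1 then paracomplex r else complex_structure r) /\
  (forall p, skew_for (bilin (omega p)) (r p)).

(* Integrable (0, ell)-structures, for ell = 1 or -1 *)
Definition integrable_0_ell (ell : R) (theta : M -> 'M[R]_n) : Prop :=
  symplectic theta /\
  exists A : M -> 'M[R]_n, forall p,
    [/\ flat (theta p) = flat (omega p) *m A p,
        A p *m A p = ell%:M
      & ell = 1 -> split_iso (A p)].

Definition plus_integrable_1_0 (r : M -> 'M[R]_n) : Prop :=
  [/\ smooth_end r,
      forall p, r p *m r p = 1%:M,
      forall p, skew_for (bilin (omega p)) (r p)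
    & integrable_distribution (eigendistribution r 1)].

Definition Imx (k : R) (p : M) : 'M[R]_(n + n) :=
  block_mx 0 (k *: invmx (flat (omega p))) (flat (omega p)) 0.

(* Integrable (lambda, ell)-structures, for lambda, ell = 1 or -1 *)
Definition integrable_lambda_ell (lambda ell : R) (S : M -> 'M[R]_(n + n)) : Prop :=
  [/\ if lambda == 1 then generalized_paracomplex S else generalized_complex S,
      forall p, S p *m Imx (lambda * ell) p = Imx (lambda * ell) p *m S p
    & forall p, split_iso (Imx (lambda * ell) p *m S p)].

Definition plus_integrable_1_ell (ell : R) (S : M -> 'M[R]_(n + n)) : Prop :=
  [/\ plus_generalized_paracomplex S,
      forall p, S p *m Imx ell p = Imx ell p *m S p
    & forall p, split_iso (S p *m Imx ell p)].

End OnSymplectic.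

End Fields.

(* Main.v *)
(** The horizontal part of the [c]-eigenbundle of [R] is the [c]-eigenbundle of [r], on
    which the Courant bracket restricts to the Lie bracket, so closedness of the former
    makes the eigendistributions of [r] involutive and, for real [c], integrable by
    Frobenius. The eigenbundle of [Q] is the graph of a multiple of [theta], and
    closedness of a graph under the Courant bracket says that [d theta = 0]. Everything
    else is pointwise linear algebra: commuting with [I_k] makes [r] skew for [omega],
    hence its eigenspaces equidimensional, and makes [I_k Q] block diagonal with
    blocks similar to multiples of [A].

    Frobenius' theorem is obtained without smooth dependence of flows on parameters. An
    involutive distribution has, locally, a commuting frame [E]; one solves
    [x' = E(x) h] for each small [h] and sets [X h := x 1]. The error
    [x_{y+h}(s) - x_y(s) - s E(x_y(s)) h] satisfies a linear equation up to [O(|h|^2)],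
    precisely because the frame commutes, so that [DX = E o X] and [X] is smooth by
    bootstrapping. Closedness is assumed for global sections only, so local fields are
    extended by bump functions. *)
Require Import Defs.
From HB Require Import structures.
From mathcomp Require Import all_boot all_order all_algebra.
From mathcomp Require Import complex.
From mathcomp Require Import boolp classical_sets functions reals topology.
From mathcomp Require Import normedtype sequences derive landau realfun exp.
From mathcomp Require Import constructive_ereal measure lebesgue_measure.
From mathcomp Require Import lebesgue_integral ftc.
From mathcomp Require Import ring lra.

Set Implicit Arguments.
Unset Strict Implicit.
Unset Printing Implicit Defensive.

Import Order.TTheory GRing.Theory Num.Theory.
Import numFieldNormedType.Exports.

Local Open Scope classical_set_scope.
Local Open Scope ring_scope.

(** * Differentiability in several variables *)

Section Differentiability.
Variable R : realType.

(** Integrability of [r] means integral manifolds for the real eigendistributions but bracket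
    closedness for the complex ones, so Frobenius' theorem is confined to the paracomplex case.
    There the eigendistributions are images of the smooth projectors [(1 + c r) / 2]. A projector
    has locally constant rank by itself, so no global dimension is fixed, and applying it to a
    global extension of a local section gives a global section of the distribution.

    The class C^k is defined by iterated partial derivatives alone; differentiability, the chain
    rule and Schwarz's theorem are recovered from the mean value theorem in the sup norm.

    Time runs over [[-1, 1]], and the parameter [h] is so small that [E(x) h] has Lipschitz constant
    at most 1/2 in [x]: Picard's iteration then contracts at once, without subdividing time.

    For [Q], sections over coordinate fields are bracketed. The bracket is a pure covector, while
    the eigenbundle, being a graph over the tangent bundle, contains no covector but 0; the covector
    vanishes, and it is d theta up to a constant factor. One eigenvalue suffices for this, which
    makes the argument common to (1) and (2). *)

Lemma is_diff_of_approx (V W : normedModType R) (f : V -> W) (x : V)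
    (L : {linear V -> W}) :
  continuous L ->
  (forall e : R, 0 < e ->
     \forall h \near (0 : V), `|f (h + x) - f x - L h| <= e * `|h|) ->
  is_diff x f L.
Proof.
move=> cL fL.
have E : f \o shift x = cst (f x) + L +o_ 0 id.
  apply/eqaddoP => e e0; near=> h.
  rewrite [X in `|X|](_ : _ = f (h + x) - f x - L h); last first.
    by rewrite opprD addrA.
  by near: h; exact: fL.
have D := diff_unique cL E.
by apply: DiffDef => //; apply/diff_locallyP; rewrite D; split.
Unshelve. all: by end_near. Qed.

Lemma near_normP (V : normedModType R) (x : V) (P : set V) :
  (\forall z \near x, P z) <-> exists2 d, 0 < d & forall z, `|z - x| < d -> P z.
Proof.
split=> [/nbhs_normP[d d0 dP]|[d d0 dP]].
  by exists d => // z zx; apply: dP; rewrite /= distrC.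
by apply/nbhs_normP; exists d => // z /=; rewrite distrC; exact: dP.
Qed.

Lemma lipschitz_continuous (V W : normedModType R) (f : V -> W) :
  (forall x y, `|f x - f y| <= `|x - y|) -> continuous f.
Proof.
move=> fl x; apply/cvgrPdist_le => e e0.
apply: (proj2 (near_normP x (fun z => `|f x - f z| <= e))).
by exists e => // z zx; rewrite (le_trans (fl _ _)) // distrC ltW.
Qed.

(** Measuring by the distance to [a] treats [a < b], [b < a] and [a = b] alike, so increments of
    either sign need no case distinction later. *)
Lemma MVT_from0 (f df : R -> R) (a b : R) :
  (forall t, `|t - a| <= `|b - a| -> is_derive t 1 f (df t)) ->
  exists2 c, `|c - a| <= `|b - a| & f b - f a = df c * (b - a).
Proof.
move=> fd.
have dc t : `|t - a| <= `|b - a| -> {for t, continuous f}.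
  move=> /fd ft; apply: differentiable_continuous.
  by apply/derivable1_diffP; exact: ex_derive.
have [ab|ba|->] := ltgtP a b; last by exists b; rewrite ?subrr ?normr0 ?mulr0.
- have sub t : t \in `[a, b] -> `|t - a| <= `|b - a|.
    by rewrite in_itv /= => /andP[? ?]; rewrite !ger0_norm ?lerB ?subr_ge0 // ltW.
  have [c cab E] : exists2 c, c \in `]a, b[ & f b - f a = df c * (b - a).
    apply: MVT => // [t /subset_itv_oo_cc tab|]; first exact/fd/sub.
    by apply: continuous_in_subspaceT => t; rewrite inE => /sub /dc.
  by exists c => //; apply: sub; exact: subset_itv_oo_cc.
- have sub t : t \in `[b, a] -> `|t - a| <= `|b - a|.
    rewrite in_itv /= => /andP[? ?]; rewrite -normrN opprB.
    by rewrite -(normrN (b - a)) opprB !ger0_norm ?lerB ?subr_ge0 // ltW.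
  have [c cab E] : exists2 c, c \in `]b, a[ & f a - f b = df c * (a - b).
    apply: MVT => // [t /subset_itv_oo_cc tab|]; first exact/fd/sub.
    by apply: continuous_in_subspaceT => t; rewrite inE => /sub /dc.
  exists c; first by apply: sub; exact: subset_itv_oo_cc.
  by rewrite -opprB E -mulrN opprB.
Qed.

Lemma continuous_sum (T : topologicalType) (V : normedModType R) (I : Type)
    (r : seq I) (F : I -> T -> V) (x : T) :
  (forall i, {for x, continuous (F i)}) ->
  {for x, continuous (fun z => \sum_(i <- r) F i z)}.
Proof.
move=> Fc; elim: r => [|i r IH].
  have -> : (fun z => \sum_(i <- [::]) F i z) = cst 0.
    by apply/funext => z; rewrite big_nil.
  exact: cvg_cst.
have -> : (fun z => \sum_(j <- i :: r) F j z) = F i \+ (fun z => \sum_(j <- r) F j z).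
  by apply/funext => z; rewrite big_cons.
by apply: continuousD; [exact: Fc|exact: IH].
Qed.

Lemma mx_entry_norm m n (A : 'M[R]_(m, n)) i j : `|A i j| <= `|A|.
Proof. by rewrite [leRHS]/Num.norm /= mx_normrE; exact: (le_bigmax _ _ (i, j)). Qed.

Lemma mx_norm_le m n (A : 'M[R]_(m, n)) (e : R) :
  0 <= e -> (forall i j, `|A i j| <= e) -> `|A| <= e.
Proof.
by move=> e0 Ae; rewrite /Num.norm /= mx_normrE; apply: bigmax_le => // -[i j] _.
Qed.

Variable n : nat.
Implicit Types (f : 'cV[R]_n -> R) (x h : 'cV[R]_n).

Lemma is_derive_line f x (j : 'I_n) (t : R) :
  derivable f (x + t *: basis_vec R j) (basis_vec R j) ->
  is_derive t (1 : R) (fun s : R => f (x + s *: basis_vec R j))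
    ('D_(basis_vec R j) f (x + t *: basis_vec R j)).
Proof.
set v := basis_vec R j => fd.
have E : (fun s : R => s^-1 *: (((fun s : R => f (x + s *: v)) \o shift t) (s *: 1)
            - f (x + t *: v))) =
         (fun s : R => s^-1 *: ((f \o shift (x + t *: v)) (s *: v) - f (x + t *: v))).
  by apply/funext => s /=; rewrite [s *: 1]mulr1 scalerDl addrCA.
by split; rewrite /derivable /derive E.
Qed.

Let trunc (h : 'cV[R]_n) (k : nat) : 'cV[R]_n :=
  \col_i (if (i < k)%N then h i 0 else 0).

(** The segment from [x] to [x + h] is replaced by a path along the coordinate axes through the
    points [x + trunc h j]. The mean value theorem applies to each leg, and in the sup norm the path
    stays in the ball of radius [|h|] around [x]. The vector [c] is an approximate gradient. *)
Lemma C1_increment f x h (c : 'cV[R]_n) (e : R) :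
  (forall j z, `|z - x| <= `|h| -> derivable f z (basis_vec R j)) ->
  (forall j z, `|z - x| <= `|h| -> `|'D_(basis_vec R j) f z - c j 0| <= e) ->
  `|f (h + x) - f x - \sum_j c j 0 * h j 0| <= n%:R * e * `|h|.
Proof.
move=> fd fc.
have T0 : trunc h 0 = 0 by apply/matrixP => i j; rewrite !mxE.
have Tn : trunc h n = h by apply/matrixP => i j; rewrite !mxE ltn_ord ord1.
have -> : f (h + x) - f x = \sum_(j < n) (f (x + trunc h j.+1) - f (x + trunc h j)).
  rewrite -(big_mkord predT (fun j => f (x + trunc h j.+1) - f (x + trunc h j))).
  by rewrite telescope_sumr // Tn T0 addr0 [h + x]addrC.
rewrite -sumrB; apply: le_trans (ler_norm_sum _ _ _) _.
rewrite -mulrA mulr_natl -[X in _ *+ X](card_ord n) -sumr_const.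
apply: ler_sum => j _.
have TS : trunc h j.+1 = trunc h j + h j 0 *: basis_vec R j.
  apply/matrixP => i k; rewrite !mxE ord1 eqxx andbT ltnS leq_eqVlt.
  case: (eqVneq i j) => [->|ij]; first by rewrite eqxx ltnn /= mulr1 add0r.
  by rewrite (negbTE (_ : nat_of_ord i != j)) //= mulr0 addr0.
have near_x t : `|t - 0| <= `|h j 0 - 0| ->
    `|x + trunc h j + t *: basis_vec R j - x| <= `|h|.
  rewrite !subr0 => th; rewrite -[x + _ + _]addrA [x + _]addrC addrK.
  apply: mx_norm_le => // i k; rewrite !mxE ord1 eqxx andbT.
  case: (eqVneq i j) => [->|ij].
    by rewrite ltnn mulr1 add0r (le_trans th) // mx_entry_norm.
  rewrite mulr0 addr0; case: ifP => _; first exact: mx_entry_norm.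
  by rewrite normr0.
have [t th] := @MVT_from0 (fun s => f (x + trunc h j + s *: basis_vec R j))
   (fun s => 'D_(basis_vec R j) f (x + trunc h j + s *: basis_vec R j)) 0 (h j 0)
   (fun t tr => is_derive_line (fd j _ (near_x t tr))).
rewrite TS addrA scale0r addr0 subr0 => ->.
rewrite -mulrBl normrM ler_pM // ?mx_entry_norm //.
exact/fc/near_x.
Qed.

Lemma dot_linear (c : 'cV[R]_n) : linear (fun h : 'cV[R]_n => \sum_j c j 0 * h j 0).
Proof.
move=> a u v; rewrite scaler_sumr -big_split /=; apply: eq_bigr => j _.
by rewrite !mxE mulrDr [a *: _]mulrCA.
Qed.

(** The gradient [c] is a parameter because flows produce it before any partial derivative is known
    to exist. *)
Lemma differentiable_of_dot f x (c : 'cV[R]_n) :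
  (forall e : R, 0 < e -> \forall h \near (0 : 'cV[R]_n),
     `|f (h + x) - f x - \sum_j c j 0 * h j 0| <= e * `|h|) ->
  differentiable f x /\ forall v, 'D_v f x = \sum_j c j 0 * v j 0.
Proof.
pose scallM := GRing.isLinear.Build _ _ _ _ _ (dot_linear c).
pose L : {linear 'cV[R]_n -> R} := HB.pack (fun h : 'cV[R]_n => \sum_j c j 0 * h j 0) scallM.
move=> fc; have [fd fE] : is_diff x f L.
  apply: is_diff_of_approx => // z; apply: continuous_sum => j.
  by apply: continuousM; [exact: cst_continuous|exact: coord_continuous].
by split=> // v; rewrite deriveE // fE.
Qed.

Lemma C1_differentiable f x :
  (forall j, \forall z \near x, derivable f z (basis_vec R j)) ->
  (forall j, {for x, continuous ('D_(basis_vec R j) f)}) ->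
  differentiable f x.
Proof.
move=> fd fc.
pose c : 'cV[R]_n := \col_j 'D_(basis_vec R j) f x.
apply: (proj1 (@differentiable_of_dot f x c _)) => e e0.
(* The divisor is [n + 1] rather than [n] so that it is positive in dimension 0. *)
have e1 : 0 < e / (n%:R + 1) by rewrite divr_gt0 // ltr_wpDl // ler0n.
have near_j j : \forall z \near x, derivable f z (basis_vec R j) /\
    `|'D_(basis_vec R j) f z - c j 0| <= e / (n%:R + 1).
  have /cvgrPdist_le/(_ _ e1) := fc j; apply: filterS2 (fd j) => z zd.
  by rewrite distrC mxE.
have near_all := filter_forall (nbhs_filter x) near_j.
move/near_normP: near_all => [d d0 dP].
apply/near_normP; exists d => // h; rewrite subr0 => hd.
have nx z : `|z - x| <= `|h| -> `|z - x| < d by move=> /le_lt_trans; exact.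
apply: le_trans (C1_increment (c := c) (e := e / (n%:R + 1)) _ _) _.
- by move=> j z /nx/dP/(_ j)[].
- by move=> j z /nx/dP/(_ j)[].
rewrite ler_wpM2r // mulrCA ger_pMr // ler_pdivrMr ?mul1r ?lerDl //.
by rewrite ltr_wpDl // ler0n.
Qed.

Lemma derive_sum_basis f x (v : 'cV[R]_n) : differentiable f x ->
  'D_v f x = \sum_j v j 0 * 'D_(basis_vec R j) f x.
Proof.
move=> fx; rewrite deriveE // {1}(matrix_sum_delta v) linear_sum.
apply: eq_bigr => j _; rewrite big_ord1 linearZ /= -deriveE //.
Qed.

End Differentiability.

(** * Functions of class [C^k] *)

Section Ck.
Variables (R : realType) (n : nat).
Implicit Types (f g : 'cV[R]_n -> R) (x : 'cV[R]_n) (U V : set 'cV[R]_n).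
Local Notation e_ := (basis_vec R).

Lemma Ck_derivable k U f j x : Ck k.+1 U f -> U x -> derivable f x (e_ j).
Proof. by move=> fk; have [+ _] := fk j; apply. Qed.

Lemma Ck_partial k U f j : Ck k.+1 U f -> Ck k U ('D_(e_ j) f).
Proof. by move=> fk; have [_] := fk j. Qed.

(** The definition quantifies over the points of [U] separately, and partial derivatives at a point
    see a full neighbourhood in any case. Smoothness is thus local, and singletons [[set x]] express
    it at a point. *)
Lemma CkP k U f : Ck k U f <-> forall x, U x -> Ck k [set x] f.
Proof.
elim: k f => [|k IH] f /=; split.
- by move=> Uf x Ux _ ->; exact: Uf.
- by move=> Uf x Ux; exact: (Uf x Ux x).
- move=> Uf x Ux j; have [fd fk] := Uf j; split; first by move=> _ ->; exact: fd.
  by move/IH: fk; exact.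
- move=> Uf j; split; first by move=> x Ux; have [fd _] := Uf x Ux j; exact: fd.
  by apply/IH => x Ux; have [_ fk] := Uf x Ux j.
Qed.

Lemma Ck_sub k U V f : V `<=` U -> Ck k U f -> Ck k V f.
Proof. by move=> VU /CkP fU; apply/CkP => x /VU /fU. Qed.

(** Continuity and partial derivatives at a point depend on the germ only; [near_join] spreads the
    local equality to nearby points, which the induction needs for the partial derivatives. *)
Lemma Ck_near k U f g :
  (forall x, U x -> \forall z \near x, f z = g z) -> Ck k U f -> Ck k U g.
Proof.
elim: k f g => [|k IH] f g fg /=.
  move=> fc x Ux; have := fc x Ux; rewrite /prop_for /continuous_at.
  rewrite (nbhs_singleton (fg x Ux)) => h.
  apply: cvg_trans h; exact: near_eq_cvg (fg x Ux).
move=> fk j; have [fd fk'] := fk j; split => [x Ux|].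
  by apply: (near_eq_derivable (fg x Ux)); exact: fd.
apply: IH fk' => x Ux; have /near_join := fg x Ux; apply: filterS => z.
exact: near_eq_derive.
Qed.

Lemma Ck_eq k U f g : open U -> (forall x, U x -> f x = g x) -> Ck k U f -> Ck k U g.
Proof.
move=> oU fg; apply: Ck_near => x Ux; apply: filterS (open_nbhs_nbhs (conj oU Ux)).
exact: fg.
Qed.

Lemma Ck1_differentiable U f x : open U -> Ck 1 U f -> U x -> differentiable f x.
Proof.
move=> oU fk Ux; apply: C1_differentiable => j; have [fd fc] := fk j.
  by apply: filterS (open_nbhs_nbhs (conj oU Ux)) => z; exact: fd.
exact: fc.
Qed.

(** [Ck k.+1] does not ask for continuity of [f] itself; on an open set it follows from continuity
    of the partial derivatives, through differentiability. *)
Lemma CkS k U f : open U -> Ck k.+1 U f -> Ck k U f.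
Proof.
move=> oU; elim: k f => [|k IH] f fk.
  by move=> x Ux; apply: differentiable_continuous; exact: Ck1_differentiable Ux.
by move=> j; have [fd fk'] := fk j; split=> //; exact: IH.
Qed.

Lemma Ck_Ck1 k U f : open U -> Ck k.+1 U f -> Ck 1 U f.
Proof. by move=> oU; elim: k => // k IH /(CkS oU)/IH. Qed.

Lemma CkS_differentiable k U f x :
  open U -> Ck k.+1 U f -> U x -> differentiable f x.
Proof. by move=> oU /(Ck_Ck1 oU) f1; exact: Ck1_differentiable. Qed.

Lemma Ck_cst k U (c : R) : Ck k U (cst c).
Proof.
elim: k c => [|k IH] c; first by move=> x _; exact: cst_continuous.
move=> j; split; first by move=> x _; exact: derivable_cst.
have -> : 'D_(e_ j) (cst c : 'cV[R]_n -> R) = cst 0; last exact: IH.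
by apply/funext => x; rewrite derive_cst.
Qed.

Lemma derive_coord x v (i : 'I_n) : 'D_v (fun z : 'cV[R]_n => z i 0) x = v i 0.
Proof.
apply: lim_near_cst => //; rewrite nearE /=; apply: filterS (@nbhs_dnbhs_neq R 0) => h h0.
by rewrite !mxE addrK; exact: mulKf.
Qed.

Lemma Ck_coord k U (i : 'I_n) : Ck k U (fun z => z i 0).
Proof.
case: k => [|k]; first by move=> x _; exact: coord_continuous.
move=> j; split; first by move=> x _; exact/diff_derivable/differentiable_coord.
have -> : 'D_(e_ j) (fun z : 'cV[R]_n => z i 0) = cst ((e_ j) i 0); last exact: Ck_cst.
by apply/funext => x; rewrite derive_coord.
Qed.

Lemma CkD k U f g : open U -> Ck k U f -> Ck k U g -> Ck k U (fun x => f x + g x).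
Proof.
move=> oU; elim: k f g => [|k IH] f g fk gk.
  by move=> x Ux; apply: continuousD; [exact: fk|exact: gk].
move=> j; have [fd fk'] := fk j; have [gd gk'] := gk j; split => [x Ux|].
  by apply: derivableD; [exact: fd|exact: gd].
apply: Ck_eq (IH _ _ fk' gk') => // x Ux.
by rewrite -deriveD //; [exact: fd|exact: gd].
Qed.

Lemma CkM k U f g : open U -> Ck k U f -> Ck k U g -> Ck k U (fun x => f x * g x).
Proof.
move=> oU; elim: k f g => [|k IH] f g fk gk.
  by move=> x Ux; apply: continuousM; [exact: fk|exact: gk].
move=> j; have [fd fk'] := fk j; have [gd gk'] := gk j; split => [x Ux|].
  by apply: derivableM; [exact: fd|exact: gd].
have H := CkD oU (IH _ _ fk' (CkS oU gk)) (IH _ _ (CkS oU fk) gk').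
apply: Ck_eq H => // x Ux.
rewrite deriveM; [|exact: fd|exact: gd].
by rewrite addrC [X in _ + X]mulrC.
Qed.

Lemma Ck_sum k U (I : Type) (r : seq I) (F : I -> 'cV[R]_n -> R) : open U ->
  (forall i, Ck k U (F i)) -> Ck k U (fun x => \sum_(i <- r) F i x).
Proof.
move=> oU Fk; elim: r => [|i r IH].
  have -> : (fun x => \sum_(i <- [::]) F i x) = cst 0; last exact: Ck_cst.
  by apply/funext => x; rewrite big_nil.
have -> : (fun x => \sum_(j <- i :: r) F j x) =
    (fun x => F i x + \sum_(j <- r) F j x); last exact: CkD.
by apply/funext => x; rewrite big_cons.
Qed.

Lemma Ck_prod k U (I : Type) (r : seq I) (F : I -> 'cV[R]_n -> R) : open U ->
  (forall i, Ck k U (F i)) -> Ck k U (fun x => \prod_(i <- r) F i x).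
Proof.
move=> oU Fk; elim: r => [|i r IH].
  have -> : (fun x => \prod_(i <- [::]) F i x) = cst 1; last exact: Ck_cst.
  by apply/funext => x; rewrite big_nil.
have -> : (fun x => \prod_(j <- i :: r) F j x) =
    (fun x => F i x * \prod_(j <- r) F j x); last exact: CkM.
by apply/funext => x; rewrite big_cons.
Qed.

Lemma CkZ k U (c : R) f : open U -> Ck k U f -> Ck k U (fun x => c * f x).
Proof. by move=> oU; apply: CkM => //; exact: Ck_cst. Qed.

Lemma CkN k U f : open U -> Ck k U f -> Ck k U (fun x => - f x).
Proof.
move=> oU fk; apply: Ck_eq (CkZ (-1) oU fk) => // x _; exact: mulN1r.
Qed.

Lemma CkB k U f g : open U -> Ck k U f -> Ck k U g -> Ck k U (fun x => f x - g x).
Proof. by move=> oU fk gk; apply: CkD => //; exact: CkN. Qed.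

Lemma CkV k U f : open U -> (forall x, U x -> f x != 0) -> Ck k U f ->
  Ck k U (fun x => (f x)^-1).
Proof.
move=> oU f0; elim: k => [|k IH] fk.
  by move=> x Ux; apply: continuousV; [exact: f0|exact: fk].
move=> j; have [fd fk'] := fk j; split => [x Ux|].
  by apply: derivableV; [exact: f0|exact: fd].
have fV := IH (CkS oU fk).
apply: Ck_eq (CkN oU (CkM oU (CkM oU fV fV) fk')) => // x Ux.
rewrite deriveV; [|exact: f0|exact: fd].
by rewrite -[RHS]/(_ * _) mulNr -expr2 exprVn.
Qed.

Lemma smooth_sub a b U V (A : 'cV[R]_n -> 'M[R]_(a, b)) :
  V `<=` U -> smooth U A -> smooth V A.
Proof. by move=> VU sA i j k; exact: Ck_sub (sA i j k). Qed.

Lemma smooth_near a b U (A B : 'cV[R]_n -> 'M[R]_(a, b)) :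
  (forall x, U x -> \forall z \near x, A z = B z) -> smooth U A -> smooth U B.
Proof.
move=> AB sA i j k; apply: Ck_near (sA i j k) => x /AB; apply: filterS => z ->//.
Qed.

Lemma smooth_eq a b U (A B : 'cV[R]_n -> 'M[R]_(a, b)) : open U ->
  (forall x, U x -> A x = B x) -> smooth U A -> smooth U B.
Proof. by move=> oU AB sA i j k; apply: Ck_eq (sA i j k) => // x /AB ->. Qed.

Lemma smoothP a b U (A : 'cV[R]_n -> 'M[R]_(a, b)) :
  smooth U A <-> forall x, U x -> smooth [set x] A.
Proof.
split=> [sA x Ux i j k|sA i j k]; first by have /CkP := sA i j k; exact.
by apply/CkP => x /sA.
Qed.

Lemma smooth_cst a b U (A : 'M[R]_(a, b)) : smooth U (fun=> A).
Proof. by move=> i j k; exact: Ck_cst. Qed.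

Lemma smoothD a b U (A B : 'cV[R]_n -> 'M[R]_(a, b)) : open U ->
  smooth U A -> smooth U B -> smooth U (fun x => A x + B x).
Proof.
move=> oU sA sB i j k; apply: Ck_eq (CkD oU (sA i j k) (sB i j k)) => // x _.
by rewrite mxE.
Qed.

Lemma smoothN a b U (A : 'cV[R]_n -> 'M[R]_(a, b)) : open U ->
  smooth U A -> smooth U (fun x => - A x).
Proof. by move=> oU sA i j k; apply: Ck_eq (CkN oU (sA i j k)) => // x _; rewrite mxE. Qed.

Lemma smoothM a b c U (A : 'cV[R]_n -> 'M[R]_(a, b)) (B : 'cV[R]_n -> 'M[R]_(b, c)) :
  open U -> smooth U A -> smooth U B -> smooth U (fun x => A x *m B x).
Proof.
move=> oU sA sB i j k; pose F l x := A x i l * B x l j.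
apply: (@Ck_eq k U (fun x => \sum_l F l x)) => // [x _|]; first by rewrite mxE.
by apply: Ck_sum => // l; apply: CkM.
Qed.

Lemma smoothZ a b U (f : 'cV[R]_n -> R) (A : 'cV[R]_n -> 'M[R]_(a, b)) :
  open U -> (forall k, Ck k U f) -> smooth U A -> smooth U (fun x => f x *: A x).
Proof.
by move=> oU sf sA i j k; apply: Ck_eq (CkM oU (sf k) (sA i j k)) => // x _; rewrite mxE.
Qed.

Lemma smooth_tr a b U (A : 'cV[R]_n -> 'M[R]_(a, b)) :
  smooth U A -> smooth U (fun x => (A x)^T).
Proof.
move=> sA i j k; have -> : (fun x => (A x)^T i j) = (fun x => A x j i); last exact: sA.
by apply/funext => x; rewrite mxE.
Qed.

Lemma smooth_det a k U (A : 'cV[R]_n -> 'M[R]_a) : open U -> smooth U A ->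
  Ck k U (fun x => \det (A x)).
Proof.
move=> oU sA; apply: Ck_sum => // s; by apply: CkZ => //; exact: Ck_prod.
Qed.

(** Cramer's rule: the cofactors are determinants of submatrices, hence polynomials in the
    entries. *)
Lemma smooth_inv a U (A : 'cV[R]_n -> 'M[R]_a) : open U -> smooth U A ->
  (forall x, U x -> A x \in unitmx) -> smooth U (fun x => invmx (A x)).
Proof.
move=> oU sA uA.
have H : smooth U (fun x => (\det (A x))^-1 *: \adj (A x)).
  apply: smoothZ => // [k|i j k].
    by apply: CkV => // [x /uA|]; [rewrite unitmxE unitfE|exact: smooth_det].
  have E x : \adj (A x) i j = (-1) ^+ (j + i) * \det (row' j (col' i (A x))).
    by rewrite mxE.
  apply: (@Ck_eq k U (fun x => (-1) ^+ (j + i) * \det (row' j (col' i (A x))))) => //.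
  apply: CkZ => //; apply: smooth_det => // i' j' k'.
  by apply: Ck_eq (sA (lift j i') (lift i j') k') => // x _; rewrite !mxE.
by apply: smooth_eq H => // x /uA Ax; rewrite /invmx Ax.
Qed.

Lemma smooth_differentiable U a b (A : 'cV[R]_n -> 'M[R]_(a, b)) x i j :
  open U -> smooth U A -> U x -> differentiable (fun z => A z i j) x.
Proof. by move=> oU sA; exact: (CkS_differentiable oU (sA i j 1%N)). Qed.

End Ck.

(** * The chain rule and composition of smooth maps *)

Section ChainRule.
Variable R : realType.

Lemma differentiable_mx (a b : nat) (W : normedModType R) (h : W -> 'M[R]_(a, b)) x :
  (forall i j, differentiable (fun z => h z i j) x) -> differentiable h x.
Proof.
move=> hd.
have -> : h = \sum_(ij : 'I_a * 'I_b)
    (fun z => h z ij.1 ij.2 *: (delta_mx ij.1 ij.2 : 'M[R]_(a, b))).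
  apply/funext => z; rewrite {1}(matrix_sum_delta (h z)) pair_big /=.
  by rewrite fct_sumE.
elim/big_ind: _ => [|f1 f2|ij _]; first exact: differentiable_cst.
  exact: differentiableD.
by apply: differentiableZl; exact: hd.
Qed.

Lemma derive_comp (m : nat) (W : normedModType R) (g : W -> 'cV[R]_m)
    (f : 'cV[R]_m -> R) (x v : W) :
  differentiable f (g x) -> (forall i, differentiable (fun z => g z i 0) x) ->
  'D_v (f \o g) x =
    \sum_i 'D_(basis_vec R i) f (g x) * 'D_v (fun z => g z i 0) x.
Proof.
move=> fd gd.
have gx : differentiable g x.
  by apply: differentiable_mx => i j; rewrite ord1; exact: gd.
rewrite deriveE; last exact: differentiable_comp.
rewrite diff_comp //= -deriveE // derive_sum_basis //; apply: eq_bigr => i _.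
rewrite mulrC; congr (_ * _).
rewrite -deriveE // derive_mx ?mxE //.
exact: diff_derivable.
Qed.

End ChainRule.

Section Composition.
Variables (R : realType) (m n : nat).
Variables (U : set 'cV[R]_n) (V : set 'cV[R]_m) (g : 'cV[R]_n -> 'cV[R]_m).
Hypotheses (oU : open U) (oV : open V) (gUV : forall x, U x -> V (g x)).

Lemma continuous_mx (a b : nat) (T : topologicalType) (h : T -> 'M[R]_(a, b)) x :
  (forall i j, {for x, continuous (fun z => h z i j)}) -> {for x, continuous h}.
Proof.
move=> hc P [Q Qn QP].
have near_ij i j : \forall z \near x, Q i j (h z i j) by exact/hc/Qn.
have near_i i := filter_forall (nbhs_filter x) (near_ij i).
have near_z := filter_forall (nbhs_filter x) near_i.
by apply: filterS near_z => z hz; exact: QP.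
Qed.

Lemma Ck_comp k (f : 'cV[R]_m -> R) :
  (forall i, Ck k U (fun z => g z i 0)) -> Ck k V f -> Ck k U (f \o g).
Proof.
elim: k f => [|k IH] f gk fk.
  move=> x Ux; apply: continuous_comp; last exact/fk/gUV.
  by apply: continuous_mx => i j; rewrite ord1; exact: gk.
have gd i x : U x -> differentiable (fun z => g z i 0) x.
  exact: (CkS_differentiable oU (gk i)).
have fd x : U x -> differentiable f (g x).
  by move=> /gUV; exact: (CkS_differentiable oV fk).
move=> j; split => [x Ux|].
  apply: diff_derivable; apply: differentiable_comp; last exact: fd.
  by apply: differentiable_mx => i k'; rewrite ord1; exact: gd.
apply: (@Ck_eq _ _ k U (fun x => \sum_i 'D_(basis_vec R i) f (g x)
          * 'D_(basis_vec R j) (fun z => g z i 0) x)) => //.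
  by move=> x Ux; rewrite derive_comp //; [exact: fd|move=> i; exact: gd].
apply: Ck_sum => // i; apply: CkM => //; last by have [_] := gk i j.
apply: (IH ('D_(basis_vec R i) f)); last by have [_] := fk i.
by move=> i'; exact: CkS (gk i').
Qed.

Lemma smooth_comp (a b : nat) (A : 'cV[R]_m -> 'M[R]_(a, b)) :
  smooth U g -> smooth V A -> smooth U (A \o g).
Proof.
move=> sg sA i j k.
exact: (@Ck_comp k (fun y => A y i j)) (fun i' => sg i' 0 k) (sA i j k).
Qed.

End Composition.

(** * Symmetry of second derivatives *)

Section Schwarz.
Variables (R : realType) (n : nat).
Implicit Types (f : 'cV[R]_n -> R) (x : 'cV[R]_n) (U : set 'cV[R]_n).
Local Notation e_ := (basis_vec R).

(** The mean value theorem is applied along [e_i] to the difference [g], then along [e_j]. The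
    second difference is symmetric in [i] and [j], and this is what forces the mixed derivatives to
    agree. *)
Lemma second_difference f x (r : R) (i j : 'I_n) :
  (forall k z, `|z - x| <= r *+ 2 -> derivable f z (e_ k)) ->
  (forall k l z, `|z - x| <= r *+ 2 -> derivable ('D_(e_ k) f) z (e_ l)) ->
  0 <= r ->
  exists2 z, `|z - x| <= r *+ 2 &
    (f (x + r *: e_ i + r *: e_ j) - f (x + r *: e_ i) - f (x + r *: e_ j) + f x)
    = r ^+ 2 * 'D_(e_ j) ('D_(e_ i) f) z.
Proof.
move=> fd fdd r0.
have e1 k : `|e_ k| <= 1.
  by apply: mx_norm_le => // a b; rewrite mxE normr_nat lern1 leq_b1.
have close s t : `|s| <= r -> `|t| <= r -> `|x + s *: e_ i + t *: e_ j - x| <= r *+ 2.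
  move=> sr tr; rewrite -[x + _ + _]addrA [x + _]addrC addrK.
  apply: le_trans (ler_normD _ _) _; rewrite mulr2n.
  by apply: lerD; rewrite normrZ; [apply: (le_trans _ sr)|apply: (le_trans _ tr)];
    rewrite ler_piMr // e1.
pose g s := f (x + r *: e_ j + s *: e_ i) - f (x + s *: e_ i).
have [|s] := @MVT_from0 _ g (fun s => 'D_(e_ i) f (x + r *: e_ j + s *: e_ i)
    - 'D_(e_ i) f (x + s *: e_ i)) 0 r.
  rewrite !subr0 => s; rewrite subr0 (ger0_norm r0) => sr.
  have d1 : derivable f (x + r *: e_ j + s *: e_ i) (e_ i).
    apply: fd; rewrite [x + _ + s *: _]addrAC.
    by apply: (close s r) => //; rewrite ger0_norm.
  have d2 : derivable f (x + s *: e_ i) (e_ i).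
    apply: fd; have := close s 0 sr; rewrite scale0r addr0 normr0.
    exact.
  exact: (is_deriveB (is_derive_line d1) (is_derive_line d2)).
rewrite !subr0 (ger0_norm r0) => sr gE.
have [|t] := @MVT_from0 _ (fun t => 'D_(e_ i) f (x + s *: e_ i + t *: e_ j))
    (fun t => 'D_(e_ j) ('D_(e_ i) f) (x + s *: e_ i + t *: e_ j)) 0 r.
  move=> t; rewrite !subr0 (ger0_norm r0) => tr.
  by apply: is_derive_line; apply: fdd; exact: close.
rewrite !subr0 (ger0_norm r0) scale0r addr0 => tr hE.
exists (x + s *: e_ i + t *: e_ j); first exact: close.
rewrite expr2 -mulrA [r * 'D__ _ _]mulrC -hE.
have := gE; rewrite /g scale0r !addr0 [x + _ + s *: _]addrAC [_ * r]mulrC => <-.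
rewrite [x + r *: e_ j + _]addrAC.
by move: (f _) (f _) (f _) (f x) => a b c d; rewrite opprB addrA addrAC.
Qed.

Lemma distr_le_halves (a b c e : R) :
  `|a - c| <= e / 2 -> `|b - c| <= e / 2 -> `|a - b| <= e.
Proof.
move=> ac bc; rewrite -(subrKA c) (le_trans (ler_normD _ _)) //.
by rewrite [leRHS]splitr lerD // distrC.
Qed.

Lemma derive_comm U f x (i j : 'I_n) : open U -> Ck 2 U f -> U x ->
  'D_(e_ i) ('D_(e_ j) f) x = 'D_(e_ j) ('D_(e_ i) f) x.
Proof.
move=> oU fk Ux; apply/eqP; rewrite -subr_eq0 -normr_le0.
apply/ler_addgt0Pl => e e0; rewrite addr0.
have e2 : 0 < e / 2 by rewrite divr_gt0.
have cont k l : {for x, continuous ('D_(e_ k) ('D_(e_ l) f))}.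
  by have [_ /(_ k)[_]] := fk l; apply.
have near1 := open_nbhs_nbhs (conj oU Ux).
have near2 : \forall z \near x, `|'D_(e_ i) ('D_(e_ j) f) x - 'D_(e_ i) ('D_(e_ j) f) z| <= e / 2.
  by have /cvgrPdist_le/(_ _ e2) := cont i j; exact.
have near3 : \forall z \near x, `|'D_(e_ j) ('D_(e_ i) f) x - 'D_(e_ j) ('D_(e_ i) f) z| <= e / 2.
  by have /cvgrPdist_le/(_ _ e2) := cont j i; exact.
have near_all : \forall z \near x, [/\ U z,
    `|'D_(e_ i) ('D_(e_ j) f) x - 'D_(e_ i) ('D_(e_ j) f) z| <= e / 2 &
    `|'D_(e_ j) ('D_(e_ i) f) x - 'D_(e_ j) ('D_(e_ i) f) z| <= e / 2].
  by apply: filterS3 near1 near2 near3 => z.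
move/near_normP: near_all => [d d0 dP].
pose r := d / 4.
have r0 : 0 < r by rewrite divr_gt0.
have rd : r *+ 2 < d by rewrite /r; lra.
have nearU z : `|z - x| <= r *+ 2 -> U z by move=> zr; have [] := dP z (le_lt_trans zr rd).
have fd k z : `|z - x| <= r *+ 2 -> derivable f z (e_ k).
  by move=> /nearU Uz; have [+ _] := fk k; apply.
have fdd k l z : `|z - x| <= r *+ 2 -> derivable ('D_(e_ k) f) z (e_ l).
  by move=> /nearU Uz; have [_ /(_ l)[+ _]] := fk k; apply.
have [z1 z1r E1] := second_difference i j fd fdd (ltW r0).
have [z2 z2r E2] := second_difference j i fd fdd (ltW r0).
(* Both are the same second difference divided by [r ^+ 2]; the two mixed derivatives agree at
   different points [z1] and [z2], and continuity carries this to [x]. *)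
have E : 'D_(e_ j) ('D_(e_ i) f) z1 = 'D_(e_ i) ('D_(e_ j) f) z2.
  have r2 : r ^+ 2 != 0 by rewrite expf_neq0 // gt_eqF.
  move: E1 E2; rewrite [x + r *: e_ j + _]addrAC => E1 E2.
  suff : r ^+ 2 * 'D_(e_ j) ('D_(e_ i) f) z1 = r ^+ 2 * 'D_(e_ i) ('D_(e_ j) f) z2.
    exact: mulfI.
  exact: etrans (esym E1) (etrans (congr1 (+%R^~ (f x)) (addrAC _ _ _)) E2).
have [_ _ h1] := dP z1 (le_lt_trans z1r rd).
have [_ h2 _] := dP z2 (le_lt_trans z2r rd).
apply: distr_le_halves h2 _; rewrite -E; exact: h1.
Qed.

End Schwarz.

(** * Ordinary differential equations *)

Section Paths.
Variable R : realType.

Lemma antiderivative (f : R -> R) : continuous f ->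
  exists F : R -> R, F 0 = 0 /\ forall t : R, `|t| <= 1 -> is_derive t (1 : R) F (f t).
Proof.
move=> fc; pose mu := @lebesgue_measure R.
(* Integrating from -2 keeps [[-1, 1]] in the interior of the interval [[-2, 2]] where the
   fundamental theorem is applied, so the derivative is two-sided at the ends as well. *)
pose F0 (t : R) : R := (\int[mu]_(s in [set` `[-2, t]]) f s)%R.
exists (fun t => F0 t - F0 0); split=> [|t t1]; first exact: subrr.
have /andP[t2 t2'] : -2 < t < 2.
  by move: t1; rewrite ler_norml => /andP[? ?]; apply/andP; split; lra.
have fi : mu.-integrable `[-2, 2] (EFin \o f).
  apply: continuous_compact_integrable; first exact: segment_compact.
  exact: continuous_subspaceT.
have [Fd FE] := continuous_FTC1_closed t2' fi t2 (fc t).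
have F0d : is_derive t 1 F0 (f t) by split; [exact: Fd|rewrite -derive1E].
have := is_deriveB F0d (is_derive_cst (F0 0) t 1); rewrite subr0; exact.
Qed.

Variable n : nat.
Implicit Types (F f : R -> 'cV[R]_n).

(** The interval is symmetric around the initial time 0 and contains the time 1 at which flows are
    evaluated; derivatives are two-sided even at its ends. *)
Definition path_derive F f :=
  forall t : R, `|t| <= 1 -> forall i, is_derive t (1 : R) (fun s => F s i 0) (f t i 0).

Lemma path_antiderivative f : continuous f -> exists2 F, F 0 = 0 & path_derive F f.
Proof.
move=> fc.
have fi i : continuous (fun t => f t i 0).
  move=> t; apply: (@continuous_comp _ _ _ f (fun A : 'cV[R]_n => A i 0)).
    exact: fc.
  exact: coord_continuous.
have [F FP] := choice (fun i => antiderivative (fi i)).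
exists (fun t => \col_i F i t); first by apply/colP => i; rewrite !mxE; case: (FP i).
move=> t t1 i; have [_ /(_ t t1)] := FP i.
by have -> : (fun s => (\col_i0 F i0 s : 'cV[R]_n) i 0) = F i by apply/funext => s; rewrite mxE.
Qed.

Lemma path_continuous F f t : path_derive F f -> `|t| <= 1 -> {for t, continuous F}.
Proof.
move=> Ff t1; apply: continuous_mx => i j; rewrite ord1.
apply: differentiable_continuous; apply/derivable1_diffP.
by have [] := Ff t t1 i.
Qed.

Lemma path_bound F f c : 0 <= c -> path_derive F f ->
  (forall t, `|t| <= 1 -> `|f t| <= c) ->
  forall s, `|s| <= 1 -> `|F s - F 0| <= c.
Proof.
move=> c0 Ff fc s s1; apply: mx_norm_le => // i j; rewrite ord1 !mxE.
have [|t] := @MVT_from0 _ (fun t => F t i 0) (fun t => f t i 0) 0 s.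
  by move=> t; rewrite !subr0 => ts; apply: Ff; exact: le_trans s1.
rewrite !subr0 => ts ->; rewrite normrM.
rewrite -[leRHS]mulr1 ler_pM // (le_trans (mx_entry_norm _ _ _)) // fc //.
exact: le_trans s1.
Qed.

(* With Lipschitz constant 1/2 on an interval of length 1, taking suprema
   replaces Gronwall's exponential. *)
Lemma path_gronwall F f c : path_derive F f ->
  (forall t, `|t| <= 1 -> `|f t| <= 2^-1 * `|F t - F 0| + c) ->
  forall s, `|s| <= 1 -> `|F s - F 0| <= 2 * c.
Proof.
move=> Ff fc.
have norm1 t : (t \in `[(-1 : R), 1]) = (`|t| <= 1) by rewrite in_itv /= ler_norml.
have [t0] : exists2 t0, t0 \in `[(-1 : R), 1] &
    forall t, t \in `[(-1 : R), 1] -> `|F t - F 0| <= `|F t0 - F 0|.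
  apply: (@EVT_max R (fun t => `|F t - F 0|)); first by lra.
  apply: continuous_in_subspaceT => t; rewrite inE /= norm1 => t1.
  apply: (@continuous_comp _ _ _ (fun t => F t - F 0) Num.norm).
    by apply: continuousB; [exact: path_continuous Ff t1|exact: cst_continuous].
  exact: norm_continuous.
rewrite norm1 => t01 t0max.
set m := `|F t0 - F 0|.
have m0 : 0 <= m by exact: normr_ge0.
have fm t : `|t| <= 1 -> `|f t| <= 2^-1 * m + c.
  move=> t1; apply: le_trans (fc t t1) _; rewrite lerD2r ler_pM2l ?invr_gt0 //.
  by apply: t0max; rewrite norm1.
have c0 : 0 <= 2^-1 * m + c by apply: le_trans (fm 0 _); rewrite ?normr0.
have mc : m <= 2^-1 * m + c by exact: path_bound c0 Ff fm t0 t01.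
move=> s s1; apply: le_trans (_ : m <= _); first by apply: t0max; rewrite norm1.
by move: mc; clear; lra.
Qed.

End Paths.

(** * Limits of geometrically convergent sequences *)

Section GeometricLimits.
Variable R : realType.

Lemma le0_of_half_powers (x c : R) : (forall m, x <= c * 2^-1 ^+ m) -> x <= 0.
Proof.
move=> xc; rewrite leNgt; apply/negP => x0.
have [m mE] : exists m : nat, c / x < m%:R.
  exists (Num.bound `|c / x|).
  exact: le_lt_trans (ler_norm _) (archi_boundP (normr_ge0 _)).
have := xc m; rewrite exprVn ler_pdivlMr ?exprn_gt0 // leNgt => /negP; apply.
rewrite mulrC -ltr_pdivrMr // (lt_trans mE) // -natrX ltr_nat ltn_expl //.
Qed.

(** The intervals of radius [d m] around [u m] are nested, because [2 B 2^-m] is the tail of the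
    geometric series. The limit is the supremum of their left ends, and the rate comes with it. *)
Lemma geometric_limit (u : nat -> R) (B : R) : 0 <= B ->
  (forall m, `|u m.+1 - u m| <= B * 2^-1 ^+ m) ->
  exists l, forall m, `|l - u m| <= 2 * B * 2^-1 ^+ m.
Proof.
move=> B0 uB; pose d m := 2 * B * 2^-1 ^+ m : R.
have d0 m : 0 <= d m by rewrite !mulr_ge0 // exprn_ge0 // invr_ge0.
have dS m : d m.+1 = d m - B * 2^-1 ^+ m by rewrite /d exprS; field.
have lo m : u m - d m <= u m.+1 - d m.+1.
  by move: (uB m); rewrite dS ler_norml => /andP[? ?]; lra.
have hi m : u m.+1 + d m.+1 <= u m + d m.
  by move: (uB m); rewrite dS ler_norml => /andP[? ?]; lra.
have lo_mono m k : u m - d m <= u (m + k)%N - d (m + k)%N.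
  by elim: k => [|k IH]; rewrite ?addn0 // addnS; exact: le_trans (lo _).
have hi_mono m k : u (m + k)%N + d (m + k)%N <= u m + d m.
  by elim: k => [|k IH]; rewrite ?addn0 // addnS; exact: le_trans (hi _) IH.
have cross m k : u m - d m <= u k + d k.
  have [mk|/ltnW mk] := leqP m k.
    rewrite -(subnKC mk); apply: le_trans (lo_mono m (k - m)%N) _.
    by rewrite lerD2l (le_trans _ (d0 _)) // oppr_le0.
  rewrite -(subnKC mk); apply: le_trans (hi_mono k (m - k)%N).
  by rewrite lerD2l (le_trans _ (d0 _)) // oppr_le0.
pose A := [set u m - d m | m in [set: nat]].
exists (sup A) => m; rewrite ler_norml; apply/andP; split.
  rewrite lerBrDl; apply: ub_le_sup; last by exists m.
  by exists (u 0%N + d 0%N) => _ [k _ <-].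
rewrite lerBlDl; apply: ge_sup; first by exists (u 0%N - d 0%N); exists 0%N.
by move=> _ [k _ <-].
Qed.

End GeometricLimits.

Section Clamp.
Variable R : realType.

(** The nearest-point projection onto [[a - r, a + r]]. It is 1-Lipschitz, so composing with it
    extends a field from an interval or box with the same Lipschitz constant. *)
Definition clamp (a r t : R) : R :=
  if t < a - r then a - r else if a + r < t then a + r else t.

Lemma clamp_le a r t : 0 <= r -> `|clamp a r t - a| <= r.
Proof.
move=> r0; rewrite ler_norml /clamp.
by case: (ltP t (a - r)) => [?|?]; [|case: (ltP (a + r) t) => ?]; apply/andP; split; lra.
Qed.

Lemma clamp_id a r t : `|t - a| <= r -> clamp a r t = t.
Proof.
rewrite ler_norml /clamp => /andP[? ?].
by case: (ltP t (a - r)) => [?|?]; [|case: (ltP (a + r) t) => ?]; lra.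
Qed.

Lemma clamp_lip a r s t : 0 <= r -> `|clamp a r s - clamp a r t| <= `|s - t|.
Proof.
move=> r0; have := ler_norm (s - t); have := ler_norm (t - s).
rewrite [`|t - s|]distrC; move: `|s - t| => c ? ?; rewrite ler_norml /clamp.
by case: (ltP s (a - r)) => [?|?]; [|case: (ltP (a + r) s) => ?];
   case: (ltP t (a - r)) => [?|?]; try (case: (ltP (a + r) t) => ?);
   apply/andP; split; lra.
Qed.

End Clamp.

(** * Existence of solutions by Picard iteration *)

Section Picard.
Variables (R : realType) (n : nat) (G : 'cV[R]_n -> 'cV[R]_n) (x0 : 'cV[R]_n).
Hypothesis G_lip : forall x y, `|G x - G y| <= 2^-1 * `|x - y|.

(** Antiderivatives are controlled on [[-1, 1]] only; clamping time makes the Picard iterates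
    continuous, and their estimates valid, on the whole line. *)
Let clamp1 (t : R) : R := clamp 0 1 t.

Let clamp1_le t : `|clamp1 t| <= 1.
Proof. by have := @clamp_le R 0 1 t ler01; rewrite subr0. Qed.

Let clamp1_id t : `|t| <= 1 -> clamp1 t = t.
Proof. by move=> t1; apply: clamp_id; rewrite subr0. Qed.

Let clamp1_cont : continuous clamp1.
Proof.
by apply: lipschitz_continuous => s t; exact: clamp_lip. Qed.

Let G_cont : continuous G.
Proof.
apply: lipschitz_continuous => x y; apply: le_trans (G_lip x y) _.
by rewrite ler_piMl // invf_le1 // ler1n.
Qed.

Lemma picard : exists w : R -> 'cV[R]_n, w 0 = x0 /\ path_derive w (G \o w).
Proof.
(* A single operator [J] is wanted, so it must be defined on all paths; on discontinuous ones its
   value is arbitrary. *)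
have Jex : forall f : R -> 'cV[R]_n, exists F : R -> 'cV[R]_n,
    continuous f -> F 0 = 0 /\ path_derive F f.
  move=> f; have [fc|nfc] := pselect (continuous f); last by exists f.
  by have [F F0 Ff] := path_antiderivative fc; exists F.
have [J JP] := choice Jex.
pose step (v : R -> 'cV[R]_n) (t : R) := x0 + J (G \o v) (clamp1 t).
pose v m := iter m step (cst x0).
have J_cont f : continuous f -> continuous (fun t => x0 + J f (clamp1 t)).
  move=> fc t; apply: continuousD; first exact: cst_continuous.
  apply: (@continuous_comp _ _ _ clamp1 (J f)); first exact: clamp1_cont.
  by have [_ Ff] := JP _ fc; exact: path_continuous Ff (clamp1_le t).
have Gv_cont (u : R -> 'cV[R]_n) : continuous u -> continuous (G \o u).
  by move=> uc t; exact: (@continuous_comp _ _ _ u G t (uc t) (@G_cont _)).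
have v_cont m : continuous (v m).
  elim: m => [|m IH]; first by move=> t; exact: cst_continuous.
  exact/J_cont/Gv_cont.
have J_lip f g c : continuous f -> continuous g -> 0 <= c ->
    (forall t, `|f t - g t| <= c) -> forall t, `|t| <= 1 -> `|J f t - J g t| <= c.
  move=> fc gc c0 fg t t1; have [F0 Ff] := JP _ fc; have [G0 Gg] := JP _ gc.
  pose H s := J f s - J g s; have H0 : H 0 = 0 by rewrite /H F0 G0 subrr.
  rewrite -[J f t - J g t]/(H t) -[H t]subr0 -H0.
  apply: (@path_bound _ _ H (fun s => f s - g s)) => // s s1 i; rewrite !mxE /H.
  have -> : (fun s => (J f s - J g s) i 0) = (fun s => J f s i 0) - (fun s => J g s i 0).
    by apply/funext => z; rewrite !mxE.
  by apply: is_deriveB; [exact: Ff|exact: Gg].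
pose B := `|G x0|.
have B0 : 0 <= B by exact: normr_ge0.
(* Each iteration gains the factor 1/2: the Lipschitz constant of [G] times the length 1 of the time
   interval on either side of 0. *)
have vB m t : `|v m.+1 t - v m t| <= B * 2^-1 ^+ m.
  elim: m t => [|m IH] t.
    rewrite expr0 mulr1 /v /= /step addrAC subrr add0r.
    have c0 : continuous (G \o cst x0 : R -> _) by move=> s; exact: cst_continuous.
    have [J0 Jd] := JP _ c0.
    have JB : forall s : R, `|s| <= 1 -> `|(G \o cst x0) s| <= B by [].
    have := path_bound (normr_ge0 _) Jd JB (clamp1_le t).
    by rewrite J0 subr0.
  rewrite [v m.+2]/(step (v m.+1)) [v m.+1 t]/(step (v m) t) /step.
  rewrite opprD addrACA subrr add0r; apply: J_lip => //.
  - exact: Gv_cont.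
  - exact: Gv_cont.
  - by apply: mulr_ge0 => //; apply: exprn_ge0; rewrite invr_ge0.
  move=> s; apply: le_trans (G_lip _ _) _.
  by rewrite exprS mulrCA ler_pM2l ?invr_gt0.
have lim_ex t i : exists l, forall m, `|l - v m t i 0| <= 2 * B * 2^-1 ^+ m.
  apply: geometric_limit => // m; apply: le_trans (vB m t).
  by have := mx_entry_norm (v m.+1 t - v m t) i 0; rewrite !mxE.
have [l lP] := choice (fun ti : R * 'I_n => lim_ex ti.1 ti.2).
pose vl t : 'cV[R]_n := \col_i l (t, i).
pose d m := 2 * B * 2^-1 ^+ m : R.
have d0 m : 0 <= d m by rewrite !mulr_ge0 // exprn_ge0 // invr_ge0.
have vlB m t : `|vl t - v m t| <= d m.
  by apply: mx_norm_le => // i j; rewrite ord1 !mxE; exact: (lP (t, i)).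
have vl_cont : continuous vl.
  move=> t; apply/cvgrPdist_le => e e0.
  have [m dm] : exists m, d m <= e / 3.
    apply/not_existsP => dm.
    suff : e / 3 <= 0 by rewrite leNgt divr_gt0.
    apply: (@le0_of_half_powers _ _ (2 * B)) => m; apply: ltW.
    by rewrite ltNge; apply/negP; exact: dm.
  have e3 : 0 < e / 3 by rewrite divr_gt0.
  have /cvgrPdist_le/(_ _ e3) := v_cont m t; apply: filterS => s vs.
  rewrite -(subrKA (v m t)) (le_trans (ler_normD _ _)) //.
  rewrite -(subrKA (v m s) (v m t)) (le_trans (lerD (lexx _) (ler_normD _ _))) //.
  have h1 := le_trans (vlB m t) dm; have h2 := le_trans (vlB m s) dm.
  rewrite distrC in h2.
  by move: h1 h2 vs; lra.
have Gvl_cont := Gv_cont _ vl_cont.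
have [J0 Jd] := JP _ Gvl_cont.
(* The limit [vl] is frozen outside [[-1, 1]] and need not have a two-sided derivative at the ends.
   Integrating once more without the clamp gives a path that agrees with [vl] on [[-1, 1]] and is
   differentiable at the ends too. *)
pose w t := x0 + J (G \o vl) t.
have w_vl t : `|t| <= 1 -> w t = vl t.
  move=> t1; apply/eqP; rewrite -subr_eq0 -normr_le0.
  apply: (@le0_of_half_powers _ _ (4 * B)) => m.
  rewrite -(subrKA (v m.+1 t)) (le_trans (ler_normD _ _)) //.
  have h1 : `|w t - v m.+1 t| <= 2^-1 * d m.
    rewrite /w [v m.+1 t]/(step (v m) t) /step clamp1_id // opprD addrACA subrr add0r.
    apply: J_lip => //; first exact: Gv_cont.
      by rewrite mulr_ge0 // invr_ge0.
    by move=> s; apply: le_trans (G_lip _ _) _; rewrite ler_pM2l ?invr_gt0.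
  have h2 := vlB m.+1 t; rewrite distrC in h2.
  have dS : d m.+1 = 2^-1 * d m by rewrite /d exprS mulrCA.
  have -> : 4 * B * 2^-1 ^+ m = 2 * d m by rewrite /d; ring.
  by move: h1 h2 (d0 m); rewrite dS; lra.
exists w; split; first by rewrite /w J0 addr0.
move=> t t1 i; rewrite /= w_vl //.
have -> : (fun s => w s i 0) = cst (x0 i 0) + (fun s => J (G \o vl) s i 0).
  by apply/funext => s; rewrite !mxE.
rewrite -[X in is_derive _ _ _ X]add0r.
by apply: is_deriveD; exact: Jd.
Qed.

End Picard.

(** * Integral manifolds of commuting frames *)

Section LocalBounds.
Variables (R : realType) (n : nat).
Local Notation e_ := (basis_vec R).

(** Lipschitz bound, second-order Taylor remainder and bounds on [f] and its gradient share one
    radius and one constant, so that they can be arranged simultaneously for all entries of a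
    frame. *)
Definition taylor_on (f : 'cV[R]_n -> R) (x0 : 'cV[R]_n) (d K : R) :=
  [/\ forall x y : 'cV[R]_n, `|x - x0| <= d -> `|y - x0| <= d -> `|f y - f x| <= K * `|y - x|,
      forall x y : 'cV[R]_n, `|x - x0| <= d -> `|y - x0| <= d ->
        `|f y - f x - \sum_j 'D_(e_ j) f x * (y - x) j 0| <= K * `|y - x| ^+ 2
    & forall x : 'cV[R]_n, `|x - x0| <= d -> `|f x| <= K /\ forall j, `|'D_(e_ j) f x| <= K].

Lemma near_bounded (V : normedModType R) (f : V -> R) (x0 : V) :
  {for x0, continuous f} -> \forall x \near x0, `|f x| <= `|f x0| + 1.
Proof.
move=> fc; have /cvgrPdist_le/(_ _ ltr01) := fc; apply: filterS => x.
rewrite distrC => fx; rewrite -[f x](subrK (f x0)) addrC.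
by rewrite (le_trans (ler_normD _ _)) // lerD2l.
Qed.

(** Two points of the ball of radius [d] are at distance at most [2 d], so the axis-parallel path
    between them stays in the ball of radius [3 d]. *)
Lemma increment_lipschitz (f : 'cV[R]_n -> R) (x0 : 'cV[R]_n) (d K : R) :
  (forall j (x : 'cV[R]_n), `|x - x0| <= 3 * d -> derivable f x (e_ j)) ->
  (forall j (x : 'cV[R]_n), `|x - x0| <= 3 * d -> `|'D_(e_ j) f x| <= K) ->
  forall x y : 'cV[R]_n, `|x - x0| <= d -> `|y - x0| <= d -> `|f y - f x| <= n%:R * K * `|y - x|.
Proof.
move=> fd fK x y xd yd.
have yx : `|y - x| <= 2 * d.
  by rewrite -(subrKA x0) (le_trans (ler_normD _ _)) // [`|x0 - x|]distrC; lra.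
have far (z : 'cV[R]_n) : `|z - x| <= `|y - x| -> `|z - x0| <= 3 * d.
  by move=> zx; rewrite -(subrKA x) (le_trans (ler_normD _ _)) //; lra.
have := @C1_increment R n f x (y - x) 0 K.
rewrite subrK big1 ?subr0 => [|j _]; last by rewrite mxE mul0r.
by apply=> j z /far zd; [exact: fd|rewrite mxE subr0; exact: fK].
Qed.

Lemma common_bound (I : finType) (a : R) (b : I -> R) (c : I -> I -> R) :
  exists K, [/\ 0 <= K, `|a| + 1 <= K &
    forall j, `|b j| + 1 <= K /\ forall l, `|c j l| + 1 <= K].
Proof.
have term (g : I -> R) i : (forall i, 0 <= g i) -> g i <= \sum_i g i.
  by move=> g0; rewrite (bigD1 i) //= lerDl sumr_ge0.
have B0 : 0 <= \sum_j `|b j| by rewrite sumr_ge0.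
have C0 j : 0 <= \sum_l `|c j l| by rewrite sumr_ge0.
have D0 : 0 <= \sum_j \sum_l `|c j l| by rewrite sumr_ge0.
exists (`|a| + \sum_j `|b j| + \sum_j \sum_l `|c j l| + 1); split.
- by rewrite !addr_ge0.
- by rewrite lerD2r -addrA lerDl addr_ge0.
move=> j; split => [|l]; rewrite lerD2r.
  apply: le_trans (term (fun j => `|b j|) j _) _ => //.
  by rewrite -addrA addrCA lerDl addr_ge0.
apply: le_trans (term (fun l => `|c j l|) l _) _ => //.
apply: le_trans (term (fun j => \sum_l `|c j l|) j _) _ => //.
by rewrite lerDr addr_ge0.
Qed.

Lemma C2_taylor (f : 'cV[R]_n -> R) U x0 : open U -> Ck 2 U f -> U x0 ->
  exists2 dK : R * R, 0 < dK.1 /\ 0 <= dK.2 & taylor_on f x0 dK.1 dK.2.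
Proof.
move=> oU fk Ux0.
have fc : {for x0, continuous f} := CkS oU (CkS oU fk) x0 Ux0.
have f1c j : {for x0, continuous ('D_(e_ j) f)}.
  exact: (CkS oU (Ck_partial j fk) x0 Ux0).
have f2c j l : {for x0, continuous ('D_(e_ l) ('D_(e_ j) f))}.
  by have [_ /(_ l)[_]] := fk j; apply.
have [K [K0 fK0 DK0]] := common_bound (f x0) (fun j => 'D_(e_ j) f x0)
  (fun j l => 'D_(e_ l) ('D_(e_ j) f) x0).
have near_j j : \forall x \near x0, `|'D_(e_ j) f x| <= K /\
    forall l, `|'D_(e_ l) ('D_(e_ j) f) x| <= K.
  have near_l l : \forall x \near x0, `|'D_(e_ l) ('D_(e_ j) f) x| <= K.
    apply: filterS (near_bounded (f2c j l)) => x /le_trans; apply.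
    by have [_ DDK] := DK0 j; exact: DDK.
  have near_all := filter_forall (nbhs_filter x0) near_l.
  apply: filterS2 near_all (near_bounded (f1c j)) => x xl xj; split => //.
  by apply: le_trans xj _; have [DK _] := DK0 j; exact: DK.
have near_f : \forall x \near x0, `|f x| <= K.
  by apply: filterS (near_bounded fc) => x /le_trans; apply.
have near_all : \forall x \near x0, [/\ U x, `|f x| <= K & forall j,
    `|'D_(e_ j) f x| <= K /\ forall l, `|'D_(e_ l) ('D_(e_ j) f) x| <= K].
  have near_allj := filter_forall (nbhs_filter x0) near_j.
  by apply: filterS3 (open_nbhs_nbhs (conj oU Ux0)) near_f near_allj => x.
move/near_normP: near_all => [r r0 rP].
pose d := r / 4.
have d0 : 0 < d by rewrite divr_gt0.
have near_r (x : 'cV[R]_n) : `|x - x0| <= 3 * d -> `|x - x0| < r.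
  by move=> /le_lt_trans; apply; rewrite /d; lra.
have d_r (x : 'cV[R]_n) : `|x - x0| <= d -> `|x - x0| < r.
  by move=> /le_lt_trans; apply; rewrite /d; lra.
have fd j (x : 'cV[R]_n) : `|x - x0| <= 3 * d -> derivable f x (e_ j).
  by move=> /near_r/rP[Ux _ _]; have [+ _] := fk j; apply.
have fK j (x : 'cV[R]_n) : `|x - x0| <= 3 * d -> `|'D_(e_ j) f x| <= K.
  by move=> /near_r/rP[_ _ /(_ j)[]].
have fdd j l (x : 'cV[R]_n) : `|x - x0| <= 3 * d -> derivable ('D_(e_ j) f) x (e_ l).
  by move=> /near_r/rP[Ux _ _]; have [_ /(_ l)[+ _]] := fk j; apply.
have fdK j l (x : 'cV[R]_n) : `|x - x0| <= 3 * d -> `|'D_(e_ l) ('D_(e_ j) f) x| <= K.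
  by move=> /near_r/rP[_ _ /(_ j)[_]].
have lip := increment_lipschitz fd fK.
have dlip j := increment_lipschitz (fdd j) (fdK j).
clear fdd fdK near_j near_f.
(* The summands serve the bounds on [f] and its gradient, the Lipschitz constant of [f], and the
   Taylor remainder, in this order; the last one is [n] times the Lipschitz constant of the partial
   derivatives. *)
pose K' := K + n%:R * K + n%:R * (n%:R * K).
have nK : 0 <= n%:R * K by rewrite mulr_ge0.
have nnK : 0 <= n%:R * (n%:R * K) by rewrite mulr_ge0.
have KK' : K <= K' by rewrite /K' -addrA lerDl addr_ge0.
(* An axis-parallel path between points of the ball of radius [d / 3] stays in the ball of radius
   [d], where the gradient is Lipschitz. *)
exists (d / 3, K') => /=; first by split; [rewrite divr_gt0|exact: le_trans KK'].
have d3 (x : 'cV[R]_n) : `|x - x0| <= d / 3 -> `|x - x0| <= d.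
  by move=> /le_trans; apply; rewrite ler_pdivrMr // ler_peMr ?ler1n // ltW.
split.
- move=> x y /d3 xd /d3 yd; apply: le_trans (lip x y xd yd) _.
  by rewrite ler_wpM2r // /K' -addrA addrCA lerDl addr_ge0.
- move=> x y xd yd.
  have yx : `|y - x| <= 2 * (d / 3).
    by rewrite -(subrKA x0) (le_trans (ler_normD _ _)) // [`|x0 - x|]distrC; lra.
  have far (z : 'cV[R]_n) : `|z - x| <= `|y - x| -> `|z - x0| <= d.
    by move=> zx; rewrite -(subrKA x) (le_trans (ler_normD _ _)) //; lra.
  have d_3d (z : 'cV[R]_n) : `|z - x0| <= d -> `|z - x0| <= 3 * d.
    by move=> /le_trans; apply; rewrite ler_peMl ?ler1n // ltW.
  have := @C1_increment R n f x (y - x) (\col_j 'D_(e_ j) f x) (n%:R * K * `|y - x|).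
  rewrite subrK; under eq_bigr do rewrite mxE; move=> H.
  apply: le_trans (H _ _) _.
  + by move=> j z /far/d_3d; exact: fd.
  + move=> j z zx; rewrite mxE; apply: le_trans (dlip j x z (d3 _ xd) (far z zx)) _.
    by rewrite ler_wpM2l.
  rewrite [n%:R * (_ * _)]mulrA -mulrA -expr2 ler_wpM2r ?exprn_ge0 //.
  by rewrite /K' lerDr addr_ge0.
- move=> x /d3/d_r/rP[_ fx fj]; split; first exact: le_trans KK'.
  by move=> j; case: (fj j) => /le_trans h _; exact: h.
Qed.

Lemma taylor_on_weaken f x0 (d d' K K' : R) : d' <= d -> K <= K' ->
  taylor_on f x0 d K -> taylor_on f x0 d' K'.
Proof.
move=> dd KK [h1 h2 h3]; split.
- move=> x y /le_trans xd /le_trans yd; apply: le_trans (h1 x y (xd _ dd) (yd _ dd)) _.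
  by rewrite ler_wpM2r.
- move=> x y /le_trans xd /le_trans yd; apply: le_trans (h2 x y (xd _ dd) (yd _ dd)) _.
  by rewrite ler_wpM2r // exprn_ge0.
- move=> x /le_trans xd; have [fK fj] := h3 x (xd _ dd); split; first exact: le_trans KK.
  by move=> j; exact: le_trans (fj j) KK.
Qed.

Lemma smooth_taylor (a b : nat) (E : 'cV[R]_n -> 'M[R]_(a, b)) U x0 :
  open U -> smooth U E -> U x0 ->
  exists d K : R, [/\ 0 < d, 0 <= K, forall x : 'cV[R]_n, `|x - x0| <= d -> U x &
    forall i j, taylor_on (fun x => E x i j) x0 d K].
Proof.
move=> oU sE Ux0.
have /near_normP[r r0 rP] := open_nbhs_nbhs (conj oU Ux0).
have dK_ex (ij : 'I_a * 'I_b) : exists dK : R * R, (0 < dK.1 /\ 0 <= dK.2) /\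
    taylor_on (fun x => E x ij.1 ij.2) x0 dK.1 dK.2.
  by have [dK ? ?] := C2_taylor oU (sE ij.1 ij.2 2%N) Ux0; exists dK.
have [dK dKP] := choice dK_ex.
have inv_ge0 ij : 0 <= (dK ij).1^-1 by rewrite invr_ge0; case: (dKP ij) => -[/ltW].
(* The inverse of a sum of inverses replaces a minimum of radii, and stays meaningful for empty
   matrices. The term [2 / r] makes the closed ball of radius [S^-1] lie in the open ball of radius
   [r]. *)
pose S := 2 / r + \sum_ij (dK ij).1^-1.
have r2 : 0 < 2 / r by rewrite divr_gt0.
have S0 : 0 < S by rewrite ltr_wpDr // sumr_ge0.
exists S^-1, (\sum_ij (dK ij).2); split.
- by rewrite invr_gt0.
- by rewrite sumr_ge0 // => ij _; case: (dKP ij) => -[].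
- move=> x xS; apply: rP; apply: le_lt_trans xS _; rewrite -[r]invrK ltf_pV2 ?posrE //.
    rewrite (lt_le_trans _ (_ : 2 / r <= _)) //; last by rewrite lerDl sumr_ge0.
    by rewrite ltr_pMl ?invr_gt0 // ltr1n.
  by rewrite invr_gt0.
- move=> i j; have [[d0 K0] T] := dKP (i, j); apply: taylor_on_weaken T.
    rewrite -[leRHS]invrK lef_pV2 ?posrE ?invr_gt0 // /S (bigD1 (i, j)) //= addrCA lerDl.
    by rewrite addr_ge0 ?sumr_ge0 // ltW.
  rewrite (bigD1 (i, j)) //= lerDl sumr_ge0 // => ij _.
  by case: (dKP ij) => -[].
Qed.

End LocalBounds.

(** * The flow map of a commuting frame *)

Section LocalFrobenius.
Variables (R : realType) (n k : nat) (E : 'cV[R]_n -> 'M[R]_(n, k)).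
Variables (x0 : 'cV[R]_n) (d K : R).
Local Notation e_ := (basis_vec R).
Hypotheses (d0 : 0 < d) (K0 : 0 <= K).
Hypothesis E_taylor : forall i a, taylor_on (fun x => E x i a) x0 d K.
Hypothesis E_diff : forall (x : 'cV[R]_n) i a, `|x - x0| <= d ->
  differentiable (fun z => E z i a) x.
Hypothesis E_comm : forall (x : 'cV[R]_n) i a b, `|x - x0| <= d ->
  \sum_m 'D_(e_ m) (fun z => E z i a) x * E x m b =
  \sum_m 'D_(e_ m) (fun z => E z i b) x * E x m a.

Lemma mulmx_norm_le (a b : nat) (A : 'M[R]_(a, b)) (h : 'cV[R]_b) (c : R) :
  0 <= c -> (forall i j, `|A i j| <= c) -> `|A *m h| <= b%:R * (c * `|h|).
Proof.
move=> c0 Ac; apply: mx_norm_le => [|i j]; first by rewrite !mulr_ge0.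
rewrite mxE (le_trans (ler_norm_sum _ _ _)) //.
rewrite mulr_natl -[X in _ *+ X](card_ord b) -sumr_const.
by apply: ler_sum => l _; rewrite normrM ler_pM // mx_entry_norm.
Qed.

(** The retraction onto the sup-norm ball around [x0]: precomposed with it, the frame becomes
    globally Lipschitz, as Picard's theorem requires. *)
Let cl (x : 'cV[R]_n) : 'cV[R]_n := \col_i clamp (x0 i 0) d (x i 0).

Let cl_in x : `|cl x - x0| <= d.
Proof.
apply: mx_norm_le => [|i j]; first exact: ltW.
by rewrite ord1 !mxE; apply: clamp_le; exact: ltW.
Qed.

Let cl_id (x : 'cV[R]_n) : `|x - x0| <= d -> cl x = x.
Proof.
move=> xd; apply/colP => i; rewrite mxE clamp_id //.
by apply: le_trans xd; have := mx_entry_norm (x - x0) i 0; rewrite !mxE.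
Qed.

Let cl_lip x y : `|cl x - cl y| <= `|x - y|.
Proof.
apply: mx_norm_le => // i j; rewrite ord1 !mxE.
apply: le_trans (clamp_lip _ _ _ (ltW d0)) _.
by have := mx_entry_norm (x - y) i 0; rewrite !mxE.
Qed.

Let E_lip (x y : 'cV[R]_n) i a : `|x - x0| <= d -> `|y - x0| <= d ->
  `|(E y - E x) i a| <= K * `|y - x|.
Proof. by move=> xd yd; have [h _ _] := E_taylor i a; rewrite !mxE; exact: h. Qed.

Let E_bound (x : 'cV[R]_n) i a : `|x - x0| <= d -> `|E x i a| <= K.
Proof. by move=> xd; have [_ _ /(_ x xd)[]] := E_taylor i a. Qed.

Let dE_bound (x : 'cV[R]_n) i a m : `|x - x0| <= d ->
  `|'D_(e_ m) (fun z => E z i a) x| <= K.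
Proof. by move=> xd; have [_ _ /(_ x xd)[_]] := E_taylor i a; apply. Qed.

(** Of the three summands, the first gives [k K (n + 1) |h| <= 1/2], the Lipschitz constant required
    by the Picard and Gronwall lemmas; the second gives [2 k K |h| <= d], which keeps solutions in
    the ball; the last gives [|h| <= 1] and a nonzero denominator. The factor [n] pays for the
    gradient term in [flow_taylor]. *)
Definition flow_radius : R := (2 * (k%:R * K * (n%:R + 1)) + 2 * (k%:R * K) / d + 1)^-1.

Let kK0 : 0 <= k%:R * K. Proof. by rewrite mulr_ge0. Qed.

Let den_ge0 : 0 <= 2 * (k%:R * K * (n%:R + 1)) + 2 * (k%:R * K) / d.
Proof. by rewrite addr_ge0 ?mulr_ge0 ?invr_ge0 ?addr_ge0 // ltW. Qed.

Lemma flow_radius_gt0 : 0 < flow_radius.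
Proof. by rewrite invr_gt0 ltr_wpDl. Qed.

Let small_mul (c : R) (h : 'cV[R]_k) : 0 <= c ->
  c <= 2 * (k%:R * K * (n%:R + 1)) + 2 * (k%:R * K) / d + 1 ->
  `|h| <= flow_radius -> c * `|h| <= 1.
Proof.
move=> c0 cD hr; apply: le_trans (ler_wpM2l c0 hr) _.
by rewrite /flow_radius ler_pdivrMr ?mul1r // ltr_wpDl.
Qed.

Let small1 (h : 'cV[R]_k) : `|h| <= flow_radius ->
  k%:R * K * (n%:R + 1) * `|h| <= 2^-1.
Proof.
move=> hr.
have p0 : 0 <= 2 * (k%:R * K * (n%:R + 1)) by rewrite !mulr_ge0 ?addr_ge0.
have q0 : 0 <= 2 * (k%:R * K) / d by rewrite !mulr_ge0 // invr_ge0 ltW.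
have := small_mul p0 _ hr; rewrite -addrA lerDl addr_ge0 // => /(_ isT).
rewrite -mulrA; move: (_ * `|h|) => c; lra.
Qed.

Let small2 (h : 'cV[R]_k) : `|h| <= flow_radius -> 2 * (k%:R * (K * `|h|)) <= d.
Proof.
move=> hr; have q0 : 0 <= 2 * (k%:R * K) / d by rewrite !mulr_ge0 // invr_ge0 ltW.
have p0 : 0 <= 2 * (k%:R * K * (n%:R + 1)) by rewrite !mulr_ge0 ?addr_ge0.
have := small_mul q0 _ hr; rewrite -addrA addrCA lerDl addr_ge0 // => /(_ isT).
by rewrite mulrAC ler_pdivrMr // mul1r -!mulrA.
Qed.

Lemma flow_exists (h : 'cV[R]_k) : `|h| <= flow_radius ->
  exists w : R -> 'cV[R]_n, [/\ w 0 = x0,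
    (forall t : R, `|t| <= 1 -> `|w t - x0| <= d) &
    path_derive w (fun t => E (w t) *m h)].
Proof.
move=> hr.
have kKh : k%:R * (K * `|h|) <= 2^-1.
  apply: le_trans (small1 hr); rewrite mulrA ler_wpM2r // ler_peMr //.
  by rewrite lerDr.
have [x y|w [w0 wd]] := @picard R n (fun x => E (cl x) *m h) x0.
  rewrite -mulmxBl; apply: le_trans (mulmx_norm_le (c := K * `|x - y|) _ _ _) _.
  - by rewrite mulr_ge0.
  - move=> i a; apply: le_trans (E_lip _ _ (cl_in _) (cl_in _)) _.
    by rewrite ler_wpM2l.
  by rewrite [K * _ * _]mulrAC mulrA ler_wpM2r.
(* The speed is at most [k K |h|], so the solution stays in the ball, where [cl] is the identity and
   the clamped equation is the original one. *)
have w_d (t : R) : `|t| <= 1 -> `|w t - x0| <= d.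
  move=> t1; rewrite -w0; apply: le_trans (small2 hr).
  apply: (path_gronwall wd) t1 => s s1 /=.
  apply: le_trans (mulmx_norm_le _ K0 _) _; first by move=> i a; exact: E_bound.
  by rewrite lerDr mulr_ge0 // invr_ge0.
exists w; split=> // t t1 i.
by have := wd t t1 i; rewrite /= cl_id //; exact: w_d.
Qed.

Section Comparison.
Variables (y h : 'cV[R]_k) (w v : R -> 'cV[R]_n).
Hypotheses (yr : `|y| <= flow_radius).
Hypotheses (w0 : w 0 = x0) (v0 : v 0 = x0).
Hypotheses (w_in : forall t : R, `|t| <= 1 -> `|w t - x0| <= d)
           (v_in : forall t : R, `|t| <= 1 -> `|v t - x0| <= d).
Hypotheses (wd : path_derive w (fun t => E (w t) *m y))
           (vd : path_derive v (fun t => E (v t) *m (y + h))).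

Lemma flow_lipschitz (t : R) : `|t| <= 1 -> `|v t - w t| <= 2 * (k%:R * (K * `|h|)).
Proof.
move=> t1.
have Fd : path_derive (fun s => v s - w s) (fun s => E (v s) *m (y + h) - E (w s) *m y).
  move=> s s1 i; rewrite mxE [X in _ + X]mxE.
  have -> : (fun s => (v s - w s) i 0) = (fun s => v s i 0) - (fun s => w s i 0).
    by apply/funext => z; rewrite !mxE.
  exact: (is_deriveB (vd s1 i) (wd s1 i)).
have := @path_gronwall _ _ _ _ (k%:R * (K * `|h|)) Fd _ t t1.
rewrite v0 w0 subrr subr0; apply => s s1; rewrite subr0.
(* The first term is at most half of [|v s - w s|] because [y] is small, and is absorbed by
   Gronwall; the second is the forcing term. *)
have -> : E (v s) *m (y + h) - E (w s) *m y = (E (v s) - E (w s)) *m y + E (v s) *m h.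
  by rewrite mulmxDr mulmxBl addrAC.
apply: le_trans (ler_normD _ _) _; apply: lerD; last first.
  by apply: mulmx_norm_le => // i a; exact/E_bound/v_in.
apply: le_trans (mulmx_norm_le (c := K * `|v s - w s|) _ _ _) _.
- by rewrite mulr_ge0.
- by move=> i a; exact: E_lip (w_in s1) (v_in s1).
rewrite [K * _ * _]mulrAC !mulrA ler_wpM2r //.
apply: le_trans (small1 yr); rewrite ler_wpM2r // ler_peMr //.
by rewrite lerDr.
Qed.

Let Err (s : R) : 'cV[R]_n := v s - w s - s *: (E (w s) *m h).

Let grad (i : 'I_n) (s : R) : 'M[R]_(k, n) :=
  \matrix_(a, m) 'D_(e_ m) (fun z => E z i a) (w s).

Let dErr (s : R) : 'cV[R]_n := E (v s) *m (y + h) - E (w s) *m y - E (w s) *m h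
   - s *: \col_i (h^T *m (grad i s *m (E (w s) *m y))) 0 0.

Let Err_derive : path_derive Err dErr.
Proof.
move=> t t1 i.
have wdiff m : differentiable (fun s => w s m 0) t.
  by apply/derivable1_diffP; have [] := wd t1 m.
have Ed a : is_derive t (1 : R) (fun s => E (w s) i a)
    ((grad i t *m (E (w t) *m y)) a 0).
  have fd := E_diff i a (w_in t1).
  split.
    apply: (proj2 (derivable1_diffP _ _)).
    apply: (@differentiable_comp _ _ _ _ w (fun z => E z i a)) => //.
    by apply: differentiable_mx => i' j'; rewrite ord1.
  rewrite (derive_comp (f := fun z => E z i a)) // mxE; apply: eq_bigr => m _.
  rewrite mxE; congr (_ * _); have [_ ->] := wd t1 m.
  by [].
have sumd : is_derive t (1 : R) (fun s => (E (w s) *m h) i 0)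
    ((h^T *m (grad i t *m (E (w t) *m y))) 0 0).
  have -> : (fun s => (E (w s) *m h) i 0) = \sum_a h a 0 *: (fun s => E (w s) i a).
    by apply/funext => s; rewrite mxE fct_sumE; apply: eq_bigr => a _; rewrite mulrC.
  have -> : (h^T *m (grad i t *m (E (w t) *m y))) 0 0 =
      \sum_a h a 0 *: (grad i t *m (E (w t) *m y)) a 0.
    by rewrite mxE; apply: eq_bigr => a _; rewrite mxE.
  exact: (is_derive_sum (fun a => is_deriveZ (h a 0) (Ed a))).
have idd := @is_derive_id R R^o t 1.
have -> : (fun s => Err s i 0) = (fun s => v s i 0) - (fun s => w s i 0)
    - (id * (fun s => (E (w s) *m h) i 0)).
  apply/funext => s; transitivity (v s i 0 - w s i 0 - s * (E (w s) *m h) i 0) => //.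
  by rewrite /Err; move: (E (w s) *m h) => A; rewrite !mxE.
have := is_deriveB (is_deriveB (vd t1 i) (wd t1 i)) (is_deriveM idd sumd).
have -> : dErr t i 0 = (E (v t) *m (y + h)) i 0 - (E (w t) *m y) i 0
    - (E (w t) *m h) i 0 - t * (h^T *m (grad i t *m (E (w t) *m y))) 0 0.
  rewrite /dErr; move: (E (v t) *m _) (E (w t) *m h) => A1 A2.
  by move: (E (w t) *m y) => A3; rewrite !mxE.
congr (is_derive _ _ _ _).
move: ((E (v t) *m _) i 0) ((E (w t) *m y) i 0) ((E (w t) *m h) i 0) => c1 c2 c3.
move: ((h^T *m _) 0 0) => c4.
by rewrite -[id t *: c4]/(t * c4) -[c3 *: 1]/(c3 * 1); ring.
Qed.

Lemma dot_norm_le (a : nat) (b c : 'cV[R]_a) : `|(b^T *m c) 0 0| <= a%:R * (`|b| * `|c|).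
Proof.
rewrite mxE (le_trans (ler_norm_sum _ _ _)) //.
rewrite mulr_natl -[X in _ *+ X](card_ord a) -sumr_const.
by apply: ler_sum => l _; rewrite normrM mxE ler_pM // mx_entry_norm.
Qed.

(** Commutation of the frame enters here: it says that [grad i s *m E (w s)] is a symmetric matrix,
    so [y] and [h] may be exchanged in the derivative of the error. *)
Let grad_sym i s : `|s| <= 1 ->
  (h^T *m (grad i s *m (E (w s) *m y))) 0 0 = (y^T *m (grad i s *m (E (w s) *m h))) 0 0.
Proof.
move=> s1.
have S : (grad i s *m E (w s))^T = grad i s *m E (w s).
  apply/matrixP => a b; rewrite mxE !mxE.
  under eq_bigr do rewrite mxE; under [RHS]eq_bigr do rewrite mxE.
  by apply: E_comm; exact: w_in.
rewrite !(mulmxA (grad i s)); move: (grad i s *m E (w s)) S => G S.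
have -> : y^T *m (G *m h) = (h^T *m (G *m y))^T.
  by rewrite !trmx_mul S trmxK mulmxA.
by rewrite [RHS]mxE.
Qed.

(** With [L = 2 k K] the Lipschitz constant of the flow in its parameter, [k K L^2] comes from the
    Taylor remainder of [E] along [v - w], [k K L] from [(E v - E w) h], and the outer 2 from
    Gronwall. *)
Lemma flow_taylor : `|v 1 - w 1 - E (w 1) *m h| <=
  2 * ((k%:R * K * (2 * (k%:R * K)) ^+ 2 + k%:R * K * (2 * (k%:R * K))) * `|h| ^+ 2).
Proof.
set C := (X in 2 * (X * _)).
have Err0 : Err 0 = 0 by rewrite /Err v0 w0 subrr scale0r subr0.
have -> : v 1 - w 1 - E (w 1) *m h = Err 1 - Err 0 by rewrite Err0 subr0 /Err scale1r.
apply: (path_gronwall Err_derive); last by rewrite normr1.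
move=> s s1; rewrite Err0 subr0.
have C0 : 0 <= C by rewrite /C addr_ge0 ?mulr_ge0 ?exprn_ge0 ?mulr_ge0.
have vw : `|v s - w s| <= 2 * (k%:R * K) * `|h|.
  by apply: le_trans (flow_lipschitz s1) _; rewrite !mulrA.
apply: mx_norm_le => [|i j]; first by rewrite addr_ge0 ?mulr_ge0 ?invr_ge0 ?exprn_ge0.
rewrite ord1.
pose D : 'cV[R]_k := \col_a (E (v s) - E (w s)) i a.
(* After the exchange of [y] and [h], the term [s E(w) h] in the derivative recombines with [v - w]:
   what remains is a Taylor remainder, a product of two small factors, and the linear term in
   [Err s] for Gronwall. *)
have dE : dErr s i 0 = (y^T *m (D - grad i s *m (v s - w s))) 0 0 + (h^T *m D) 0 0
    + (y^T *m (grad i s *m Err s)) 0 0.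
  have rowD (z : 'cV[R]_k) : (E (v s) *m z - E (w s) *m z) i 0 = (z^T *m D) 0 0.
    by rewrite -mulmxBl !mxE; apply: eq_bigr => a _; rewrite !mxE mulrC.
  have -> : dErr s i 0 = (E (v s) *m y - E (w s) *m y) i 0
      + (E (v s) *m h - E (w s) *m h) i 0 - s * (y^T *m (grad i s *m (E (w s) *m h))) 0 0.
    rewrite -grad_sym // /dErr mulmxDr; move: (E (v s) *m _) (E (v s) *m _).
    move=> A1 A2; rewrite !mxE; ring.
  rewrite !rowD /Err; move: (v s - w s) (E (w s) *m h) (grad i s) => z u G.
  rewrite !mulmxBr -!scalemxAr; move: (y^T *m D) (h^T *m D) => A1 A2.
  move: (y^T *m (G *m z)) (y^T *m (G *m u)) => A3 A4.
  rewrite !mxE; ring.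
have y1 : `|y| <= 1.
  apply: le_trans yr _; rewrite /flow_radius invf_le1 ?lerDr // ltr_wpDl //.
rewrite dE; apply: le_trans (ler_normD _ _) _.
have t1 : `|(y^T *m (D - grad i s *m (v s - w s))) 0 0| <=
    k%:R * K * (2 * (k%:R * K)) ^+ 2 * `|h| ^+ 2.
  apply: le_trans (dot_norm_le _ _) _.
  rewrite [leRHS](_ : _ = k%:R * (K * ((2 * (k%:R * K)) ^+ 2 * `|h| ^+ 2))); last by ring.
  rewrite ler_wpM2l //; apply: le_trans (_ : K * `|v s - w s| ^+ 2 <= _).
    rewrite -[leRHS]mul1r ler_pM // ?y1 //.
    apply: mx_norm_le => [|a j']; first by rewrite mulr_ge0 ?exprn_ge0.
    have [_ h2 _] := E_taylor i a.
    have := h2 _ _ (w_in s1) (v_in s1); rewrite ord1 !mxE.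
    by under [X in _ -> `|_ - X| <= _]eq_bigr do rewrite mxE.
  by rewrite ler_wpM2l // -exprMn ler_pXn2r ?nnegrE ?mulr_ge0.
have t2 : `|(h^T *m D) 0 0| <= k%:R * K * (2 * (k%:R * K)) * `|h| ^+ 2.
  apply: le_trans (dot_norm_le _ _) _.
  rewrite [leRHS](_ : _ = k%:R * (`|h| * (K * (2 * (k%:R * K) * `|h|)))); last by ring.
  rewrite !ler_wpM2l //; apply: le_trans (_ : K * `|v s - w s| <= _); last first.
    by rewrite ler_wpM2l.
  apply: mx_norm_le => [|a j']; first by rewrite mulr_ge0.
  by have := E_lip i a (w_in s1) (v_in s1); rewrite !mxE.
have t3 : `|(y^T *m (grad i s *m Err s)) 0 0| <= 2^-1 * `|Err s|.
  apply: le_trans (dot_norm_le _ _) _.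
  apply: le_trans (_ : k%:R * (`|y| * (n%:R * (K * `|Err s|))) <= _).
    rewrite !ler_wpM2l //; apply: mulmx_norm_le => // a m.
    by rewrite mxE; exact/dE_bound/w_in.
  rewrite [leLHS](_ : _ = k%:R * K * n%:R * `|y| * `|Err s|); last by ring.
  rewrite ler_wpM2r //; apply: le_trans (small1 yr).
  by rewrite ler_wpM2r // ler_wpM2l // lerDl.
rewrite addrC; apply: lerD t3 _; apply: le_trans (ler_normD _ _) _.
by rewrite /C mulrDl; exact: lerD.
Qed.

End Comparison.

Lemma flow_map : exists (X : 'cV[R]_k -> 'cV[R]_n) (C : R), [/\ X 0 = x0, 0 <= C,
  (forall h : 'cV[R]_k, `|h| <= flow_radius -> `|X h - x0| <= d) &
  forall y h : 'cV[R]_k, `|y| <= flow_radius -> `|y + h| <= flow_radius ->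
    `|X (y + h) - X y - E (X y) *m h| <= C * `|h| ^+ 2].
Proof.
have flow (h : 'cV[R]_k) : exists w : R -> 'cV[R]_n, `|h| <= flow_radius ->
    [/\ w 0 = x0, (forall t : R, `|t| <= 1 -> `|w t - x0| <= d) &
        path_derive w (fun t => E (w t) *m h)].
  have [hr|hr] := leP `|h| flow_radius; first by have [w wP] := flow_exists hr; exists w.
  (* A placeholder for large [h], about which nothing is claimed. *)
  by exists (cst x0).
have [w wP] := choice flow.
exists (fun h => w h 1), (2 * (k%:R * K * (2 * (k%:R * K)) ^+ 2 + k%:R * K * (2 * (k%:R * K)))).
have r0 := ltW flow_radius_gt0.
have n1 : `|1 : R| <= 1 by rewrite normr1.
split.
- have h0r : `|0 : 'cV[R]_k| <= flow_radius by rewrite normr0.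
  have [w0 w_in wd] := wP 0 h0r.
  apply/eqP; rewrite -subr_eq0 -normr_le0 -w0; apply: (path_bound _ wd) n1 => // t _.
  by rewrite mulmx0 normr0.
- by rewrite mulr_ge0 // addr_ge0 ?mulr_ge0 ?exprn_ge0 ?mulr_ge0.
- by move=> h /wP[_ w_in _]; exact: w_in.
move=> y h yr yhr; have [w0 w_in wd] := wP y yr; have [v0 v_in vd] := wP _ yhr.
rewrite -mulrA; exact: (flow_taylor yr w0 v0 w_in v_in wd vd).
Qed.

End LocalFrobenius.

(** * Local integral manifolds in coordinates *)

Section LocalIntegralManifold.
Variables (R : realType) (n k : nat).
Local Notation e_ := (basis_vec R).

Lemma open_norm_lt (V : normedModType R) (r : R) : open [set h : V | `|h| < r].
Proof.
have -> : [set h : V | `|h| < r] = Num.norm @^-1` [set x : R | x < r] by [].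
apply: open_comp; last exact: open_lt.
by move=> x _; exact: norm_continuous.
Qed.

Lemma local_frobenius (E : 'cV[R]_n -> 'M[R]_(n, k)) (U : set 'cV[R]_n) (x0 : 'cV[R]_n) :
  open U -> smooth U E -> U x0 ->
  (forall x i a b, U x ->
     \sum_m 'D_(e_ m) (fun z => E z i a) x * E x m b =
     \sum_m 'D_(e_ m) (fun z => E z i b) x * E x m a) ->
  exists (X : 'cV[R]_k -> 'cV[R]_n) (r : R), [/\ 0 < r, X 0 = x0,
    (forall h : 'cV[R]_k, `|h| < r -> U (X h)),
    smooth [set h | `|h| < r] X &
    forall h, `|h| < r -> jac X h = E (X h)].
Proof.
move=> oU sE Ux0 comm.
have [d [K [d0 K0 dU T]]] := smooth_taylor oU sE Ux0.
have Ediff (x : 'cV[R]_n) i a : `|x - x0| <= d -> differentiable (fun z => E z i a) x.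
  by move=> /dU Ux; exact: smooth_differentiable oU sE Ux.
have Ecomm (x : 'cV[R]_n) i a b : `|x - x0| <= d ->
    \sum_m 'D_(e_ m) (fun z => E z i a) x * E x m b =
    \sum_m 'D_(e_ m) (fun z => E z i b) x * E x m a by move=> /dU; exact: comm.
have [X [C [X0 C0 Xd XT]]] := flow_map d0 K0 T Ediff Ecomm.
set r := flow_radius n k d K in XT Xd.
have r0 : 0 < r by exact: flow_radius_gt0.
pose W := [set h : 'cV[R]_k | `|h| < r].
have oW : open W by exact: open_norm_lt.
have XU h : W h -> U (X h) by move=> /ltW/Xd/dU.
have Xdiff y i : W y -> differentiable (fun h => X h i 0) y /\
    forall v, 'D_v (fun h => X h i 0) y = \sum_j (\col_j E (X y) i j : 'cV[R]_k) j 0 * v j 0.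
  move=> Wy; apply: differentiable_of_dot => e e0.
  apply/near_normP; have C1 : 0 < C + 1 by rewrite ltr_wpDl.
  (* The first bound keeps [y + h] in the domain of the estimate, the second turns [C |h|^2] into at
     most [e |h|]. *)
  have m0 : 0 < Num.min (r - `|y|) (e / (C + 1)).
    by rewrite lt_min subr_gt0 divr_gt0 // andbT.
  exists (Num.min (r - `|y|) (e / (C + 1))) => // h; rewrite subr0 lt_min => /andP[h1 h2].
  have yhr : `|y + h| <= r.
    by apply: le_trans (ler_normD _ _) _; rewrite -lerBrDl ltW.
  have := XT y h (ltW Wy) yhr; rewrite [h + y]addrC => H.
  have -> : X (y + h) i 0 - X y i 0 - \sum_j (\col_j0 E (X y) i j0 : 'cV[R]_k) j 0 * h j 0
      = (X (y + h) - X y - E (X y) *m h) i 0.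
    by rewrite !mxE; congr (_ - _); apply: eq_bigr => j _; rewrite mxE.
  apply: le_trans (mx_entry_norm _ _ _) _; apply: le_trans H _.
  rewrite expr2 mulrA ler_wpM2r //.
  apply: le_trans (_ : (C + 1) * `|h| <= _); first by rewrite ler_wpM2r // lerDl.
  by rewrite mulrC -ler_pdivlMr // ltW.
have XD y i j : W y -> 'D_(e_ j) (fun h => X h i 0) y = E (X y) i j.
  move=> /(Xdiff _ i)[_ ->]; rewrite (bigD1 j) //= big1 => [|l lj].
    by rewrite !mxE !eqxx mulr1 addr0.
  by rewrite !mxE (negbTE lj) mulr0.
exists X, r; split => //.
- move=> i j p; rewrite (ord1 j); elim: p i => [|p IH] i.
    by move=> h Wh; apply: differentiable_continuous; have [] := Xdiff h i Wh.
  move=> l; split => [h Wh|].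
    by apply: diff_derivable; have [] := Xdiff h i Wh.
  apply: (@Ck_eq _ _ p W (fun h => E (X h) i l)) => // [h Wh|]; first by rewrite XD.
  by apply: (@Ck_comp _ _ _ W U X oW oU XU p (fun x => E x i l)).
- by move=> h Wh; apply/matrixP => i j; rewrite mxE XD.
Qed.

End LocalIntegralManifold.

(** * Bump functions *)

Section Bump.
Variable R : realType.

(* The family is closed under differentiation, up to linear combinations. *)
Definition flatexp (N : nat) (x : R) : R := if 0 < x then x^-1 ^+ N * expR (- x^-1) else 0.

(** With [u = x^-1], the exponential series gives [u^(N+2) / (N+2)! <= exp u]. The exponent 2 on the
    right is what yields a zero derivative at the origin. *)
Lemma flatexp_bound N x : `|flatexp N x| <= N.+2`!%:R * `|x| ^+ 2.
Proof.
rewrite /flatexp; case: ifPn => [x0|_]; last first.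
  by rewrite normr0 mulr_ge0 ?exprn_ge0.
have u0 : 0 < x^-1 by rewrite invr_gt0.
rewrite !gtr0_norm ?mulr_gt0 ?exprn_gt0 ?expR_gt0 //.
rewrite expRN ler_pdivrMr ?expR_gt0 // mulrAC -ler_pdivrMr ?exprn_gt0 //.
rewrite -exprVn -exprD addn2 -ler_pdivrMl ?ltr0n ?fact_gt0 // mulrC.
by apply: le_trans (expR_ge1Dxn N.+1 (ltW u0)); rewrite lerDr.
Qed.

Lemma flatexp_derive N (x : R) :
  is_derive x (1 : R) (flatexp N) (flatexp N.+2 x - N%:R * flatexp N.+1 x).
Proof.
have [x0|x0|->] := ltgtP x 0.
- have -> : flatexp N.+2 x - N%:R * flatexp N.+1 x = 0.
    by rewrite /flatexp ltNge (ltW x0) /= mulr0 subr0.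
  have neg : \forall z \near x, z < 0.
    exact: (open_nbhs_nbhs (conj (@open_lt R 0) x0)).
  have E : \forall z \near x, cst 0 z = flatexp N z.
    by apply: filterS neg => z z0; rewrite /flatexp ltNge (ltW z0).
  exact: near_eq_is_derive E (is_derive_cst (0 : R) x (1 : R)).
- have xn0 : x != 0 by rewrite gt_eqF.
  have ud : is_derive x (1 : R) (fun z : R => z^-1) (- x^-1 ^+ 2).
    split; first exact: (@derivableV _ _ (@id R) x 1 xn0 (@derivable_id _ _ x 1)).
    rewrite (@deriveV _ _ (@id R) x 1 xn0 (@derivable_id _ _ x 1)) derive_id.
    by rewrite -[LHS]/(_ * 1) mulr1 exprVn.
  have ed := @is_derive1_comp R expR _ x _ _ (is_derive_expR _) (is_deriveN ud).
  have := is_deriveM (is_deriveX N ud) ed.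
  have -> : flatexp N.+2 x - N%:R * flatexp N.+1 x =
     (x^-1 ^+ N) * (expR (- x^-1) * x^-1 ^+ 2)
     + expR (- x^-1) * ((N%:R * x^-1 ^+ N.-1) * - x^-1 ^+ 2).
    rewrite /flatexp x0; case: (N) => [|p] /=; rewrite ?exprS ?expr0; ring.
  rewrite opprK exprfctE => md.
  have pos : \forall z \near x, 0 < z.
    exact: (open_nbhs_nbhs (conj (@open_gt R 0) x0)).
  have E : \forall z \near x, z^-1 ^+ N * expR (- z^-1) = flatexp N z.
    by apply: filterS pos => z z0; rewrite /flatexp z0.
  exact: (near_eq_is_derive E md).
- have -> : flatexp N.+2 0 - N%:R * flatexp N.+1 0 = 0.
    by rewrite /flatexp ltxx mulr0 subr0.
  have [fd fE] : is_diff (0 : R) (flatexp N) (\0 : {linear R -> R}).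
    apply: is_diff_of_approx; first by move=> z; exact: cst_continuous.
    move=> e e0; have c0 : 0 < N.+2`!%:R :> R by rewrite ltr0n fact_gt0.
    apply: (proj2 (near_normP (0 : R) _)); exists (e / N.+2`!%:R).
      exact: divr_gt0.
    move=> h; rewrite subr0 ltr_pdivlMr // => he.
    rewrite addr0 subr0 [flatexp N 0]/flatexp ltxx subr0; apply: le_trans (flatexp_bound _ _) _.
    by rewrite expr2 mulrA ler_wpM2r // mulrC ltW.
  split; first exact: diff_derivable.
  by rewrite deriveE // fE.
Qed.

Lemma Ck_flatexp n k (U : set 'cV[R]_n) N (f : 'cV[R]_n -> R) : open U -> Ck k U f ->
  Ck k U (fun x => flatexp N (f x)).
Proof.
move=> oU; elim: k N f => [|k IH] N f fk.
  move=> x Ux; apply: (@continuous_comp _ _ _ f (flatexp N)); first exact: fk.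
  apply: differentiable_continuous; apply/derivable1_diffP.
  by have [] := flatexp_derive N (f x).
have fd x : U x -> differentiable f x by exact: CkS_differentiable fk.
have flatd y : differentiable (flatexp N) y.
  by apply/derivable1_diffP; have [] := flatexp_derive N y.
have flatE y (c : R) : 'd (flatexp N) y c = (flatexp N.+2 y - N%:R * flatexp N.+1 y) * c.
  rewrite diff1E // derive1E; have [_ ->] := flatexp_derive N y.
  by rewrite -[LHS]/(_ * _) mulrC.
have cd x : U x -> differentiable (flatexp N \o f) x.
  by move=> Ux; apply: differentiable_comp => //; exact: fd.
move=> j; split => [x Ux|]; first by apply: diff_derivable; exact: cd.
apply: (@Ck_eq _ _ k U (fun x => (flatexp N.+2 (f x) - N%:R * flatexp N.+1 (f x))
   * 'D_(basis_vec R j) f x)) => // [x Ux|].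
  rewrite -[RHS]/('D_(basis_vec R j) (flatexp N \o f) x) (deriveE _ (cd x Ux)).
  by rewrite diff_comp //= ?flatE -?deriveE //; exact: fd.
have fk' := CkS oU fk.
apply: CkM => //; last exact: Ck_partial.
by apply: CkB => //; [exact: IH|apply: CkZ => //; exact: IH].
Qed.

(** The quotient [f(r^2 - q) / (f(r^2 - q) + f(q - r^2/2))] with [f = flatexp 0]; the denominator is
    positive since [q < r^2] or [q > r^2/2]. The squared Euclidean distance [q] is polynomial and
    dominates the square of the sup norm, so the bump vanishes outside the sup-norm ball. *)
Lemma bump_exists n (c : 'cV[R]_n) (r : R) : 0 < r ->
  exists phi : 'cV[R]_n -> R, [/\ forall k, Ck k setT phi,
    \forall y \near c, phi y = 1 &
    forall y, r <= `|y - c| -> phi y = 0].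
Proof.
move=> r0; pose q (y : 'cV[R]_n) : R := \sum_i (y i 0 - c i 0) * (y i 0 - c i 0).
have r2 : 0 < r ^+ 2 by rewrite exprn_gt0.
have qk k : Ck k setT q.
  apply: Ck_sum; first exact: openT.
  by move=> i; apply: CkM; (try exact: openT); apply: CkB; (try exact: openT);
     (exact: Ck_coord || exact: Ck_cst).
have flatexp_ge0 x : 0 <= flatexp 0 x.
  by rewrite /flatexp; case: ifP => // _; rewrite expr0 mul1r expR_ge0.
have flatexp_gt0 x : 0 < x -> 0 < flatexp 0 x.
  by move=> x0; rewrite /flatexp x0 expr0 mul1r expR_gt0.
have flatexp0 x : x <= 0 -> flatexp 0 x = 0 by rewrite /flatexp leNgt => /negbTE ->.
pose den y := flatexp 0 (r ^+ 2 - q y) + flatexp 0 (q y - r ^+ 2 / 2).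
have den0 y : den y != 0.
  rewrite gt_eqF // /den; have [qr|qr] := ltP (q y) (r ^+ 2).
    by rewrite ltr_wpDr // flatexp_gt0 // subr_gt0.
  by rewrite ltr_wpDl // flatexp_gt0 //; lra.
exists (fun y => flatexp 0 (r ^+ 2 - q y) * (den y)^-1); split.
- have oT := @openT 'cV[R]_n.
  have num_k k : Ck k setT (fun y => flatexp 0 (r ^+ 2 - q y)).
    by apply: Ck_flatexp => //; apply: CkB => //; exact: Ck_cst.
  move=> k; apply: CkM => //; apply: CkV => //; apply: CkD => //.
  by apply: Ck_flatexp => //; apply: CkB => //; exact: Ck_cst.
- have qc : {for c, continuous q} := qk 0%N c I.
  have q0 : q c = 0 by rewrite /q big1 // => i _; rewrite subrr mul0r.
  have e0 : 0 < r ^+ 2 / 2 by rewrite divr_gt0.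
  have /cvgrPdist_lt/(_ _ e0) := qc; rewrite q0; apply: filterS => y.
  rewrite sub0r normrN => /(le_lt_trans (ler_norm _)) qy.
  rewrite /den (flatexp0 (q y - _)) ?addr0 ?mulfV //; last by rewrite subr_le0 ltW.
  by rewrite gt_eqF // flatexp_gt0 //; lra.
move=> y ry; rewrite (flatexp0 (r ^+ 2 - q y)) ?mul0r // subr_le0.
apply: le_trans (_ : `|y - c| ^+ 2 <= _); first by rewrite ler_pXn2r ?nnegrE // ltW.
have [->|yc0] := eqVneq (y - c) 0.
  rewrite normr0 expr0n sumr_ge0 // => i _; rewrite -expr2; exact: sqr_ge0.
have [[i j]] : exists ij, `|y - c| = `|(y - c) ij.1 ij.2|.
  by apply: mx_norm_neq0; rewrite -[mx_norm _]/(`|y - c|) normr_eq0.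
rewrite ord1 /= => ->; rewrite real_normK ?num_real // !mxE expr2 /q (bigD1 i) //= lerDl.
by rewrite sumr_ge0 // => l _; rewrite -expr2; exact: sqr_ge0.
Qed.

End Bump.

(** * Charts and the Lie bracket *)

Section Jacobian.
Variable R : realType.
Local Notation e_ := (basis_vec R).

Definition diff_at (n a b : nat) (A : 'cV[R]_n -> 'M[R]_(a, b)) (x : 'cV[R]_n) :=
  forall i j, differentiable (fun z => A z i j) x.

Lemma smooth_diff_at (n a b : nat) (A : 'cV[R]_n -> 'M[R]_(a, b)) U x :
  open U -> smooth U A -> U x -> diff_at A x.
Proof. by move=> oU sA Ux i j; exact: smooth_differentiable oU sA Ux. Qed.

Lemma jac_near (n m : nat) (f g : 'cV[R]_n -> 'cV[R]_m) x :
  (\forall z \near x, f z = g z) -> jac f x = jac g x.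
Proof.
move=> fg; apply/matrixP => i j; rewrite !mxE.
by apply: near_eq_derive; apply: filterS fg => z ->.
Qed.

Lemma jac_id (n : nat) (x : 'cV[R]_n) : jac id x = 1%:M.
Proof. by apply/matrixP => i j; rewrite !mxE derive_coord mxE eqxx andbT. Qed.

Lemma jac_mulmx (n m : nat) (f : 'cV[R]_n -> 'cV[R]_m) x v i : diff_at f x ->
  (jac f x *m v) i 0 = 'D_v (fun z => f z i 0) x.
Proof.
move=> fd; rewrite derive_sum_basis ?mxE //.
by apply: eq_bigr => j _; rewrite mxE mulrC.
Qed.

Lemma jac_comp (n m p : nat) (f : 'cV[R]_m -> 'cV[R]_p) (g : 'cV[R]_n -> 'cV[R]_m) x :
  diff_at f (g x) -> diff_at g x -> jac (f \o g) x = jac f (g x) *m jac g x.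
Proof.
move=> fd gd; apply/matrixP => i j; rewrite mxE.
rewrite -[LHS]/('D_(e_ j) ((fun y => f y i 0) \o g) x) derive_comp //.
by rewrite mxE; apply: eq_bigr => l _; rewrite !mxE.
Qed.

Lemma smooth_jac (n m : nat) (f : 'cV[R]_n -> 'cV[R]_m) U :
  smooth U f -> smooth U (jac f).
Proof.
move=> sf i j k; have -> : (fun z => jac f z i j) = 'D_(e_ j) (fun z => f z i 0).
  by apply/funext => z; rewrite mxE.
exact: (Ck_partial j (sf i 0 k.+1)).
Qed.

Lemma jac_mul_mulmx (n m p : nat) (A : 'cV[R]_n -> 'M[R]_(m, p)) (f : 'cV[R]_n -> 'cV[R]_p) x v i :
  diff_at A x -> diff_at f x ->
  (jac (fun z => A z *m f z) x *m v) i 0 =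
  \sum_l 'D_v (fun z => A z i l) x * f x l 0 + (A x *m (jac f x *m v)) i 0.
Proof.
move=> dA df.
have dM l : differentiable (fun z => A z i l * f z l 0) x by exact: differentiableM.
have E : (fun z => (A z *m f z) i 0) = \sum_l (fun z => A z i l * f z l 0).
  by apply/funext => z; rewrite mxE fct_sumE.
have dAf : diff_at (fun z => A z *m f z) x.
  move=> i' j'; rewrite (ord1 j').
  have -> : (fun z => (A z *m f z) i' 0) = \sum_l (fun z => A z i' l * f z l 0).
    by apply/funext => z; rewrite mxE fct_sumE.
  by apply: differentiable_sum => l; apply: differentiableM; [exact: dA|exact: df].
rewrite jac_mulmx // E derive_sum; last by move=> l; exact: diff_derivable.
rewrite [X in _ + X]mxE -big_split /=; apply: eq_bigr => l _.
rewrite deriveM; [|exact/diff_derivable/dA|exact/diff_derivable/df].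
by rewrite jac_mulmx // addrC; congr (_ + _); exact: mulrC.
Qed.

End Jacobian.

Section Charts.
Variables (R : realType) (n : nat) (M : manifold R n).
Implicit Types (p q r x : M) (y z : 'cV[R]_n).
Local Notation e_ := (basis_vec R).

Definition chart_img p : set 'cV[R]_n := chart p @` chart_dom p.
Definition overlap p q : set 'cV[R]_n := chart p @` (chart_dom p `&` chart_dom q).
Definition coord_change p q y : 'cV[R]_n := chart q (chart_inv p y).

Lemma chart_img_open p : open (chart_img p).
Proof. exact: image_open. Qed.

Lemma chart_img_in p x : chart_dom p x -> chart_img p (chart p x).
Proof. by move=> px; exists x. Qed.

Lemma chart_inv_dom p y : chart_img p y -> chart_dom p (chart_inv p y).
Proof. by move=> [x px <-]; rewrite chartK. Qed.

Lemma chart_invK p y : chart_img p y -> chart p (chart_inv p y) = y.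
Proof. by move=> [x px <-]; rewrite chartK. Qed.

Lemma chart_image_nbhs p (O : set M) y : open O -> chart_img p y -> O (chart_inv p y) ->
  \forall z \near y, chart_img p z /\ O (chart_inv p z).
Proof.
move=> oO py Oy.
have h1 := open_nbhs_nbhs (conj (@chart_img_open p) py).
have h2 : \forall z \near y, O (chart_inv p z).
  by apply: (chart_inv_continuous py); exact: open_nbhs_nbhs.
by apply: filterS2 h1 h2 => z.
Qed.

Lemma overlapP p q y :
  overlap p q y <-> chart_img p y /\ chart_dom q (chart_inv p y).
Proof.
split=> [[x [px qx] <-]|[py qy]]; first by rewrite chartK //; split=> //; exists x.
exists (chart_inv p y); last exact: chart_invK.
by split=> //; exact: chart_inv_dom.
Qed.

Lemma overlap_in p q x : chart_dom p x -> chart_dom q x -> overlap p q (chart p x).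
Proof. by move=> px qx; exists x. Qed.

Lemma overlap_open p q : open (overlap p q).
Proof.
rewrite openE => y /overlapP[py qy].
have := chart_image_nbhs (dom_open q) py qy; apply: filterS => z h.
exact/overlapP.
Qed.

Lemma coord_change_smooth p q : smooth (overlap p q) (coord_change p q).
Proof. exact: transition_smooth. Qed.

Lemma coord_change_in p q y : overlap p q y -> overlap q p (coord_change p q y).
Proof. by move=> [x [px qx] <-]; rewrite /coord_change chartK //; exists x. Qed.

Lemma coord_changeK p q y : overlap p q y ->
  chart_inv q (coord_change p q y) = chart_inv p y.
Proof. by move=> [x [px qx] <-]; rewrite /coord_change (chartK px) chartK. Qed.

Lemma coord_change_diff p q x : chart_dom p x -> chart_dom q x ->
  diff_at (coord_change p q) (chart p x).
Proof.
move=> px qx; apply: (smooth_diff_at (@overlap_open p q)); last exact: overlap_in.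
exact: coord_change_smooth.
Qed.

Lemma transition_comp p q r x :
  chart_dom p x -> chart_dom q x -> chart_dom r x ->
  transition q r x *m transition p q x = transition p r x.
Proof.
move=> px qx rx; rewrite /transition.
have E : coord_change p q (chart p x) = chart q x by rewrite /coord_change chartK.
have := @jac_comp R n n n (coord_change q r) (coord_change p q) (chart p x).
rewrite E => <-; [|exact: coord_change_diff|exact: coord_change_diff].
apply: jac_near.
have := open_nbhs_nbhs (conj (@overlap_open p q) (overlap_in px qx)).
by apply: filterS => z zpq; rewrite /= /coord_change -/(coord_change p q z) coord_changeK.
Qed.

Lemma transition_id p x : chart_dom p x -> transition p p x = 1%:M.
Proof.
move=> px; rewrite -(jac_id (chart p x)); apply: jac_near.
have := open_nbhs_nbhs (conj (@chart_img_open p) (chart_img_in px)).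
by apply: filterS => z; exact: chart_invK.
Qed.

Lemma transitionK p q x : chart_dom p x -> chart_dom q x ->
  transition q p x *m transition p q x = 1%:M.
Proof. by move=> px qx; rewrite transition_comp // transition_id. Qed.

Lemma vec_in_chart (X : M -> 'cV[R]_n) q x : chart_dom q x ->
  vec_in X q (chart q x) = transition x q x *m X x.
Proof. by move=> qx; rewrite /vec_in chartK. Qed.

Lemma vec_in_change (X : M -> 'cV[R]_n) p q y : overlap p q y ->
  vec_in X q (coord_change p q y) = jac (coord_change p q) y *m vec_in X p y.
Proof.
move=> [x [px qx] <-]; rewrite /coord_change (chartK px) vec_in_chart // vec_in_chart //.
by rewrite mulmxA -[jac _ _]/(transition p q x) transition_comp //; exact: dom_center.
Qed.

Definition local_bracket (U V : 'cV[R]_n -> 'cV[R]_n) y : 'cV[R]_n :=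
  jac V y *m U y - jac U y *m V y.

(* The second derivatives of the coordinate change cancel by Schwarz's theorem. *)
Lemma lie_bracket_chart (X Y : M -> 'cV[R]_n) q x :
  chart_dom q x -> diff_at (vec_in X q) (chart q x) -> diff_at (vec_in Y q) (chart q x) ->
  lie_bracket X Y x =
  transition q x x *m local_bracket (vec_in X q) (vec_in Y q) (chart q x).
Proof.
move=> qx dX dY; set y := chart q x in dX dY *; set c := chart x x.
have xx := dom_center x.
pose psi := coord_change q x; pose chi := coord_change x q.
have oy : overlap q x y by exact: overlap_in.
have chic : chi c = y by rewrite /chi /coord_change chartK.
have dJ : diff_at (jac psi) y.
  exact: smooth_diff_at (@overlap_open q x) (smooth_jac (@coord_change_smooth q x)) oy.
have J_sym i l m : 'D_(e_ m) (fun z => jac psi z i l) y = 'D_(e_ l) (fun z => jac psi z i m) y.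
  have E l' : (fun z => jac psi z i l') = 'D_(e_ l') (fun z => psi z i 0).
    by apply/funext => z; rewrite mxE.
  rewrite !E; apply: (derive_comm _ _ (@overlap_open q x) _ oy).
  exact: (@coord_change_smooth q x i 0 2%N).
(* Near [c] the components of [Z] in the chart at [x] are those in the chart at [q], pushed forward
   by [jac psi] and composed with [chi]. By the chain rule the Jacobian of [chi] carries the
   components of [W] back to the chart at [q]. *)
have key (Z W : M -> 'cV[R]_n) : diff_at (vec_in Z q) y ->
    jac (vec_in Z x) c *m vec_in W x c =
    jac (fun z => jac psi z *m vec_in Z q z) y *m vec_in W q y.
  move=> dZ; have near_c : \forall z \near c,
      ((fun z => jac psi z *m vec_in Z q z) \o chi) z = vec_in Z x z.
    have := open_nbhs_nbhs (conj (@overlap_open x q) (overlap_in xx qx)).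
    apply: filterS => z xz /=; rewrite -vec_in_change; last exact: coord_change_in.
    rewrite /coord_change -/(coord_change x q z) coord_changeK //.
    by rewrite chart_invK //; case/overlapP: xz.
  rewrite -(jac_near near_c) jac_comp.
  - rewrite chic -mulmxA -[y in vec_in W q y]chic vec_in_change //.
    exact: overlap_in.
  - rewrite chic => i j; rewrite (ord1 j).
    have -> : (fun z => (jac psi z *m vec_in Z q z) i 0) =
        \sum_l (fun z => jac psi z i l * vec_in Z q z l 0).
      by apply/funext => z; rewrite mxE fct_sumE.
    by apply: differentiable_sum => l; apply: differentiableM; [exact: dJ|exact: dZ].
  - exact: coord_change_diff.
have swap (v w : 'cV[R]_n) i : \sum_l 'D_v (fun z => jac psi z i l) y * w l 0 =
    \sum_l 'D_w (fun z => jac psi z i l) y * v l 0.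
  under eq_bigr => l _ do rewrite (derive_sum_basis _ (dJ i l)) mulr_suml.
  under [RHS]eq_bigr => l _ do rewrite (derive_sum_basis _ (dJ i l)) mulr_suml.
  rewrite exchange_big /=; apply: eq_bigr => l _; apply: eq_bigr => m _.
  rewrite (J_sym i m l); move: ('D_(e_ m) _ y) => d.
  by rewrite mulrAC [RHS]mulrAC [X in X * _ = _]mulrC.
have -> : lie_bracket X Y x =
    jac (fun z => jac psi z *m vec_in Y q z) y *m vec_in X q y -
    jac (fun z => jac psi z *m vec_in X q z) y *m vec_in Y q y.
  exact: (congr2 (fun a b => a - b) (key Y X dY) (key X Y dX)).
rewrite /local_bracket mulmxBr; apply/colP => i.
rewrite [LHS]mxE [X in _ + X]mxE [RHS]mxE [X in _ = _ + X]mxE.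
rewrite (jac_mul_mulmx _ _ dJ dX) (jac_mul_mulmx _ _ dJ dY).
rewrite (swap (vec_in X q y) (vec_in Y q y) i) opprD addrACA subrr add0r.
by [].
Qed.

End Charts.

(** * Global extension of local vector fields *)

Section Extension.
Variables (R : realType) (n : nat) (M : manifold R n).
Implicit Types (p q x : M) (y z : 'cV[R]_n).
Local Notation e_ := (basis_vec R).

Lemma open_norm_sub_lt (V : normedModType R) (c : V) (r : R) : open [set z : V | `|z - c| < r].
Proof.
rewrite openE => z /= zr.
suff H : \forall w \near z, `|w - c| < r by exact: H.
apply: (proj2 (near_normP z (fun w => `|w - c| < r))).
exists (r - `|z - c|) => [|w wz]; first by rewrite subr_gt0.
by rewrite -(subrKA z) (le_lt_trans (ler_normD _ _)) // -ltrBrDr.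
Qed.

Lemma closed_ball_image_compact q y0 (r : R) :
  (forall y, `|y - y0| <= r -> chart_img q y) -> 0 <= r ->
  compact (chart_inv q @` [set y | `|y - y0| <= r]).
Proof.
move=> imgq r0.
(* A sup-norm ball is a product of segments; transposition transports the compact box of row vectors
   to columns. *)
pose K := [set v : 'rV[R]_n | forall i, `[y0 i 0 - r, y0 i 0 + r]%classic (v 0 i)].
have cK : compact K.
  exact: (@rV_compact R n _ (fun i => @segment_compact R (y0 i 0 - r) (y0 i 0 + r))).
have KE (v : 'rV[R]_n) : K v -> `|v^T - y0| <= r.
  move=> Kv; apply: mx_norm_le => // i j; rewrite ord1 !mxE.
  have := Kv i; rewrite /= in_itv /= => /andP[h1 h2].
  by rewrite ler_norml lerBrDl h1 lerBlDl.
have -> : chart_inv q @` [set y | `|y - y0| <= r] = (fun v : 'rV[R]_n => chart_inv q v^T) @` K.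
  apply/seteqP; split=> [x [y /= yr <-]|x [v /KE Kv <-]]; last by exists v^T.
  exists y^T; last by rewrite trmxK.
  move=> i /=; rewrite in_itv /= !mxE.
  have := mx_entry_norm (y - y0) i 0; rewrite !mxE => /le_trans/(_ yr).
  by rewrite ler_norml => /andP[h1 h2]; apply/andP; split; lra.
apply: continuous_compact => //; apply: continuous_in_subspaceT => v.
rewrite inE => Kv.
apply: (@continuous_comp _ _ _ (fun v : 'rV[R]_n => v^T) (chart_inv q)).
  apply: continuous_mx => i j.
  have -> : (fun w : 'rV[R]_n => w^T i j) = (fun w => w j i).
    by apply/funext => w; rewrite mxE.
  exact: coord_continuous.
exact/chart_inv_continuous/imgq/KE.
Qed.

Lemma smooth_continuous (m a b : nat) (A : 'cV[R]_m -> 'M[R]_(a, b)) U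
    (y : 'cV[R]_m) :
  smooth U A -> U y -> {for y, continuous A}.
Proof. by move=> sA Uy; apply: continuous_mx => i j; exact: (sA i j 0%N). Qed.

Lemma open_preimage (m : nat) (f : 'cV[R]_m -> 'cV[R]_n) (W : set 'cV[R]_m) (O : set 'cV[R]_n) :
  open W -> open O -> (forall w : 'cV[R]_m, W w -> {for w, continuous f}) ->
  open [set w | W w /\ O (f w)].
Proof.
move=> oW oO fc; rewrite openE => y /= [Wy Ofy].
have h1 := open_nbhs_nbhs (conj oW Wy).
have h2 : \forall z \near y, O (f z) by apply: (fc y Wy); exact: open_nbhs_nbhs.
by apply: filterS2 h1 h2 => z.
Qed.

(** The field is cut off by a bump function and extended by zero. Smoothness across the boundary of
    the chart domain rests on the Hausdorff property: the image [KM] of the closed ball is compact,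
    hence closed in [M], and the field vanishes on its open complement. *)
Lemma vec_extension q U (V : 'cV[R]_n -> 'cV[R]_n) y0 :
  open U -> U `<=` chart_img q -> smooth U V -> U y0 ->
  exists2 X : M -> 'cV[R]_n, smooth_vec X & \forall y \near y0, vec_in X q y = V y.
Proof.
move=> oU Uq sV Uy0.
have near_U : \forall y \near y0, U y by exact: (open_nbhs_nbhs (conj oU Uy0)).
have /near_normP[d d0 dU] := near_U.
pose r := d / 2; have r0 : 0 < r by rewrite divr_gt0.
have rU y : `|y - y0| <= r -> U y.
  by move=> yr; apply: dU; rewrite (le_lt_trans yr) // /r; lra.
have [phi [phik phi1 phi0]] := bump_exists y0 r0.
pose V' y := phi y *: V y.
have sV' : smooth U V'.
  by apply: smoothZ => // k; apply: Ck_sub (phik k).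
have V'0 y : r < `|y - y0| -> V' y = 0.
  by move=> /ltW/phi0 p0; rewrite /V' p0 scale0r.
pose X x : 'cV[R]_n :=
  if `[< chart_dom q x >] then transition q x x *m V' (chart q x) else 0.
have Xin x : chart_dom q x -> X x = transition q x x *m V' (chart q x).
  by move=> qx; rewrite /X asboolT.
have X0 x : (chart_dom q x -> V' (chart q x) = 0) -> X x = 0.
  by move=> h; rewrite /X; case: asboolP => // /h ->; rewrite mulmx0.
exists X; last first.
  apply: filterS2 near_U phi1 => y /Uq qy p1.
  have qx := chart_inv_dom qy.
  rewrite -[in LHS](chart_invK qy) vec_in_chart // Xin // mulmxA transitionK //.
    by rewrite mul1mx chart_invK // /V' p1 scale1r.
  exact: dom_center.
pose KM := chart_inv q @` [set y | `|y - y0| <= r].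
have KM_closed : closed KM.
  apply: compact_closed; first exact: manifold_hausdorff.
  by apply: closed_ball_image_compact (ltW r0) => y /rU/Uq.
move=> p; apply/smoothP => y py.
pose chi := coord_change p q.
have chi_cont z : overlap p q z -> {for z, continuous chi}.
  exact: smooth_continuous (@coord_change_smooth _ _ M p q).
pose Dq := [set z | overlap p q z /\ U (chi z)].
have oDq : open Dq by apply: open_preimage => //; exact: overlap_open.
(* Either [y] corresponds to a point of [U], where a smooth formula holds, or it lies off [KM],
   where the field is zero nearby. *)
have [Dqy|nDqy] := pselect (Dq y).
  suff : smooth Dq (vec_in X p) by move=> /smoothP; exact.
  have schi : smooth Dq chi.
    by apply: smooth_sub (@coord_change_smooth _ _ M p q) => z [].
  have sJ : smooth Dq (jac (coord_change q p) \o chi).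
    apply: (smooth_comp oDq (@overlap_open _ _ M q p)) => //.
      by move=> z [/coord_change_in].
    by apply: smooth_jac; exact: coord_change_smooth.
  have sVchi : smooth Dq (V' \o chi) by apply: (smooth_comp oDq oU) => // z [].
  apply: smooth_eq (smoothM oDq sJ sVchi) => // z [zpq _] /=.
  have [pz qz] := (overlapP p q z).1 zpq.
  rewrite -[in RHS](chart_invK pz) vec_in_chart; last exact: chart_inv_dom.
  rewrite Xin // mulmxA; congr (_ *m _).
  rewrite transition_comp //; [exact: dom_center|exact: chart_inv_dom].
have nKM : (~` KM) (chart_inv p y).
  move=> [k /= kr kE]; have qk := Uq _ (rU _ kr).
  apply: nDqy; split.
    by apply/overlapP; split => //; rewrite -kE; exact: chart_inv_dom.
  by rewrite /chi /coord_change -kE chart_invK //; exact: rU.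
have oKM : open (~` KM) by exact: closed_openC.
have near_y := chart_image_nbhs oKM py nKM.
apply: (@smooth_near _ _ _ _ _ (fun=> 0)); last exact: smooth_cst.
move=> _ ->; apply: filterS near_y => z [pz nz].
rewrite /vec_in X0 ?mulmx0 // => qx; apply: V'0; rewrite ltNge; apply/negP => zr.
by apply: nz; exists (chart q (chart_inv p z)) => //; exact: chartK.
Qed.

Lemma end_in_chart (P : M -> 'M[R]_n) q x : chart_dom q x ->
  end_in P q (chart q x) = transition x q x *m P x *m transition q x x.
Proof. by move=> qx; rewrite /end_in chartK. Qed.

Lemma vec_in_mulmx (P : M -> 'M[R]_n) (X : M -> 'cV[R]_n) q y : chart_img q y ->
  vec_in (fun x => P x *m X x) q y = end_in P q y *m vec_in X q y.
Proof.
move=> [x qx <-]; rewrite end_in_chart // !vec_in_chart //.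
rewrite -[in RHS]mulmxA [transition q x x *m _]mulmxA transitionK ?mul1mx ?mulmxA //.
exact: dom_center.
Qed.

Lemma smooth_vec_mulmx (P : M -> 'M[R]_n) (X : M -> 'cV[R]_n) :
  smooth_end P -> smooth_vec X -> smooth_vec (fun x => P x *m X x).
Proof.
move=> sP sX q; have oq := @chart_img_open _ _ M q.
apply: smooth_eq (smoothM oq (sP q) (sX q)) => // y qy.
by rewrite vec_in_mulmx.
Qed.

Lemma end_in_idem (P : M -> 'M[R]_n) q y : (forall x, P x *m P x = P x) -> chart_img q y ->
  end_in P q y *m end_in P q y = end_in P q y.
Proof.
move=> PP [x qx <-]; rewrite end_in_chart //.
have H : transition q x x *m transition x q x = 1%:M by apply: transitionK => //; exact: dom_center.
rewrite !mulmxA -[_ *m transition q x x *m transition x q x]mulmxA H mulmx1.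
by rewrite -[_ *m P x *m P x]mulmxA PP.
Qed.

End Extension.

(** * Frobenius' theorem *)

Section Frobenius.
Variables (R : realType) (n : nat) (M : manifold R n).
Local Notation e_ := (basis_vec R).

Lemma jac_mulmx_const (a b c : nat) (A : 'M[R]_(a, b)) (f : 'cV[R]_c -> 'cV[R]_b)
    (x v : 'cV[R]_c) : diff_at f x ->
  jac (fun z => A *m f z) x *m v = A *m (jac f x *m v).
Proof.
move=> df; have dA : diff_at (fun _ : 'cV[R]_c => A) x.
  by move=> i j; exact: differentiable_cst.
apply/colP => i; rewrite (jac_mul_mulmx _ _ dA df) big1 ?add0r // => l _.
by rewrite (derive_cst (A i l)) mul0r.
Qed.

Lemma jac_cst (a c : nat) (u : 'cV[R]_a) (x : 'cV[R]_c) : jac (fun=> u) x = 0.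
Proof.
by apply/matrixP => i j; rewrite !mxE; exact: (derive_cst (u i 0)).
Qed.

Lemma near_unitmx (a : nat) (A : 'cV[R]_n -> 'M[R]_a) U y0 :
  open U -> smooth U A -> U y0 -> A y0 \in unitmx -> \forall y \near y0, A y \in unitmx.
Proof.
move=> oU sA Uy0; rewrite unitmxE unitfE => d0.
have dc : {for y0, continuous (fun y => \det (A y))} :=
  smooth_det 0 oU sA y0 Uy0.
have n0 : 0 < `|\det (A y0)| by rewrite normr_gt0.
have /cvgrPdist_lt/(_ _ n0) := dc; apply: filterS => y yd.
by rewrite unitmxE unitfE; apply/eqP => y0d; move: yd; rewrite y0d subr0 ltxx.
Qed.

(** In a rank factorisation of an idempotent the outer factors of [B C B C = B C] cancel by their
    one-sided inverses. *)
Lemma mulmx_cancel_idem (k m : nat) (B : 'M[R]_(m, k)) (C : 'M[R]_(k, m))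
    (L : 'M[R]_(k, m)) (N : 'M[R]_(m, k)) :
  L *m B = 1%:M -> C *m N = 1%:M -> (B *m C) *m (B *m C) = B *m C -> C *m B = 1%:M.
Proof.
move=> LB CN /(congr1 (fun A => L *m A *m N)).
by rewrite !mulmxA !LB !mul1mx -!mulmxA !CN !mulmx1.
Qed.

Lemma mulmx_frame_norm (k m : nat) (Q : 'M[R]_m) (B : 'M[R]_(m, k)) (C : 'M[R]_(k, m)) :
  C *m Q *m B \in unitmx -> C *m (Q *m B *m invmx (C *m Q *m B)) = 1%:M.
Proof. by move=> N1; rewrite !(mulmxA C) mulmxV. Qed.

(* Near the base point the image of a projector Q is the graph of a function over its
   image at the base point; the frame [E] is normalised by [C *m E y = 1], so that its
   columns commute as soon as their brackets stay in the image of Q. *)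
Lemma projector_frame (Q : 'cV[R]_n -> 'M[R]_n) U y0 : open U -> smooth U Q -> U y0 ->
  (forall y, U y -> Q y *m Q y = Q y) ->
  exists (k : nat) (C : 'M[R]_(k, n)) (E : 'cV[R]_n -> 'M[R]_(n, k)) (d : R),
  [/\ 0 < d, (forall y, `|y - y0| < d -> U y),
      smooth [set y | `|y - y0| < d] E,
      (forall y, `|y - y0| < d -> C *m E y = 1%:M /\ Q y *m E y = E y) &
      (forall y (u : 'cV[R]_n), `|y - y0| < d -> Q y *m u = u -> C *m u = 0 -> u = 0)].
Proof.
move=> oU sQ Uy0 QQ; pose P0 := Q y0; pose k : nat := \rank P0.
pose B : 'M[R]_(n, k) := col_base P0; pose C : 'M[R]_(k, n) := row_base P0.
have BC : B *m C = P0 by exact: mulmx_base.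
have CB : C *m B = 1%:M.
  have /row_fullP[L LB] : row_full B by exact: col_base_full.
  have /row_freeP[N CN] : row_free C by exact: row_base_free.
  by apply: (mulmx_cancel_idem LB CN); rewrite BC; exact: QQ.
have sN1 : smooth U (fun y => C *m Q y *m B).
  apply: smoothM => //; last exact: smooth_cst.
  by apply: smoothM => //; exact: smooth_cst.
(* This matrix is the identity at [y0], hence invertible nearby. It annihilates any [u] with
   [Q y *m u = u] and [C *m u = 0], so [C] is injective on the image of [Q y]: the rank cannot jump
   up. *)
have sN2 : smooth U (fun y => 1%:M - Q y + P0).
  apply: smoothD => //; last exact: smooth_cst.
  by apply: smoothD => //; [exact: smooth_cst|exact: smoothN].
have u1 : \forall y \near y0, C *m Q y *m B \in unitmx.
  apply: near_unitmx oU sN1 Uy0 _.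
  by rewrite -/P0 -BC mulmxA CB mul1mx CB unitmx1.
have u2 : \forall y \near y0, 1%:M - Q y + P0 \in unitmx.
  by apply: near_unitmx oU sN2 Uy0 _; rewrite -/P0 subrK unitmx1.
have near_all : \forall y \near y0, [/\ U y, C *m Q y *m B \in unitmx &
    1%:M - Q y + P0 \in unitmx].
  by apply: filterS3 (open_nbhs_nbhs (conj oU Uy0)) u1 u2 => y.
move/near_normP: near_all => [d d0 dP].
have Wsub (y : 'cV[R]_n) : `|y - y0| < d -> U y by case/dP.
exists k, C, (fun y => Q y *m B *m invmx (C *m Q y *m B)), d; split => //.
- have oW := open_norm_sub_lt y0 d.
  have sub : [set y : 'cV[R]_n | `|y - y0| < d] `<=` U by move=> y; exact: Wsub.
  apply: smoothM => //.
    by apply: smoothM => //; [exact: smooth_sub sub sQ|exact: smooth_cst].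
  by apply: smooth_inv => //; [exact: smooth_sub sub sN1|move=> y /dP[]].
- move=> y yd; have [Uy N1 _] := dP y yd; split; first exact: mulmx_frame_norm.
  by rewrite !mulmxA QQ.
- move=> y u yd Qu Cu; have [_ _ N2] := dP y yd.
  have : (1%:M - Q y + P0) *m u = 0.
    by rewrite mulmxDl mulmxBl mul1mx Qu subrr add0r -BC -mulmxA Cu mulmx0.
  by move/(congr1 (mulmx (invmx (1%:M - Q y + P0)))); rewrite mulKmx // mulmx0.
Qed.

Variable P : M -> 'M[R]_n.
Hypotheses (P_smooth : smooth_end P) (PP : forall x, P x *m P x = P x).
Hypothesis P_closed : eigen_closed (@smooth_vec R n M) (@lie_bracket R n M) P 1.

(** Extensions of [V] and [W] need not be sections of the distribution away from [y], so they are
    projected by [P]. Near [y] the projection changes nothing, and the bracket is local. *)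
Lemma local_bracket_closed q U (V W : 'cV[R]_n -> 'cV[R]_n) y :
  open U -> U `<=` chart_img q -> smooth U V -> smooth U W -> U y ->
  (forall z, U z -> end_in P q z *m V z = V z) ->
  (forall z, U z -> end_in P q z *m W z = W z) ->
  end_in P q y *m local_bracket V W y = local_bracket V W y.
Proof.
move=> oU Uq sV sW Uy PV PW.
have near_U : \forall z \near y, U z by exact: (open_nbhs_nbhs (conj oU Uy)).
have [X sX XV] := vec_extension oU Uq sV Uy.
have [Y sY YW] := vec_extension oU Uq sW Uy.
pose PX x := P x *m X x; pose PY x := P x *m Y x.
have sPX : smooth_vec PX by exact: smooth_vec_mulmx.
have sPY : smooth_vec PY by exact: smooth_vec_mulmx.
have PXV : \forall z \near y, vec_in PX q z = V z.
  by apply: filterS2 near_U XV => z Uz e; rewrite vec_in_mulmx ?e ?PV //; exact: Uq.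
have PYW : \forall z \near y, vec_in PY q z = W z.
  by apply: filterS2 near_U YW => z Uz e; rewrite vec_in_mulmx ?e ?PW //; exact: Uq.
have [x qx xy] := Uq y Uy; have xx := dom_center x.
have closed_x : P x *m lie_bracket PX PY x = lie_bracket PX PY x.
  have := P_closed sPX sPY _ _ x; rewrite scale1r; apply => z; rewrite scale1r.
    by rewrite /PX mulmxA PP.
  by rewrite /PY mulmxA PP.
have dPX : diff_at (vec_in PX q) (chart q x).
  by apply: smooth_diff_at (@chart_img_open _ _ M q) (sPX q) _; exact: chart_img_in.
have dPY : diff_at (vec_in PY q) (chart q x).
  by apply: smooth_diff_at (@chart_img_open _ _ M q) (sPY q) _; exact: chart_img_in.
have LB : local_bracket (vec_in PX q) (vec_in PY q) y = local_bracket V W y.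
  rewrite /local_bracket (jac_near PXV) (jac_near PYW).
  by rewrite (nbhs_singleton PXV) (nbhs_singleton PYW).
move: closed_x; rewrite (lie_bracket_chart qx dPX dPY) xy LB.
move: (local_bracket V W y) => L closed_x.
have TT : transition x q x *m transition q x x = 1%:M by exact: transitionK.
rewrite -xy end_in_chart // -mulmxA -mulmxA closed_x mulmxA TT mul1mx //.
Qed.

Lemma frobenius : integrable_distribution (fun x : M => [set v | P x *m v = v]).
Proof.
move=> q; pose y0 := chart q q; have qq := dom_center q.
have oq := @chart_img_open _ _ M q.
have [k [C [E [d [d0 dq sE CE inj]]]]] := projector_frame oq (P_smooth q)
   (chart_img_in qq) (fun y => @end_in_idem _ _ M P q y PP).
pose U := [set y : 'cV[R]_n | `|y - y0| < d].
have oU : open U by exact: open_norm_sub_lt.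
have Uq : U `<=` chart_img q by move=> y; exact: dq.
have Uy0 : U y0 by rewrite /U /= subrr normr0.
have sEa a : smooth U (fun y => col a (E y)).
  move=> i j p; have -> : (fun y => col a (E y) i j) = (fun y => E y i a).
    by apply/funext => y; rewrite mxE.
  exact: sE.
(* The bracket lies in the image of the projector, by closedness, and [C] kills it because each
   [C *m col a (E z)] is constant in [z]; on that image [C] is injective. *)
have bracket0 y a b : U y ->
    local_bracket (fun z => col a (E z)) (fun z => col b (E z)) y = 0.
  move=> Uy; apply: (inj y) => //.
    by apply: local_bracket_closed oU Uq (sEa a) (sEa b) Uy _ _ => z Uz;
       rewrite colE mulmxA; have [_ ->] := CE z Uz.
  have C0 c (v : 'cV[R]_n) : C *m (jac (fun z => col c (E z)) y *m v) = 0.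
    rewrite -jac_mulmx_const; last exact: smooth_diff_at oU (sEa c) Uy.
    rewrite (@jac_near _ _ _ _ (fun=> col c 1%:M)) ?jac_cst ?mul0mx //.
    apply: filterS (open_nbhs_nbhs (conj oU Uy)) => z Uz.
    by rewrite !colE mulmxA; have [-> _] := CE z Uz.
  by rewrite /local_bracket mulmxBr !C0 subrr.
have comm y i a b : U y ->
    \sum_m 'D_(e_ m) (fun z => E z i a) y * E y m b =
    \sum_m 'D_(e_ m) (fun z => E z i b) y * E y m a.
  move=> /(bracket0 y b a)/eqP; rewrite subr_eq0 => /eqP/colP/(_ i).
  have jE c m : jac (fun z => col c (E z)) y i m = 'D_(e_ m) (fun z => E z i c) y.
    rewrite mxE; have -> : (fun z => col c (E z) i 0) = (fun z => E z i c); last by [].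
    by apply/funext => z; rewrite mxE.
  rewrite mxE [RHS]mxE => H; transitivity (\sum_j jac (fun z => col a (E z)) y i j *
      col b (E y) j 0).
    by apply: eq_bigr => m _; rewrite jE mxE.
  by rewrite H; apply: eq_bigr => m _; rewrite jE mxE.
have [X [r [r0 X0 XU sX XE]]] := local_frobenius oU sE Uy0 comm.
pose W := [set h : 'cV[R]_k | `|h| < r].
have oW : open W by exact: open_norm_lt.
have W0 : W 0 by rewrite /W /= normr0.
have Xc h : W h -> {for h, continuous X} by exact: smooth_continuous sX.
have dX h : W h -> diff_at X h by exact: smooth_diff_at oW sX.
pose F h := chart_inv q (X h).
have FX h : W h -> chart_dom q (F h) /\ chart q (F h) = X h.
  by move=> /XU/Uq Xq; split; [exact: chart_inv_dom|exact: chart_invK].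
(* Since [C *m E = 1], the map [C *m X h - h] has zero derivative and is constant on the ball. So
   [h] can be read off from [X h], which makes the immersion injective. *)
have CX h : W h -> C *m X h - h = C *m X 0.
  move=> Wh; apply/colP => i.
  pose g h := (C *m X h) i 0 - h i 0.
  have gd z : W z -> differentiable (fun h => (C *m X h) i 0) z.
    move=> Wz; have -> : (fun h => (C *m X h) i 0) = \sum_l (C i l *: (fun h => X h l 0)).
      by apply/funext => t; rewrite mxE fct_sumE.
    by apply: differentiable_sum => l; apply: differentiableZ; exact: dX.
  have gD j z : W z -> derivable g z (e_ j) /\ 'D_(e_ j) g z = 0.
    move=> Wz; have d1 : derivable (fun h => (C *m X h) i 0) z (e_ j).
      by apply: diff_derivable; exact: gd.
    have d2 : derivable (fun h : 'cV[R]_k => h i 0) z (e_ j).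
      by apply: diff_derivable; exact: differentiable_coord.
    split; first exact: derivableB d1 d2.
    rewrite (deriveB d1 d2) derive_coord.
    have -> : 'D_(e_ j) (fun h => (C *m X h) i 0) z = jac (fun h => C *m X h) z i j.
      by rewrite mxE.
    have -> : jac (fun h => C *m X h) z i j = (jac (fun h => C *m X h) z *m e_ j) i 0.
      by rewrite /basis_vec -colE [RHS]mxE.
    rewrite jac_mulmx_const; last exact: dX.
    rewrite XE // mulmxA; have [-> _] := CE _ (XU z Wz).
    by rewrite mul1mx subrr.
  have small (z : 'cV[R]_k) : `|z - 0| <= `|h| -> W z.
    by rewrite subr0 => /le_lt_trans; apply.
  have := @C1_increment R k g 0 h 0 0 (fun j z zh => (gD j z (small z zh)).1).
  rewrite mulr0 mul0r addr0 big1 ?subr0 => [H|j _]; last by rewrite mxE mul0r.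
  have : `|g h - g 0| <= 0.
    by apply: H => j z zh; rewrite (gD j z (small z zh)).2 mxE subrr normr0.
  have z0 : (0 : 'cV[R]_k) i 0 = 0 by rewrite mxE.
  rewrite normr_le0 subr_eq0 /g z0 subr0 => /eqP gE.
  by rewrite [LHS]mxE [X in _ + X]mxE.
exists k, W, F; split.
- split=> //; exists 0 => //; rewrite /F X0; exact: chartK.
- split=> [h Wh|q'].
    apply: (@continuous_comp _ _ _ X (chart_inv q)); first exact: Xc.
    exact/chart_inv_continuous/Uq/XU.
  pose W' := [set h | W h /\ overlap q q' (X h)].
  have -> : W `&` F @^-1` chart_dom q' = W'.
    apply/seteqP; split => h [Wh Fh]; split => //.
      by apply/overlapP; split => //; exact/Uq/XU.
    by have /overlapP[] := Fh.
  have oW' : open W' by apply: open_preimage => //; exact: overlap_open.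
  have gUV h : W' h -> overlap q q' (X h) by case.
  have sXW : smooth W' X by apply: smooth_sub sX => h [].
  exact: (smooth_comp oW' (@overlap_open _ _ M q q') gUV sXW (@coord_change_smooth _ _ M q q')).
- move=> h h' Wh Wh' FF.
  have XX : X h = X h' by rewrite -(FX h Wh).2 -(FX h' Wh').2 FF.
  have := CX h Wh; rewrite -(CX h' Wh') XX => /eqP.
  by rewrite (inj_eq (addrI _)) eqr_opp => /eqP.
move=> h Wh; have [qx xE] := FX h Wh; set x := F h in qx xE *; have xx := dom_center x.
have [CE1 QE] := CE _ (XU h Wh).
(* Tangent vectors at [x] are expressed in the chart centred at [x] itself, hence the transition
   factor. *)
have dFE : jac (fun z => chart x (F z)) h = transition q x x *m E (X h).
  rewrite -[X in jac X]/(coord_change q x \o X) jac_comp; first by rewrite XE // /transition xE.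
    by rewrite -xE; exact: coord_change_diff.
  exact: dX.
rewrite dFE.
have TT : transition x q x *m transition q x x = 1%:M by exact: transitionK.
have TT' : transition q x x *m transition x q x = 1%:M by exact: transitionK.
have PT : P x *m transition q x x = transition q x x *m end_in P q (X h).
  by rewrite -xE end_in_chart // !mulmxA TT' mul1mx.
split.
  apply/eqP; change (row_full (transition q x x *m E (X h))).
  apply/row_fullP; exists (C *m transition x q x).
  by rewrite -mulmxA [_ *m (_ *m E _)]mulmxA TT mul1mx.
apply/seteqP; split => [v /= Pv|_ [u _ <-]] /=; last first.
  by rewrite !mulmxA PT -[_ *m end_in P q _ *m _]mulmxA QE.
pose u := transition x q x *m v.
have Tu : transition q x x *m u = v by rewrite mulmxA TT' mul1mx.
have Qu : end_in P q (X h) *m u = u.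
  by rewrite -xE end_in_chart // /u -mulmxA [transition q x x *m _]mulmxA TT' mul1mx -mulmxA Pv.
exists (C *m u) => //; rewrite -mulmxA -[RHS]Tu; congr (_ *m _).
(* The vector [u] and its candidate [E *m (C *m u)] both lie in the image of the projector and have
   the same image under [C]. *)
apply/esym/eqP; rewrite -subr_eq0; apply/eqP; apply: (inj (X h)); first exact: XU.
  by rewrite mulmxBr Qu (mulmxA _ (E (X h))) QE.
by rewrite mulmxBr (mulmxA _ (E (X h))) CE1 mul1mx subrr.
Qed.

End Frobenius.

(** * Eigenbundles of block endomorphisms *)

Section Generalized.
Variables (R : realType) (n : nat) (M : manifold R n).
Local Notation e_ := (basis_vec R).

Lemma mulmx_block_col0 (F : fieldType) (r t : 'M[F]_n) (u w : 'cV[F]_n) :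
  block_mx r 0 0 t *m col_mx u w = col_mx (r *m u) (t *m w).
Proof. by rewrite mul_block_col !mul0mx addr0 add0r. Qed.

Lemma mulmx_antiblock_col (F : fieldType) (p f : 'M[F]_n) (u w : 'cV[F]_n) :
  block_mx 0 p f 0 *m col_mx u w = col_mx (p *m w) (f *m u).
Proof. by rewrite mul_block_col !mul0mx addr0 add0r. Qed.

Lemma gend_in_block (A B C D : M -> 'M[R]_n) q y :
  gend_in (fun x => block_mx (A x) (B x) (C x) (D x)) q y =
  let x := chart_inv q y in
  let T := transition x q x in let T' := transition q x x in
  block_mx (T *m A x *m T') (T *m B x *m T^T) (T'^T *m C x *m T') (T'^T *m D x *m T^T).
Proof.
rewrite /gend_in /gtransition /= !mulmx_block.
by rewrite !(mul0mx, mulmx0, addr0, add0r).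
Qed.

Lemma smooth_end_ul (r p f t : M -> 'M[R]_n) :
  smooth_gend (fun x => block_mx (r x) (p x) (f x) (t x)) -> smooth_end r.
Proof.
move=> sS q i j k.
have -> : (fun y => end_in r q y i j) =
    (fun y => gend_in (fun x => block_mx (r x) (p x) (f x) (t x)) q y (lshift n i) (lshift n j)).
  by apply/funext => y; rewrite gend_in_block /= block_mxEul.
exact: sS.
Qed.

Lemma smooth_form_dl (r p theta t : M -> 'M[R]_n) :
  smooth_gend (fun x => block_mx (r x) (p x) (flat (theta x)) (t x)) -> smooth_form theta.
Proof.
move=> sS q i j k.
have -> : (fun y => form_in theta q y i j) =
    (fun y => gend_in (fun x => block_mx (r x) (p x) (flat (theta x)) (t x)) q y
                (rshift n j) (lshift n i)).
  apply/funext => y; rewrite gend_in_block /= block_mxEdl /form_in /=.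
  set T := transition q _ _; set G := theta _.
  transitivity ((T^T *m flat G *m T)^T i j); last by rewrite mxE.
  by rewrite !trmx_mul !trmxK /flat mulmxA.
exact: sS.
Qed.

Lemma smooth_col_mx (a b c : nat) U (A : 'cV[R]_c -> 'M[R]_(a, 1)) (B : 'cV[R]_c -> 'M[R]_(b, 1)) :
  smooth U A -> smooth U B -> smooth U (fun y => col_mx (A y) (B y)).
Proof.
move=> sA sB i j k; case: (split_ordP i) => l ->.
  have -> : (fun y => col_mx (A y) (B y) (lshift b l) j) = (fun y => A y l j); last exact: sA.
  by apply/funext => y; rewrite col_mxEu.
have -> : (fun y => col_mx (A y) (B y) (rshift a l) j) = (fun y => B y l j); last exact: sB.
by apply/funext => y; rewrite col_mxEd.
Qed.

Lemma smooth_gvec_col (X t : M -> 'cV[R]_n) : smooth_vec X ->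
  smooth_in_charts (covec_in t) -> smooth_gvec (fun x => col_mx (X x) (t x)).
Proof.
move=> sX st q.
have -> : gvec_in (fun x => col_mx (X x) (t x)) q =
    (fun y => col_mx (vec_in X q y) (covec_in t q y)).
  by apply/funext => y; rewrite /gvec_in /gtransition /= mulmx_block_col0.
by apply: smooth_col_mx; [exact: sX|exact: st].
Qed.

Lemma smooth_covec0 : smooth_in_charts (covec_in (fun=> 0 : 'cV[R]_n) : M -> _).
Proof.
move=> q; have -> : covec_in (fun=> 0 : 'cV[R]_n) q = (fun=> 0 : 'cV[R]_n).
  by apply/funext => y; rewrite /covec_in mulmx0.
exact: smooth_cst.
Qed.

Lemma courant_vec (X Y : M -> 'cV[R]_n) x :
  usubmx (courant (fun z => col_mx (X z) 0) (fun z => col_mx (Y z) 0) x) = lie_bracket X Y x.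
Proof.
rewrite col_mxKu; congr (lie_bracket _ _ x); apply/funext => z; exact: col_mxKu.
Qed.

Lemma eigen_closed_vec (r t : M -> 'M[R]_n) c :
  eigen_closed (@smooth_gvec R n M) (@courant R n M) (fun x => block_mx (r x) 0 0 (t x)) c ->
  eigen_closed (@smooth_vec R n M) (@lie_bracket R n M) r c.
Proof.
move=> H X Y sX sY rX rY x.
have sc (Z : M -> 'cV[R]_n) : smooth_vec Z -> smooth_gvec (fun z => col_mx (Z z) 0).
  by move=> sZ; apply: smooth_gvec_col => //; exact: smooth_covec0.
have eigc (Z : M -> 'cV[R]_n) : (forall p, r p *m Z p = c *: Z p) ->
    forall p, block_mx (r p) 0 0 (t p) *m col_mx (Z p) 0 = c *: col_mx (Z p) 0.
  by move=> rZ p; rewrite mulmx_block_col0 rZ mulmx0 scale_col_mx scaler0.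
have := H _ _ (sc X sX) (sc Y sY) (eigc X rX) (eigc Y rY) x.
rewrite -[courant _ _ x]vsubmxK courant_vec mulmx_block_col0 scale_col_mx.
by move=> /eq_col_mx[].
Qed.

Lemma to_complex0 (a b : nat) : to_complex (0 : 'M[R]_(a, b)) = 0.
Proof. exact: (map_mx0 (real_complex R)). Qed.

Lemma to_complexM (a b c : nat) (A : 'M[R]_(a, b)) (B : 'M[R]_(b, c)) :
  to_complex (A *m B) = to_complex A *m to_complex B.
Proof. exact: (map_mxM (real_complex R)). Qed.

Lemma usubmx_complex_comb (A B C D : 'cV[R]_(n + n)) :
  usubmx (to_complex (A - B) + 'i%C *: to_complex (C + D)) =
  to_complex (usubmx A - usubmx B) + 'i%C *: to_complex (usubmx C + usubmx D).
Proof. by apply/colP => i; rewrite !mxE. Qed.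

Lemma courant_complex_vec (A B C D : M -> 'cV[R]_n) x :
  let s (Z : M -> 'cV[R]_n) := fun z => col_mx (Z z) (0 : 'cV[R]_n) in
  usubmx (to_complex (courant (s A) (s C) x - courant (s B) (s D) x)
          + 'i%C *: to_complex (courant (s A) (s D) x + courant (s B) (s C) x)) =
  to_complex (lie_bracket A C x - lie_bracket B D x)
  + 'i%C *: to_complex (lie_bracket A D x + lie_bracket B C x).
Proof.
move=> s; apply: etrans (usubmx_complex_comb _ _ _ _) _.
exact: (congr2 (fun P Q => to_complex P + 'i%C *: to_complex Q)
  (congr2 (fun P Q => P - Q) (courant_vec A C x) (courant_vec B D x))
  (congr2 (fun P Q => P + Q) (courant_vec A D x) (courant_vec B C x))).
Qed.

Lemma complex_eigen_closed_vec (r t : M -> 'M[R]_n) c :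
  complex_eigen_closed (@smooth_gvec R n M) (@courant R n M)
    (fun x => block_mx (r x) 0 0 (t x)) c ->
  complex_eigen_closed (@smooth_vec R n M) (@lie_bracket R n M) r c.
Proof.
move=> H X Y reX imX reY imY rX rY x.
pose s (Z : M -> 'cV[R[i]]_n) p : 'cV[R[i]]_(n + n) := col_mx (Z p) 0.
have reE Z : re_part (s Z) = fun p => col_mx (re_part Z p) 0.
  by apply/funext => p; rewrite /re_part /s map_col_mx; congr col_mx;
     apply/matrixP => i j; rewrite !mxE.
have imE Z : im_part (s Z) = fun p => col_mx (im_part Z p) 0.
  by apply/funext => p; rewrite /im_part /s map_col_mx; congr col_mx;
     apply/matrixP => i j; rewrite !mxE.
have sc (Z : M -> 'cV[R]_n) : smooth_vec Z -> smooth_gvec (fun z => col_mx (Z z) 0).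
  by move=> sZ; apply: smooth_gvec_col => //; exact: smooth_covec0.
have blockE p : to_complex (block_mx (r p) 0 0 (t p)) =
    block_mx (to_complex (r p)) 0 0 (to_complex (t p)).
  by rewrite /to_complex map_block_mx -!/(to_complex _) !to_complex0.
have eigc Z : (forall p, to_complex (r p) *m Z p = c *: Z p) ->
    forall p, to_complex (block_mx (r p) 0 0 (t p)) *m s Z p = c *: s Z p.
  by move=> rZ p; rewrite blockE mulmx_block_col0 rZ mulmx0 scale_col_mx scaler0.
have sre Z : smooth_vec (re_part Z) -> smooth_gvec (re_part (s Z)) by rewrite reE; exact: sc.
have sim Z : smooth_vec (im_part Z) -> smooth_gvec (im_part (s Z)) by rewrite imE; exact: sc.
have := H _ _ (sre X reX) (sim X imX) (sre Y reY) (sim Y imY) (eigc X rX) (eigc Y rY) x.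
have -> : complex_bracket (@courant R n M) (s X) (s Y) x = col_mx
    (complex_bracket (@lie_bracket R n M) X Y x)
    (dsubmx (complex_bracket (@courant R n M) (s X) (s Y) x)).
  rewrite -[LHS]vsubmxK; congr col_mx.
  by rewrite /complex_bracket !reE !imE; exact: courant_complex_vec.
rewrite blockE mulmx_block_col0 scale_col_mx.
by move=> /eq_col_mx[].
Qed.

Lemma smooth_projector (r : M -> 'M[R]_n) (c : R) : smooth_end r ->
  smooth_end (fun x => 2^-1 *: (1%:M + c *: r x)).
Proof.
move=> sr q; have oq := @chart_img_open _ _ M q.
have H : smooth (chart_img q) (fun y => 2^-1 *: (1%:M + c *: end_in r q y)).
  apply: (@smoothZ _ _ _ _ _ (fun=> 2^-1)) => // [k|]; first exact: Ck_cst.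
  apply: smoothD => //; first exact: smooth_cst.
  exact: (@smoothZ _ _ _ _ _ (fun=> c) _ oq (fun k => @Ck_cst _ _ k _ c) (sr q)).
apply: smooth_eq H => // y [x qx <-]; rewrite !end_in_chart //.
rewrite -scalemxAr -scalemxAl mulmxDr mulmxDl mulmx1 transitionK //; last exact: dom_center.
by rewrite -scalemxAr -scalemxAl.
Qed.

(** As [c ^+ 2 = 1], the matrix [(1 + c r) / 2] is the projector onto the [c]-eigenspace, smooth
    wherever [r] is; this reduces the claim to Frobenius' theorem for projectors. *)
Lemma frobenius_eigen (r : M -> 'M[R]_n) (c : R) : c * c = 1 -> smooth_end r ->
  (forall x, r x *m r x = 1%:M) ->
  eigen_closed (@smooth_vec R n M) (@lie_bracket R n M) r c ->
  integrable_distribution (eigendistribution r c).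
Proof.
move=> cc sr rr H.
have projE (x : M) (v : 'cV[R]_n) :
    (2^-1 *: (1%:M + c *: r x)) *m v = v <-> r x *m v = c *: v.
  rewrite -scalemxAl mulmxDl mul1mx -scalemxAl; split => [E|->].
    have {}E : v + c *: (r x *m v) = v + v.
      have := congr1 (fun w => 2 *: w) E.
      by rewrite scalerA divff ?scale1r ?pnatr_eq0 // => ->; rewrite -mulr2n scaler_nat.
    by rewrite -[LHS]scale1r -cc -scalerA (addrI v E).
  rewrite scalerA cc scale1r; have -> : v + v = 2 *: v by rewrite scaler_nat mulr2n.
  by rewrite scalerA mulVf ?scale1r // pnatr_eq0.
have -> : eigendistribution r c = fun x => [set v | (2^-1 *: (1%:M + c *: r x)) *m v = v].
  by apply/funext => x; apply/seteqP; split => v /projE.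
apply: frobenius; first exact: smooth_projector.
- move=> x; rewrite -scalemxAl -scalemxAr scalerA.
  have -> : (1%:M + c *: r x) *m (1%:M + c *: r x) = 2 *: (1%:M + c *: r x).
    rewrite mulmxDl mul1mx mulmxDr mulmx1 -scalemxAl -scalemxAr rr !scalerA cc scale1r.
    by rewrite [c *: r x + _]addrC scaler_nat mulr2n.
  by rewrite scalerA -mulrA mulVf ?mulr1 // pnatr_eq0.
- move=> X Y sX sY eX eY x; rewrite scale1r; apply/projE; apply: H => // p; apply/projE.
    by rewrite -[RHS]scale1r.
  by rewrite -[RHS]scale1r.
Qed.

End Generalized.

(** * Skew-symmetry, eigenspaces and split isomorphisms of block matrices *)

Section LinearAlgebraFacts.
Variables (R : realType) (n : nat).

Lemma pairing_entry (A : 'M[R]_n) (i j : 'I_n) :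
  pairing (delta_mx i 0) (A *m delta_mx j 0) = A i j.
Proof. by rewrite /pairing trmx_delta mulmxA -rowE -colE !mxE. Qed.

Lemma pairing_sym (u v : 'cV[R]_n) : pairing u v = pairing v u.
Proof. by rewrite /pairing !mxE; apply: eq_bigr => i _; rewrite !mxE mulrC. Qed.

Lemma pairing0 (v : 'cV[R]_n) : pairing 0 v = 0.
Proof. by rewrite /pairing trmx0 mul0mx mxE. Qed.

Lemma skew_diag (r t : 'M[R]_n) :
  skew_for (@split_form R n) (block_mx r 0 0 t) -> t = - r^T.
Proof.
move=> S; apply/matrixP => i j.
have := S (col_mx (delta_mx i 0) 0) (col_mx 0 (delta_mx j 0)).
rewrite !mulmx_block_col0 !mulmx0 /split_form !col_mxKu !col_mxKd !pairing0 !addr0.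
rewrite pairing_entry pairing_sym pairing_entry !mxE => ->.
by rewrite opprK.
Qed.

Lemma skew_antidiag (p f : 'M[R]_n) :
  skew_for (@split_form R n) (block_mx 0 p f 0) -> f^T = - f.
Proof.
move=> S; apply/matrixP => i j.
have := S (col_mx (delta_mx i 0) 0) (col_mx (delta_mx j 0) 0).
rewrite !mulmx_antiblock_col !mulmx0 /split_form !col_mxKu !col_mxKd !pairing0 !addr0 !add0r.
by rewrite pairing_sym pairing_entry pairing_sym pairing_entry !mxE.
Qed.

Lemma rank_similar (a : nat) (G A B : 'M[R]_a) : G \in unitmx -> G *m A = B *m G ->
  \rank A = \rank B.
Proof.
move=> uG E; have uG' := uG; rewrite -row_full_unit in uG; rewrite -row_free_unit in uG'.
by rewrite -(eqmxMfull A uG) E mxrankMfree.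
Qed.

Lemma eigenspace_rank (F : fieldType) (a : nat) (A : 'M[F]_a) (c : F) :
  \rank (eigenspace A c) = (a - \rank (A - c%:M)%R)%N.
Proof. exact: mxrank_ker. Qed.

(** Conjugation by [G] turns [r] into [- r^T], so [r + 1] and [r^T - 1] have the same rank: the
    eigenvalues 1 and -1 are exchanged. *)
Lemma skew_eigenspaces (G r : 'M[R]_n) : G \in unitmx -> G *m r = - r^T *m G ->
  \rank (eigenspace r^T 1) = \rank (eigenspace r^T (-1)).
Proof.
move=> uG E; rewrite !eigenspace_rank; congr (_ - _)%N.
have -> : r^T - (-1)%:M = (r + 1%:M)^T by rewrite linearD /= trmx1 raddfN opprK.
rewrite mxrank_tr -(mxrank_opp (r^T - _)); apply/esym/(rank_similar uG).
by rewrite mulmxDr E mulmx1 opprB mulmxBl mul1mx addrC mulNmx.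
Qed.

Lemma eigenvalue_rank (F : fieldType) (a : nat) (A : 'M[F]_a) (c : F) :
  eigenvalue A c = (0 < \rank (eigenspace A c))%N.
Proof. by rewrite /eigenvalue lt0n mxrank_eq0. Qed.

(** Both diagonal blocks are similar to [k *: A], so the [c]-eigenspace of the block matrix has
    twice the dimension of the [k c]-eigenspace of [A], where [k] is its own inverse. Halving
    dimensions transfers the splitting. *)
Lemma split_iso_block (k : R) (A B W : 'M[R]_n) : k * k = 1 -> W \in unitmx ->
  A *m A = 1%:M -> B = W *m (k *: A) *m invmx W ->
  split_iso (block_mx (k *: A) 0 0 B) -> split_iso A.
Proof.
move=> kk uW AA BE; have k0 : k != 0.
  by apply/eqP => k0; move: kk; rewrite k0 mul0r => /esym/eqP; rewrite oner_eq0.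
case=> -[ZZ [a [b [ab ev rk]]]]; last first.
  (* Square -1 is impossible since the upper block squares to 1. The eigenvalue [a] ensures [n > 0];
     for empty matrices [1 = -1] would be no contradiction. *)
  exfalso; move: ZZ ev; rewrite mulmx_block !(mul0mx, mulmx0, addr0).
  rewrite -scalemxAl -scalemxAr scalerA kk scale1r AA => /(congr1 (@ulsubmx _ _ _ _ _)).
  rewrite block_mxKul scalar_mx_block block_mxKul => E ev.
  have := (ev a).2 (or_introl erefl); rewrite eigenvalue_rank.
  move=> h; have := leq_trans h (rank_leq_row _); rewrite addnn double_gt0 => n0.
  have := congr1 (fun Z : 'M[R]_n => Z (Ordinal n0) (Ordinal n0)) E.
  by rewrite !mxE eqxx !mulr1n => /eqP; rewrite -subr_eq0 opprK -mulr2n pnatr_eq0.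
left; split=> //.
have rkZ c : \rank (eigenspace (block_mx (k *: A) 0 0 B)^T c) =
    ((\rank (eigenspace A^T (k * c)%R)).*2)%N.
  rewrite !eigenspace_rank tr_block_mx !trmx0 scalar_mx_block opp_block_mx add_block_mx.
  rewrite !oppr0 !addr0 rank_diag_block_mx.
  have r1 : \rank ((k *: A)^T - c%:M) = \rank (A^T - (k * c)%:M).
    rewrite -[RHS](eqmx_scale _ k0); congr (\rank _).
    by rewrite scalerBr linearZ /= scale_scalar_mx mulrA kk mul1r.
  have r2 : \rank (B^T - c%:M) = \rank (A^T - (k * c)%:M).
    rewrite -r1 -[LHS]mxrank_tr -[RHS]mxrank_tr !linearB /= !trmxK !tr_scalar_mx.
    apply/esym/(rank_similar uW).
    by rewrite mulmxBl mulmxBr BE mulmxKV // mul_mx_scalar mul_scalar_mx.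
  rewrite r1 r2 -addnn; have := rank_leq_row (A^T - (k * c)%:M).
  by move=> h; rewrite subnDA -addnBA // addnC -addnBA // addnC.
have kK c : k * (k * c) = c by rewrite mulrA kk mul1r.
exists (k * a), (k * b); split.
- by apply: contra ab => /eqP/(mulfI k0) ->.
- move=> c; have := ev (k * c); rewrite !eigenvalue_rank rkZ kK double_gt0 => h.
  split=> [/h[<-|<-]|ce]; rewrite ?kK; [by left|by right|].
  by apply/h; case: ce => ->; rewrite kK; [left|right].
- by apply: double_inj; rewrite -!rkZ.
Qed.

End LinearAlgebraFacts.

(** * Graphs of forms *)

Section ClosedForm.
Variables (R : realType) (n : nat) (M : manifold R n) (theta : M -> 'M[R]_n).
Hypothesis theta_smooth : smooth_form theta.
Local Notation e_ := (basis_vec R).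
Local Notation F x := (flat (theta x)).

Lemma covec_in_flat (X : M -> 'cV[R]_n) (a : R) q y : chart_img q y ->
  covec_in (fun x => a *: (F x *m X x)) q y =
  a *: ((form_in theta q y)^T *m vec_in X q y).
Proof.
move=> [x qx <-]; rewrite /covec_in /form_in /vec_in (chartK qx) -scalemxAr; congr (_ *: _).
rewrite !trmx_mul trmxK -!mulmxA; congr (_ *m (_ *m _)).
by rewrite mulmxA transitionK ?mul1mx //; exact: dom_center.
Qed.

Lemma smooth_section (X : M -> 'cV[R]_n) (a0 a : R) : smooth_vec X ->
  smooth_gvec (fun x => col_mx (a0 *: X x) (a *: (F x *m X x))).
Proof.
move=> sX; apply: smooth_gvec_col => q; have oq := @chart_img_open _ _ M q.
  have H := @smoothZ _ _ _ _ _ (fun=> a0) _ oq (fun k => @Ck_cst _ _ k _ a0) (sX q).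
  by apply: smooth_eq H => // y _; rewrite /vec_in -scalemxAr.
have H := @smoothZ _ _ _ _ _ (fun=> a) _ oq (fun k => @Ck_cst _ _ k _ a)
  (smoothM oq (smooth_tr (theta_smooth q)) (sX q)).
by apply: smooth_eq H => // y qy; rewrite covec_in_flat.
Qed.

Section AtPoint.
Variable p : M.
Let y := chart p p.
Let pp : chart_dom p p := dom_center p.
Let D (l a b : 'I_n) : R := 'D_(e_ l) (fun z => form_in theta p z a b) y.
Variables (i j : 'I_n) (X Y : M -> 'cV[R]_n).
Hypothesis X_near : \forall z \near y, vec_in X p z = e_ i.
Hypothesis Y_near : \forall z \near y, vec_in Y p z = e_ j.

Let near_img : \forall z \near y, chart_img p z.
Proof. exact: (open_nbhs_nbhs (conj (@chart_img_open _ _ M p) (chart_img_in pp))). Qed.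

Let form_derivable l a b : derivable (fun z => form_in theta p z a b) y (e_ l).
Proof.
apply: (Ck_derivable (U := chart_img p) (theta_smooth p a b 1%N)); exact: chart_img_in.
Qed.

Let jac0 (Z : M -> 'cV[R]_n) (c : R) k : (\forall z \near y, vec_in Z p z = e_ k) ->
  jac (vec_in (fun x => c *: Z x) p) y = 0.
Proof.
move=> Zk; rewrite (@jac_near _ _ _ _ (fun=> c *: e_ k)) ?jac_cst //.
by apply: filterS Zk => z <-; rewrite /vec_in -scalemxAr.
Qed.

Let vec_val (Z : M -> 'cV[R]_n) (c : R) k : (\forall z \near y, vec_in Z p z = e_ k) ->
  vec_in (fun x => c *: Z x) p y = c *: e_ k.
Proof. by move=> /nbhs_singleton <-; rewrite /vec_in -scalemxAr. Qed.

Let lie_entry (Z W : M -> 'cV[R]_n) (c a : R) k m l :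
  (\forall z \near y, vec_in Z p z = e_ k) -> (\forall z \near y, vec_in W p z = e_ m) ->
  lie_derivative (fun x => c *: Z x) (fun x => a *: (F x *m W x)) p l 0 = c * a * D k m l.
Proof.
move=> Zk Wm; rewrite /lie_derivative -/y (jac0 c Zk) trmx0 mul0mx addr0 (vec_val c Zk).
rewrite -scalemxAr mxE /basis_vec -colE mxE -mulrA; congr (_ * _); rewrite mxE.
have -> : 'D_(e_ k) (fun z => covec_in (fun x => a *: (F x *m W x)) p z l 0) y =
    'D_(e_ k) (a \*: (fun z => form_in theta p z m l)) y.
  apply: near_eq_derive; apply: filterS2 near_img Wm => z pz Wz.
  by rewrite covec_in_flat // Wz /basis_vec -colE 3!mxE.
by rewrite deriveZ //; exact: form_derivable.
Qed.

(** Coordinate fields have constant components near [p], so the vector part vanishes and only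
    derivatives of [theta] survive. The four scalars let the formula apply to real and imaginary
    parts of complex sections separately. *)
Lemma courant_coordinate_fields (a0 a b0 b : R) :
  courant (fun x => col_mx (a0 *: X x) (a *: (F x *m X x)))
          (fun x => col_mx (b0 *: Y x) (b *: (F x *m Y x))) p =
  col_mx 0 (\col_l (a0 * b * D i j l - b0 * a * D j i l
                    - 2^-1 * (b * a0 * D l j i - a * b0 * D l i j))).
Proof.
have uE (f g : M -> 'cV[R]_n) : (fun x => usubmx (col_mx (f x) (g x))) = f.
  by apply/funext => x; rewrite col_mxKu.
have dE (f g : M -> 'cV[R]_n) : (fun x => dsubmx (col_mx (f x) (g x))) = g.
  by apply/funext => x; rewrite col_mxKd.
rewrite /courant !uE !dE; congr col_mx.
  by rewrite /lie_bracket -/y (jac0 a0 X_near) (jac0 b0 Y_near) !mul0mx subrr.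
apply/colP => l; have entry (U V W : 'cV[R]_n) : (U - V - W) l 0 = U l 0 - V l 0 - W l 0.
  by rewrite !mxE.
rewrite entry (lie_entry a0 b l X_near Y_near) (lie_entry b0 a l Y_near X_near) [RHS]mxE.
congr (_ - _); rewrite mxE; congr (_ * _); rewrite mxE.
have pairE (Z W : M -> 'cV[R]_n) (c e : R) k m z : chart_img p z ->
    vec_in Z p z = e_ k -> vec_in W p z = e_ m ->
    pairing (c *: (F (chart_inv p z) *m Z (chart_inv p z))) (e *: W (chart_inv p z)) =
    c * e * form_in theta p z k m.
  move=> [x px <-] Zk Wm; rewrite !chartK // in Zk Wm *.
  have xx := dom_center x.
  have solve (V : M -> 'cV[R]_n) v : vec_in V p (chart p x) = v -> V x = transition p x x *m v.
    by rewrite vec_in_chart // => <-; rewrite mulmxA transitionK ?mul1mx.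
  rewrite (solve _ _ Zk) (solve _ _ Wm) /form_in chartK // /pairing.
  set U := F x *m _; set V := transition p x x *m e_ m.
  rewrite [(c *: U)^T]linearZ /= -scalemxAl -scalemxAr scalerA mxE; congr (_ * _).
  rewrite {}/U {}/V.
  rewrite !trmx_mul /flat trmxK /basis_vec trmx_delta !mulmxA -colE mxE.
  by rewrite -!mulmxA -rowE mxE.
transitivity ('D_(e_ l) ((b * a0) \*: (fun z => form_in theta p z j i) -
   (a * b0) \*: (fun z => form_in theta p z i j)) y).
  apply: near_eq_derive; apply: filterS3 near_img X_near Y_near => z pz Xz Yz.
  rewrite !col_mxKd !col_mxKu.
  by rewrite (pairE Y X b a0 j i z pz Yz Xz) (pairE X Y a b0 i j z pz Xz Yz).
rewrite deriveB; [|exact/derivableZ/form_derivable|exact/derivableZ/form_derivable].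
by rewrite !deriveZ //; exact: form_derivable.
Qed.

End AtPoint.

Lemma coordinate_field p i : exists2 X : M -> 'cV[R]_n, smooth_vec X &
  \forall z \near chart p p, vec_in X p z = e_ i.
Proof.
apply: (@vec_extension _ _ M p (chart_img p) (fun=> e_ i)) => //.
- exact: chart_img_open.
- exact: smooth_cst.
- exact/chart_img_in/dom_center.
Qed.

Hypothesis theta_skew : forall x, (theta x)^T = - theta x.

(** Skew-symmetry turns the half-difference into [- D l i j] and [- D j i l] into [D j l i], so the
    expression is the cyclic sum defining d theta. *)
Lemma closed_of_courant :
  (forall p i j l, let D (l a b : 'I_n) :=
     'D_(e_ l) (fun z => form_in theta p z a b) (chart p p) in
     D i j l - D j i l - 2^-1 * (D l j i - D l i j) = 0) ->
  closed_2form theta.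
Proof.
move=> H p i j k d; have := H p i j k; rewrite /= -!/(d _ _ _).
have skew l a b : d l a b = - d l b a.
  have sk : (fun z => form_in theta p z a b) = - (fun z => form_in theta p z b a).
    apply/funext => z; rewrite /form_in; set T := transition _ _ _.
    transitivity ((T^T *m theta (chart_inv p z) *m T)^T b a); first by rewrite [RHS]mxE.
    by rewrite !trmx_mul trmxK theta_skew mulNmx mulmxN mulmxA mxE.
  rewrite /d sk deriveN //.
  apply: (Ck_derivable (U := chart_img p) (theta_smooth p b a 1%N)).
  exact/chart_img_in/dom_center.
rewrite (skew k j i) (skew j i k); move: (d i j k) (d j k i) (d k i j) => A B C.
by move=> h; rewrite -[RHS]h; field.
Qed.

(** The 1-eigenbundle is the graph of [F]. Stating the lemma for the eigenvalue 1 alone covers the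
    (+)-integrable case as well. *)
Lemma closed_paracomplex (q : M -> 'M[R]_n) : (forall x, q x *m F x = 1%:M) ->
  eigen_closed (@smooth_gvec R n M) (@courant R n M) (fun x => block_mx 0 (q x) (F x) 0) 1 ->
  closed_2form theta.
Proof.
move=> qF H; apply: closed_of_courant => p i j l /=.
have [X sX Xn] := coordinate_field p i; have [Y sY Yn] := coordinate_field p j.
have eig (Z : M -> 'cV[R]_n) x : block_mx 0 (q x) (F x) 0 *m
    col_mx (1 *: Z x) (1 *: (F x *m Z x)) = 1 *: col_mx (1 *: Z x) (1 *: (F x *m Z x)).
  by rewrite mulmx_antiblock_col !scale1r mulmxA qF mul1mx.
have := H _ _ (smooth_section 1 1 sX) (smooth_section 1 1 sY) (eig X) (eig Y) p.
(* The bracket is a pure covector, which the antidiagonal matrix sends to a pure vector; being an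
   eigenvector, it is zero. *)
rewrite (courant_coordinate_fields Xn Yn) mulmx_antiblock_col mulmx0 scale1r.
by move=> /eq_col_mx[_] /colP/(_ l); rewrite [LHS]mxE [RHS]mxE !mul1r => <-.
Qed.

Lemma re_part_comb (a : nat) (A B : M -> 'cV[R]_a) :
  re_part (fun x => to_complex (A x) + 'i%C *: to_complex (B x)) = A.
Proof.
apply/funext => x; apply/matrixP => i j; rewrite !mxE /=.
by rewrite !(mul0r, mulr0, subr0, addr0).
Qed.

Lemma im_part_comb (a : nat) (A B : M -> 'cV[R]_a) :
  im_part (fun x => to_complex (A x) + 'i%C *: to_complex (B x)) = B.
Proof.
apply/funext => x; apply/matrixP => i j; rewrite !mxE /=.
by rewrite !(mul0r, mulr0, mul1r, add0r, addr0).
Qed.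

Lemma to_complexN (a b : nat) (A : 'M[R]_(a, b)) : to_complex (- A) = - to_complex A.
Proof. exact: (map_mxN (real_complex R)). Qed.

Lemma ii_mul : ('i * 'i)%C = -1 :> R[i].
Proof. by apply/eqP; rewrite eq_complex /= !(mul0r, mulr0, mul1r, addr0, sub0r) oppr0 !eqxx. Qed.

Lemma closed_complex (q : M -> 'M[R]_n) : (forall x, q x *m F x = (-1)%:M) ->
  complex_eigen_closed (@smooth_gvec R n M) (@courant R n M)
    (fun x => block_mx 0 (q x) (F x) 0) 'i%C ->
  closed_2form theta.
Proof.
move=> qF H; apply: closed_of_courant => p i j l /=.
have [X sX Xn] := coordinate_field p i; have [Y sY Yn] := coordinate_field p j.
(* The [i]-eigenbundle consists of the sections [Z - i F Z], with real part [A Z] and imaginary part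
   [B Z]; the scalars 1, 0 and -1 match the form of [courant_coordinate_fields]. *)
pose A (Z : M -> 'cV[R]_n) x := col_mx (1 *: Z x) (0 *: (F x *m Z x)).
pose B (Z : M -> 'cV[R]_n) x := col_mx (0 *: Z x) (-1 *: (F x *m Z x)).
pose s (Z : M -> 'cV[R]_n) x := to_complex (A Z x) + 'i%C *: to_complex (B Z x).
have SA (Z : M -> 'cV[R]_n) x : block_mx 0 (q x) (F x) 0 *m A Z x = - B Z x.
  by rewrite mulmx_antiblock_col /B !scale1r !scale0r mulmx0 opp_col_mx oppr0 scaleN1r opprK.
have SB (Z : M -> 'cV[R]_n) x : block_mx 0 (q x) (F x) 0 *m B Z x = A Z x.
  rewrite mulmx_antiblock_col /A !scale1r !scale0r mulmx0 scaleN1r mulmxN mulmxA qF.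
  by rewrite mul_scalar_mx scaleN1r opprK.
have eig Z x : to_complex (block_mx 0 (q x) (F x) 0) *m s Z x = 'i%C *: s Z x.
  rewrite /s mulmxDr -scalemxAr -!to_complexM SA SB scalerDr scalerA ii_mul to_complexN.
  by rewrite scaleN1r addrC.
have sA Z : smooth_vec Z -> smooth_gvec (re_part (s Z)).
  by move=> sZ; rewrite re_part_comb; exact: smooth_section.
have sB Z : smooth_vec Z -> smooth_gvec (im_part (s Z)).
  by move=> sZ; rewrite im_part_comb; exact: smooth_section.
have := H _ _ (sA X sX) (sB X sX) (sA Y sY) (sB Y sY) (eig X) (eig Y) p.
rewrite /complex_bracket !re_part_comb !im_part_comb.
rewrite !(courant_coordinate_fields Xn Yn) opp_col_mx !add_col_mx oppr0 !addr0.
(* The brackets of two vectors and of two covectors vanish here, so the real part [u] is zero and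
   the complex bracket is [i] times the pure covector [w]; the eigenvalue equation then forces
   [w = 0]. *)
set u := (\col_l _ - _); set w := (\col_l _ + _).
have u0 : u = 0.
  by apply/colP => l'; rewrite !mxE !(mul0r, mulr0, subr0, oppr0, mulN1r, mul1r).
have blockE : to_complex (block_mx 0 (q p) (F p) 0) =
    block_mx 0 (to_complex (q p)) (to_complex (F p)) 0.
  by rewrite /to_complex map_block_mx -!/(to_complex _) !to_complex0.
have colE (v : 'cV[R]_n) : to_complex (col_mx (0 : 'cV[R]_n) v) = col_mx 0 (to_complex v).
  by rewrite /to_complex map_col_mx -!/(to_complex _) to_complex0.
have ReE (v : 'cV[R]_n) l' : complex.Re (to_complex v l' 0) = v l' 0 by rewrite mxE.
rewrite u0 blockE !colE to_complex0 col_mx0 add0r scale_col_mx scaler0.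
rewrite mulmx_antiblock_col mulmx0 scale_col_mx scalerA ii_mul scaleN1r.
move=> /eq_col_mx[_] /eqP; rewrite eq_sym oppr_eq0 => /eqP/colP/(_ l).
move=> /(congr1 (@complex.Re R)); rewrite ReE [X in _ = complex.Re X]mxE /= /w.
rewrite !mxE !(mul0r, mulr0, subr0, sub0r, oppr0, mulN1r, mul1r, mulr1, addr0, add0r) => w0.
apply/eqP; rewrite -oppr_eq0; apply/eqP; rewrite -[RHS]w0.
by move: ('D_(e_ i) _ _) ('D_(e_ j) _ _) ('D_(e_ l) _ _) ('D_(e_ l) _ _) => a b c e; ring.
Qed.

End ClosedForm.

(** * The interpolation theorem *)

Section Interpolation.
Variables (R : realType) (n : nat) (M : manifold R n).
Variable omega : M -> 'M[R]_n.
Hypothesis omega_symplectic : symplectic omega.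

Lemma omega_skew x : (omega x)^T = - omega x.
Proof. by case: omega_symplectic. Qed.

Lemma omega_unit x : omega x \in unitmx.
Proof. by case: omega_symplectic. Qed.

Lemma flat_omega_unit x : flat (omega x) \in unitmx.
Proof. by rewrite unitmx_tr omega_unit. Qed.

(** With [W = flat omega], the lower left block of the commutation relation is [t W = W r], and
    skew-symmetry for the split form gives [t = - r^T]. The sign in [W = - omega] cancels. *)
Lemma commute_diag (k : R) (r t : M -> 'M[R]_n) x :
  block_mx (r x) 0 0 (t x) *m Imx omega k x = Imx omega k x *m block_mx (r x) 0 0 (t x) ->
  skew_for (@split_form R n) (block_mx (r x) 0 0 (t x)) ->
  omega x *m r x = - (r x)^T *m omega x.
Proof.
move=> C /skew_diag tE; move: C; rewrite /Imx !mulmx_block !(mul0mx, mulmx0, addr0, add0r).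
move=> /eq_block_mx[_ _ + _]; rewrite tE /flat omega_skew mulmxN mulNmx opprK => E.
by rewrite E mulNmx opprK.
Qed.

Lemma skew_for_omega (r : M -> 'M[R]_n) x :
  omega x *m r x = - (r x)^T *m omega x -> skew_for (bilin (omega x)) (r x).
Proof.
move=> E u v; rewrite /bilin trmx_mul -!mulmxA [omega x *m (r x *m v)]mulmxA E.
by rewrite !mulNmx mulmxN [X in - X]mxE opprK !mulmxA.
Qed.

Lemma flat_skew (G : 'M[R]_n) : (flat G)^T = - flat G -> G^T = - G.
Proof. by rewrite /flat trmxK => E; rewrite [in RHS]E opprK. Qed.

Lemma square_diag (a : R) (r t : 'M[R]_n) :
  block_mx r 0 0 t *m block_mx r 0 0 t = a%:M -> r *m r = a%:M.
Proof.
rewrite mulmx_block !(mul0mx, mulmx0, addr0, add0r) scalar_mx_block.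
by move=> /eq_block_mx[].
Qed.

Lemma square_antidiag (a : R) (p f : 'M[R]_n) :
  block_mx 0 p f 0 *m block_mx 0 p f 0 = a%:M -> p *m f = a%:M.
Proof.
rewrite mulmx_block !(mul0mx, mulmx0, addr0, add0r) scalar_mx_block.
by move=> /eq_block_mx[].
Qed.

(** Put [W = flat omega], [F = flat theta] and [A = W^-1 F]. Commutation gives [p W = k A]; with
    [p F = lambda] this yields [k A^2 = lambda], that is [A^2 = ell]. The product of [I_k] and [S]
    is block diagonal with blocks [k A] and [W p = W (k A) W^-1], so its splitting descends to
    [A]. *)
Lemma antidiag_0_ell (lambda ell : R) (p theta : M -> 'M[R]_n) :
  lambda * lambda = 1 -> ell * ell = 1 ->
  let S x := block_mx 0 (p x) (flat (theta x)) 0 in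
  almost_generalized lambda S -> closed_2form theta ->
  (forall x, S x *m Imx omega (lambda * ell) x = Imx omega (lambda * ell) x *m S x) ->
  (forall x, split_iso (Imx omega (lambda * ell) x *m S x)) ->
  integrable_0_ell omega ell theta.
Proof.
move=> ll ee S [sS SS _ skS] closed C spl; set k := lambda * ell in C spl.
have kk : k * k = 1 by rewrite /k mulrACA ll ee mulr1.
have l0 : lambda != 0.
  by apply/eqP => l0; move: ll; rewrite l0 mul0r => /esym/eqP; rewrite oner_eq0.
have pF x : p x *m flat (theta x) = lambda%:M by exact: square_antidiag (SS x).
have Fu x : flat (theta x) \in unitmx.
  have : (lambda^-1 *: p x) *m flat (theta x) = 1%:M.
    by rewrite -scalemxAl pF scale_scalar_mx mulVf.
  by move=> /mulmx1_unit[].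
split; first split => //.
- exact: smooth_form_dl sS.
- by move=> x; apply: flat_skew; exact: skew_antidiag (skS x).
- by move=> x; have := Fu x; rewrite unitmx_tr.
pose W x := flat (omega x); pose A x := invmx (W x) *m flat (theta x).
have uW x : W x \in unitmx by exact: flat_omega_unit.
have FA x : flat (theta x) = W x *m A x by rewrite /A mulKVmx.
have pW x : p x *m W x = k *: A x.
  have := C x; rewrite /S /Imx !mulmx_block !(mul0mx, mulmx0, addr0, add0r).
  by move=> /eq_block_mx[+ _ _ _]; rewrite -scalemxAl.
have Wp x : W x *m p x = W x *m (k *: A x) *m invmx (W x) by rewrite -pW mulmxA mulmxK.
have AA x : A x *m A x = ell%:M.
  have : k *: (A x *m A x) = lambda%:M by rewrite scalemxAl -pW -mulmxA -FA pF.
  move=> /(congr1 (fun Z => k *: Z)); rewrite scalerA kk scale1r => ->.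
  by rewrite scale_scalar_mx /k mulrAC ll mul1r.
exists A => x; split => // e1.
apply: (split_iso_block kk (uW x) _ (Wp x)); first by rewrite AA e1.
have := spl x; rewrite /S /Imx mulmx_block !(mul0mx, mulmx0, addr0, add0r).
by rewrite -scalemxAl.
Qed.

Lemma diag_facts (lambda k : R) (r t : M -> 'M[R]_n) :
  let S x := block_mx (r x) 0 0 (t x) in
  almost_generalized lambda S -> (forall x, S x *m Imx omega k x = Imx omega k x *m S x) ->
  [/\ smooth_end r, forall x, r x *m r x = lambda%:M,
      forall x, omega x *m r x = - (r x)^T *m omega x &
      forall x, skew_for (bilin (omega x)) (r x)].
Proof.
move=> S [sS SS _ skS] C.
have E x : omega x *m r x = - (r x)^T *m omega x by exact: commute_diag (C x) (skS x).
split => //; first exact: smooth_end_ul sS.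
  by move=> x; exact: square_diag (SS x).
by move=> x; exact: skew_for_omega.
Qed.

End Interpolation.

Theorem theorem4p5 (R : realType) (n : nat) (M : manifold R n)
    (omega : M -> 'M[R]_n) (omega_symplectic : symplectic omega) :
  (forall lambda ell : R, lambda = 1 \/ lambda = -1 -> ell = 1 \/ ell = -1 ->
     (forall r t : M -> 'M[R]_n,
        integrable_lambda_ell omega lambda ell (fun x => block_mx (r x) 0 0 (t x)) ->
        integrable_lambda_0 omega lambda r) /\
     (forall p theta : M -> 'M[R]_n,
        integrable_lambda_ell omega lambda ell
          (fun x => block_mx 0 (p x) (flat (theta x)) 0) ->
        integrable_0_ell omega ell theta))
  /\
  (forall ell : R, ell = 1 \/ ell = -1 ->
     (forall r t : M -> 'M[R]_n,
        plus_integrable_1_ell omega ell (fun x => block_mx (r x) 0 0 (t x)) ->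
        plus_integrable_1_0 omega r) /\
     (forall p theta : M -> 'M[R]_n,
        plus_integrable_1_ell omega ell
          (fun x => block_mx 0 (p x) (flat (theta x)) 0) ->
        integrable_0_ell omega ell theta)).
Proof.
have sq (c : R) : c = 1 \/ c = -1 -> c * c = 1 by case=> ->; rewrite ?mulr1 // mulrNN mulr1.
have n11 : (-1 == 1 :> R) = false.
  by apply/eqP => /eqP; rewrite eq_sym -subr_eq0 opprK -mulr2n pnatr_eq0.
have theta_skew (p theta : M -> 'M[R]_n) lambda :
    almost_generalized lambda (fun x => block_mx 0 (p x) (flat (theta x)) 0) ->
    forall x, (theta x)^T = - theta x.
  by move=> [_ _ _ skS] x; apply: flat_skew; exact: skew_antidiag (skS x).
split=> [lambda ell hl he|ell he]; split.
- move=> r t [+ C spl]; case: hl => ->.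
    rewrite /integrable_lambda_0 eqxx => -[ag c1 c2].
    have [sr rr rE sk] := diag_facts omega_symplectic ag C.
    split=> //; split => //.
    + by apply: frobenius_eigen => //; [rewrite mulr1|exact: eigen_closed_vec c1].
    + by apply: frobenius_eigen => //; [rewrite mulrNN mulr1|exact: eigen_closed_vec c2].
    + by move=> x; exact: skew_eigenspaces (omega_unit omega_symplectic x) (rE x).
  rewrite /integrable_lambda_0 n11 => -[ag c1 c2].
  have [sr rr rE sk] := diag_facts omega_symplectic ag C.
  split=> //; split => //; [exact: complex_eigen_closed_vec c1|].
  exact: complex_eigen_closed_vec c2.
- move=> p theta [H C spl].
  have [ag cl] : almost_generalized lambda (fun x => block_mx 0 (p x) (flat (theta x)) 0)
      /\ closed_2form theta.
    case: hl H => ->.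
      rewrite eqxx => -[ag c1 _]; split => //; have [sS SS _ _] := ag.
      apply: (closed_paracomplex (smooth_form_dl sS) (theta_skew _ _ _ ag) _ c1) => x.
      exact: square_antidiag (SS x).
    rewrite n11 => -[ag c1 _]; split => //; have [sS SS _ _] := ag.
    apply: (closed_complex (smooth_form_dl sS) (theta_skew _ _ _ ag) _ c1) => x.
    exact: square_antidiag (SS x).
  exact: (antidiag_0_ell omega_symplectic (sq _ hl) (sq _ he) ag cl C spl).
- move=> r t [[ag c1] C _].
  have [sr rr rE sk] := diag_facts omega_symplectic ag C.
  split=> //.
  by apply: frobenius_eigen => //; [rewrite mulr1|exact: eigen_closed_vec c1].
- move=> p theta [[ag c1] C spl].
  have cl : closed_2form theta.
    have [sS SS _ _] := ag.
    apply: (closed_paracomplex (smooth_form_dl sS) (theta_skew _ _ _ ag) _ c1) => x.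
    exact: square_antidiag (SS x).
  apply: (antidiag_0_ell omega_symplectic (mulr1 1) (sq _ he) ag cl); rewrite mul1r //.
  (* The (+)-definition splits [S I] and not [I S]; commutation identifies them. *)
  by move=> x; rewrite -C.
Qed.
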